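(* Let $n_3, n_6, n_8, n_{10}, n_{13}$ be the five graphs on vertex set $\{1,\dots,6\}$ with ten edges each whose edge sets are listed in the context. Let $n$ be a non-negative integer. (i) For each $G \in \{n_3, n_6, n_{10}\}$ and each $n \neq 16$: a $G$-design of order $n$ exists if and only if $n \equiv 0, 1, 5$ or $16 \pmod{20}$ and $n \neq 5$. (Nothing is asserted about $n = 16$.) (ii) An $n_8$-design of order $n$ exists if and only if $n \equiv 0, 1, 5$ or $16 \pmod{20}$ and $n \notin \{5, 16\}$. (iii) An $n_{13}$-design of order $n$ exists if and only if $n \equiv 0, 1, 5$ or $16 \pmod{20}$ and $n \notin \{5, 16, 20\}$.
   Context: All graphs are simple. A decomposition of a graph $K$ into a graph $G$ is a partition of the edge set of $K$ into edge sets of subgraphs of $K$ each isomorphic to $G$. A $G$-design of order $n$ is a decomposition of the complete graph $K_n$ into $G$ (for $n \in \{0,1\}$ the graph $K_n$ has no edges and the empty decomposition counts as a design). The graphs have vertex set $\{1,2,3,4,5,6\}$ and the following edge sets: - $n_3$: $\{5,3\},\{5,2\},\{5,1\},\{4,3\},\{4,2\},\{4,1\},\{6,1\},\{3,2\},\{3,1\},\{2,1\}$; - $n_6$: $\{6,2\},\{6,3\},\{6,1\},\{5,2\},\{5,3\},\{5,1\},\{4,2\},\{4,3\},\{4,1\},\{2,1\}$; - $n_8$: $\{6,4\},\{6,2\},\{6,1\},\{5,3\},\{5,2\},\{5,1\},\{4,2\},\{4,1\},\{3,2\},\{3,1\}$; - $n_{10}$: $\{4,3\},\{4,2\},\{4,5\},\{4,1\},\{6,1\},\{3,2\},\{3,5\},\{3,1\},\{2,5\},\{2,1\}$;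 - $n_{13}$: $\{6,4\},\{6,3\},\{6,1\},\{5,3\},\{5,2\},\{5,1\},\{4,2\},\{4,1\},\{3,1\},\{2,1\}$. *)

(* Defs.v *)
From mathcomp Require Import all_boot.

Set Implicit Arguments.
Unset Strict Implicit.
Unset Printing Implicit Defensive.

(* The vertex set is a subset of T, not T itself, so that subgraphs of a graph
   on T are again graphs on T. *)
Record sgraph (T : finType) := SGraph {
  vset : {set T};
  eset : {set {set T}};
  eset_wf : forall e, e \in eset -> #|e| = 2 /\ e \subset vset
}.

Definition subgraph (T : finType) (H K : sgraph T) : Prop :=
  vset H \subset vset K /\ eset H \subset eset K.

Definition isomorphic (S T : finType) (G : sgraph S) (H : sgraph T) : Prop :=
  exists f : {x : S | x \in vset G} -> T,
    [/\ injective f,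
        [set f x | x : {x : S | x \in vset G}] = vset H &
        forall x y, ([set f x; f y] \in eset H) =
                    ([set val x; val y] \in eset G)].

Definition decomposition (S T : finType) (K : sgraph T) (G : sgraph S)
    (P : {set {set {set T}}}) : Prop :=
  partition P (eset K) /\
  forall F, F \in P ->
    exists H : sgraph T, [/\ subgraph H K, isomorphic G H & eset H = F].

Lemma complete_wf n (e : {set 'I_n}) :
  e \in [set e : {set 'I_n} | #|e| == 2] -> #|e| = 2 /\ e \subset setT.
Proof. by rewrite inE => /eqP ->; rewrite subsetT. Qed.

Definition complete (n : nat) : sgraph 'I_n := SGraph (@complete_wf n).

Definition has_design (S : finType) (G : sgraph S) (n : nat) : Prop :=
  exists P, decomposition (complete n) G P.

(* The vertex labelled k in {1, ..., 6} is the ordinal k - 1 of 'I_6. *)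
Definition edges6 (s : seq (nat * nat)) : {set {set 'I_6}} :=
  [set [set p.1; p.2] | p : 'I_6 * 'I_6 & (p.1.+1, p.2.+1) \in s].

Lemma edges6_wf s (e : {set 'I_6}) : all (fun p => p.1 != p.2) s ->
  e \in edges6 s -> #|e| = 2 /\ e \subset setT.
Proof.
move=> /allP sP /imsetP[[x y]]; rewrite inE => /sP /= xy ->.
by rewrite cards2 subsetT; move: xy; rewrite eqSS (inj_eq val_inj) => ->.
Qed.

Definition graph6 (s : seq (nat * nat)) (sP : all (fun p => p.1 != p.2) s) :
  sgraph 'I_6 := SGraph (fun e => @edges6_wf s e sP).

Definition n3 : sgraph 'I_6 := @graph6
  [:: (5, 3); (5, 2); (5, 1); (4, 3); (4, 2);
      (4, 1); (6, 1); (3, 2); (3, 1); (2, 1)] isT.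

Definition n6 : sgraph 'I_6 := @graph6
  [:: (6, 2); (6, 3); (6, 1); (5, 2); (5, 3);
      (5, 1); (4, 2); (4, 3); (4, 1); (2, 1)] isT.

Definition n8 : sgraph 'I_6 := @graph6
  [:: (6, 4); (6, 2); (6, 1); (5, 3); (5, 2);
      (5, 1); (4, 2); (4, 1); (3, 2); (3, 1)] isT.

Definition n10 : sgraph 'I_6 := @graph6
  [:: (4, 3); (4, 2); (4, 5); (4, 1); (6, 1);
      (3, 2); (3, 5); (3, 1); (2, 5); (2, 1)] isT.

Definition n13 : sgraph 'I_6 := @graph6
  [:: (6, 4); (6, 3); (6, 1); (5, 3); (5, 2);
      (5, 1); (4, 2); (4, 1); (3, 1); (2, 1)] isT.

(* Main.v *)
Require Import Defs.
From Stdlib Require Import BinPos.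
From mathcomp Require Import all_boot zify.

(* Counting edges gives 20 | n (n - 1), hence the four residues, and a block does
   not fit into 5 vertices. In the cases n = 16 and n = 20 the degree of each
   vertex restricts the numbers of blocks in which it plays each role; counting
   roles, or the edges inside the set of vertices that play the high degree roles,
   gives a contradiction.

   Existence is proved by Wilson's construction. Write n = 20 t + y + h, where
   (y, h) is (0, 0), (0, 1), (5, 0) or (15, 1) according to the residue. Give
   weight 20 to the points of a transversal design with five or six groups, after
   deleting some points of the last two, and weight y to one point of the fifth
   group; put a G-decomposition of a complete multipartite graph with parts 20^4,
   20^5, 20^6, 20^4 y or 20^5 y on each block, and fill the groups, each with h
   additional points, by smaller designs. This reduces t to about t/4; the finitely
   many ingredients and initial values are developed from base blocks under a
   cyclic group. *)

Set Implicit Arguments.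
Unset Strict Implicit.
Unset Printing Implicit Defensive.

(** * Decompositions *)

(** Decompositions are stated as identities between multiplicity functions on ordered pairs. Partial
    designs then combine by addition, and being covered exactly once becomes an equation between
    numbers. Weight 20 preserves residues: a group of total weight [20 * m] is filled, with its [h]
    additional points, by a design of order [20 * m + h], and only the fifth group sees the residue
    of [n]. The missing orders shape the recursion. For [n13], which also lacks order 20, no group
    may consist of a single point of weight 20 unless a point is added. Transversal designs with six
    groups come from lines over Z_m for every m coprime to 6; putting 0 or 7 points into the sixth
    group bridges the gaps between such m. Small t also uses five groups of 4 or 9 points, obtained
    from finite fields, and a table of direct constructions. *)

Definition labels := iota 1 6.

(* Every edge is listed in both directions, so that multiplicities are symmetric. *)
Definition arcs (T : eqType) (E : seq (nat * nat)) (f : nat -> T) : seq (T * T) :=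
  [seq (f e.1, f e.2) | e <- E ++ [seq (e.2, e.1) | e <- E]].

Definition placed (T : eqType) (D : pred T) (f : nat -> T) :=
  uniq (map f labels) && all D (map f labels).

(* [w x y] is the multiplicity of the edge [x y]; a block is an injective
   placement of the labels 1..6 into [D]. *)
Definition decomposable (E : seq (nat * nat)) (T : eqType) (D : pred T) (w : T -> T -> nat) :=
  exists B : seq (nat -> T), all (placed D) B /\
    forall x y, count_mem (x, y) (flatten (map (arcs E) B)) = w x y.

Definition wf_edges (E : seq (nat * nat)) :=
  all (fun e => (e.1 \in labels) && (e.2 \in labels)) E.

Section Dec.
Variable E : seq (nat * nat).

Lemma decomposable_ext (T : eqType) (D D' : pred T) w w' :
  D =1 D' -> (forall x y, w x y = w' x y) -> decomposable E D w -> decomposable E D' w'.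
Proof.
move=> DD ww [B [BP Bw]]; exists B; split=> [|x y]; last by rewrite Bw.
by rewrite -(@eq_all _ (placed D)) // => f; rewrite /placed (eq_all DD).
Qed.

Lemma decomposable_sub (T : eqType) (D D' : pred T) w :
  subpred D D' -> decomposable E D w -> decomposable E D' w.
Proof.
move=> DD [B [BP Bw]]; exists B; split=> //.
apply: sub_all BP => f /andP[fu fD]; rewrite /placed fu; exact: sub_all fD.
Qed.

Lemma decomposable0 (T : eqType) (D : pred T) : decomposable E D (fun _ _ => 0).
Proof. by exists [::]. Qed.

Lemma decomposable_add (T : eqType) (D : pred T) w1 w2 :
  decomposable E D w1 -> decomposable E D w2 -> decomposable E D (fun x y => w1 x y + w2 x y).
Proof.
move=> [B1 [BP1 Bw1]] [B2 [BP2 Bw2]]; exists (B1 ++ B2); split.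
  by rewrite all_cat BP1.
by move=> x y; rewrite map_cat flatten_cat count_cat Bw1 Bw2.
Qed.

Lemma decomposable_sum (T : eqType) (D : pred T) (I : eqType) (r : seq I) (w : I -> T -> T -> nat) :
  {in r, forall i, decomposable E D (w i)} -> decomposable E D (fun x y => \sum_(i <- r) w i x y).
Proof.
elim: r => [|i r IH] wr.
  by apply: decomposable_ext (decomposable0 D) => // x y; rewrite big_nil.
apply: (@decomposable_ext _ D _ (fun x y => w i x y + \sum_(i <- r) w i x y)) => //.
  by move=> x y; rewrite big_cons.
apply: decomposable_add; first by apply: wr; rewrite mem_head.
by apply: IH => j jr; apply: wr; rewrite inE jr orbT.
Qed.

Hypothesis Ewf : wf_edges E.

Lemma mem_arcs (T : eqType) (f : nat -> T) x y : (x, y) \in arcs E f ->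
  exists a b, [/\ a \in labels, b \in labels, x = f a & y = f b].
Proof.
case/mapP=> -[a b] /=; rewrite mem_cat => ab [-> ->]; exists a, b.
case/orP: ab => [/(allP Ewf)/= /andP[]//|/mapP[[c d] /(allP Ewf) /= cd [-> ->]]].
by case/andP: cd.
Qed.

Lemma all_arcs (T : eqType) (D : pred T) (B : seq (nat -> T)) :
  all (placed D) B ->
  all (fun p => D p.1 && D p.2) (flatten (map (arcs E) B)).
Proof.
elim: B => //= f B IH /andP[/andP[_ /allP fD] /IH BD]; rewrite all_cat BD andbT.
apply/allP=> -[x y] /mem_arcs[a [b [al bl -> ->]]] /=.
by rewrite !fD ?map_f.
Qed.

(** This is the tool for every change of vertices: renumbering, embedding a group into the whole,
    moving a small design onto its windows. The last hypothesis puts the support of [w'] inside the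
    image of [h], so that the image blocks cover all of it. *)
Lemma decomposable_map (T T' : eqType) (D : pred T) (D' : pred T') (h : T -> T') w w' :
    (forall x y, D x -> D y -> h x = h y -> x = y) ->
    (forall x, D x -> D' (h x)) ->
    (forall x y, D x -> D y -> w' (h x) (h y) = w x y) ->
    (forall x' y', w' x' y' != 0 ->
       exists x y, [/\ D x, D y, x' = h x & y' = h y]) ->
  decomposable E D w -> decomposable E D' w'.
Proof.
move=> hI hD hw w'0 [B [BP Bw]]; exists (map (comp h) B); split.
  rewrite all_map; apply: sub_all BP => f /andP[fu fD]; apply/andP; split.
    rewrite map_comp map_inj_in_uniq // => x y /(allP fD) xD /(allP fD) yD.
    exact: hI.
  by rewrite map_comp all_map; apply: sub_all fD => x; apply: hD.
move=> x' y'; have /allP BD := all_arcs BP.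
have -> : map (arcs E) (map (comp h) B) =
          map (map (fun p => (h p.1, h p.2))) (map (arcs E) B).
  by rewrite -!map_comp; apply: eq_map => f /=; rewrite /arcs -map_comp.
rewrite -map_flatten count_map; set A := flatten _ in BD Bw *.
(* If [w'] vanishes at a pair, an arc of [A] mapped to that pair would have positive multiplicity in
   [w], against [hw]. *)
have [w0|/w'0[x [y [xD yD -> ->]]]] := eqVneq (w' x' y') 0.
  rewrite w0; apply/eqP; rewrite eqn0Ngt -has_count; apply/hasPn => -[x y] xyA.
  have /= /andP[xD yD] := BD _ xyA.
  apply/negP => /eqP[hx hy]; move: w0; rewrite -hx -hy hw // -Bw.
  by move/eqP; rewrite eqn0Ngt -has_count has_pred1 xyA.
rewrite hw // -Bw; apply: eq_in_count => -[a b] /BD /= /andP[aD bD].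
apply/eqP/eqP=> [[/hI -> // /hI -> //]|[-> ->] //].
Qed.
End Dec.

(** * Complete graphs, group divisible designs and the filling of groups *)

Definition Kdec E n := decomposable E (fun x => x < n) (fun x y => [&& x != y, x < n & y < n]).

(* Group divisible design: the vertices are the pairs [(i, a)] with
   [a < l_i], and all edges between different parts are decomposed. *)
Definition gdd E (l : seq nat) :=
  decomposable E (fun p : nat * nat => p.2 < nth 0 l p.1)
        (fun p q => [&& p.1 != q.1, p.2 < nth 0 l p.1 & q.2 < nth 0 l q.1]).

Lemma Some_inj T : injective (@Some T).
Proof. by move=> x y []. Qed.

Section Fill.
Variable E : seq (nat * nat).
Hypothesis Ewf : wf_edges E.

Lemma Kdec_small n : n <= 1 -> Kdec E n.
Proof.
move=> n1; apply: decomposable_ext (decomposable0 _ _) => // x y /=.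
by case: eqP => //=; lia.
Qed.

Lemma Kdec_points (T : eqType) (s : seq T) :
  uniq s -> decomposable E (mem s) (fun x y => [&& x != y, x \in s & y \in s]) -> Kdec E (size s).
Proof.
move=> su; apply: (@decomposable_map _ Ewf _ _ _ _ (index^~ s)).
- by move=> x y xs ys; apply: index_inj.
- by move=> x xs; rewrite index_mem.
- by move=> x y xs ys; rewrite !index_mem (inj_in_eq (@index_inj _ x s)).
move=> x y; rewrite eqb0 negbK => /and3P[_ xs ys].
case: s su xs ys => // t s su xs ys.
by exists (nth t (t :: s) x), (nth t (t :: s) y); rewrite !index_uniq // !inE -!in_cons !mem_nth.
Qed.

Lemma points_Kdec (T : eqType) (s : seq T) : uniq s -> Kdec E (size s) ->
  decomposable E (mem s) (fun x y => [&& x != y, x \in s & y \in s]).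
Proof.
case: s => [|t s] su.
  by move=> _; apply: decomposable_ext (decomposable0 _ _) => // x y; rewrite andbF.
apply: (@decomposable_map _ Ewf _ _ _ _ (nth t (t :: s))).
- by move=> x y xs ys /eqP; rewrite nth_uniq // => /eqP.
- by move=> x xs; apply: mem_nth.
- by move=> x y xs ys; rewrite nth_uniq // !mem_nth // xs ys.
move=> x y; rewrite eqb0 negbK => /and3P[_ xs ys].
by exists (index x (t :: s)), (index y (t :: s)); rewrite !nth_index // !index_mem.
Qed.

Definition multi (T C : eqType) (s : seq T) (col : T -> C) (x y : T) : nat :=
  [&& col x != col y, x \in s & y \in s].

(** Each colour class, enlarged by the additional point [None] when [h] holds, receives its own
    design. Since at most one point is added, two enlarged classes have no edge in common, so no
    design with a hole is required. *)
Lemma fill (T C : eqType) (s : seq T) (col : T -> C) (h : bool) :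
    uniq s -> decomposable E (mem s) (multi s col) ->
    {in s, forall x, Kdec E (count (fun y => col y == col x) s + h)} ->
  Kdec E (size s + h).
Proof.
move=> su sd sK.
pose so := map Some s; pose s' := so ++ nseq h None.
have s'u : uniq s'.
  have : None \notin so by apply/negP => /mapP[].
  rewrite cat_uniq map_inj_uniq ?su => [|? ? []] //.
  by case: (h) => //= /negbTE ->.
have -> : size s + h = size s' by rewrite size_cat size_map size_nseq.
apply: Kdec_points => //.
pose cs := undup (map col s).
pose g c := map Some (filter (fun y => col y == c) s) ++ nseq h None.
pose wm (x y : option T) : nat :=
  if x is Some x then if y is Some y then multi s col x y else 0 else 0.
(* Every edge belongs to exactly one summand: to [wm] if its ends have different colours, otherwise
   to the colour of an end other than [None]. *)
apply: (@decomposable_ext _ _ (mem s') _ (fun x y =>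
  wm x y + \sum_(c <- cs) [&& x != y, x \in g c & y \in g c])) => //.
  move=> x y.
  have gS z c : (Some z \in g c) = (z \in s) && (col z == c).
    rewrite mem_cat mem_map ?mem_filter => [|? ? [] //].
    by case: (h); rewrite /= ?inE ?orbF andbC.
  have mN (r : seq T) : (None \in map Some r) = false by apply/negP => /mapP[].
  have gN c : (None \in g c) = h by rewrite mem_cat mN; case: (h).
  have sS z : (Some z \in s') = (z \in s).
    by rewrite mem_cat mem_map => [|? ? [] //]; case: (h); rewrite /= ?inE ?orbF.
  have sN : (None \in s') = h by rewrite mem_cat mN; case: (h).
  have sum1 z (P : C -> bool) : z \in s ->
      \sum_(c <- cs) ((col z == c) && P c) = P (col z).
    move=> zs; rewrite (bigD1_seq (col z)) ?undup_uniq ?mem_undup ?map_f //= eqxx.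
    by rewrite big1 ?addn0 // => c /negbTE; rewrite eq_sym => ->.
  case: x y => [x|] [y|] /=; last by rewrite big1 // => c _; rewrite eqxx.
  - have [xs|xs] := boolP (x \in s); last first.
      rewrite /multi (negbTE xs) sS (negbTE xs) !andbF big1 // => c _.
      by rewrite gS (negbTE xs) andbF.
    have -> : \sum_(c <- cs) [&& Some x != Some y, Some x \in g c & Some y \in g c] =
              \sum_(c <- cs) ((col x == c) && [&& x != y, y \in s & col y == c]).
      apply: eq_bigr => c _; rewrite !gS xs /=; congr nat_of_bool.
      by case: (_ != _); rewrite ?andbF.
    rewrite sum1 // /multi !sS xs /= (inj_eq (@Some_inj _)).
    have [<-|xy] := eqVneq x y; first by rewrite eqxx.
    by rewrite [col y == _]eq_sym; case: (_ == _); case: (y \in s).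
  - have [xs|xs] := boolP (x \in s); last first.
      by rewrite !sS (negbTE xs) big1 // => c _; rewrite gS (negbTE xs).
    rewrite sS sN xs /= -(sum1 x (fun=> h)) //; apply: eq_bigr => c _.
    by rewrite gS gN xs.
  - have [ys|ys] := boolP (y \in s); last first.
      by rewrite !sS (negbTE ys) andbF big1 // => c _; rewrite gS (negbTE ys) andbF.
    rewrite sS sN ys andbT -(sum1 y (fun=> h)) //; apply: eq_bigr => c _.
    by rewrite gS gN ys andbC.
apply: decomposable_add.
  apply: (@decomposable_map _ Ewf _ _ _ _ Some) sd => //.
  - by move=> x y _ _ [].
  - by move=> x xs; rewrite /= mem_cat map_f.
  - move=> [x|] [y|] //=; rewrite eqb0 negbK => /and3P[_ xs ys].
    by exists x, y.
apply: decomposable_sum => c; rewrite mem_undup => /mapP[x xs ->].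
have gs : {subset g (col x) <= s'}.
  move=> z; rewrite !mem_cat => /orP[/mapP[t]|->]; last by rewrite orbT.
  by rewrite mem_filter => /andP[_ ts] ->; rewrite map_f.
apply: decomposable_sub gs _; apply: points_Kdec.
  apply: subseq_uniq s'u; apply: cat_subseq => //; apply: map_subseq; exact: filter_subseq.
by rewrite size_cat size_map size_filter size_nseq; apply: sK.
Qed.

End Fill.

(** * Wilson's construction *)

Definition offset (w : nat -> nat) x := \sum_(y < x) w y.

Lemma offsetS w x : offset w x.+1 = offset w x + w x.
Proof. by rewrite /offset big_ord_recr. Qed.

Lemma offset_mono w x y : x <= y -> offset w x <= offset w y.
Proof.
move=> /subnKC <-; elim: (y - x) => [|d IH]; first by rewrite addn0.
by rewrite addnS offsetS (leq_trans IH) ?leq_addr.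
Qed.

(* Part [i] of the blown-up design is cut into consecutive windows, one for each
   point [x] of the transversal design, of length the weight [w x]. *)
Definition window w x b := (offset w x <= b) && (b < offset w x.+1).

Lemma window_eq w b x y : window w x b -> window w y b -> x = y.
Proof.
move=> /andP[xb bx] /andP[yb by_].
by case: (ltngtP x y) => // /(offset_mono w); lia.
Qed.

Lemma windowP w m b : b < offset w m -> exists2 x, x < m & window w x b.
Proof.
elim: m => [|m IH]; first by rewrite /offset big_ord0.
have [/IH [x xm xb] _|mb bm] := ltnP b (offset w m); first by exists x => //; lia.
by exists m => //; rewrite /window mb.
Qed.

Lemma window_lt w m x b : x < m -> window w x b -> b < offset w m.
Proof. by move=> /(offset_mono w); rewrite /window; lia. Qed.

Section Gdd.
Variable E : seq (nat * nat).
Hypothesis Ewf : wf_edges E.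

(** Parts are identified by their position in a list, while their order and the empty parts are
    immaterial. This lemma permutes parts and adds or removes empty ones. *)
Lemma gdd_reindex (f : nat -> nat) l l' :
    injective f -> (forall i, nth 0 l' (f i) = nth 0 l i) ->
    (forall i', 0 < nth 0 l' i' -> exists i, i' = f i) ->
  gdd E l -> gdd E l'.
Proof.
move=> fI fl f0; apply: (@decomposable_map _ Ewf _ _ _ _ (fun p => (f p.1, p.2))).
- by move=> [i a] [j b] _ _ [/fI -> ->].
- by move=> [i a] /=; rewrite fl.
- by move=> [i a] [j b] /= _ _; rewrite !fl (inj_eq fI).
move=> [i a] [j b] /=; rewrite eqb0 negbK => /and3P[_ ai bj].
have [i' ii] := f0 i (leq_ltn_trans (leq0n _) ai).
have [j' jj] := f0 j (leq_ltn_trans (leq0n _) bj).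
by exists (i', a), (j', b); split; rewrite /= ?ii ?jj // -fl -?ii -?jj.
Qed.

(** A point is sent to its colour together with its rank in its colour class, which fills the parts
    of [l] exactly because [l] lists the class sizes. *)
Lemma gdd_points (T : eqType) (s : seq T) (col : T -> nat) l :
    uniq s -> (forall i, count (fun x => col x == i) s = nth 0 l i) ->
  decomposable E (mem s) (multi s col) -> gdd E l.
Proof.
move=> su sl.
pose fib i := filter (fun x => col x == i) s.
have fibP x : x \in s -> x \in fib (col x) by rewrite mem_filter eqxx.
have ilt x : x \in s -> index x (fib (col x)) < nth 0 l (col x).
  by move=> /fibP; rewrite -index_mem size_filter sl.
apply: (@decomposable_map _ Ewf _ _ _ _ (fun x => (col x, index x (fib (col x))))).
- move=> x y xs ys [cxy]; rewrite -cxy; apply: (@index_inj _ x); first exact: fibP.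
  by rewrite cxy; apply: fibP.
- by move=> x xs /=; apply: ilt.
- by move=> x y xs ys; rewrite /= !ilt // /multi (xs : x \in s) (ys : y \in s).
move=> [i a] [j b] /=; rewrite eqb0 negbK => /and3P[_ ai bj].
have getx i' a' : a' < nth 0 l i' -> exists2 x, x \in s & (i', a') = (col x, index x (fib (col x))).
  rewrite -sl -size_filter -/(fib i') => af.
  have x0 : T by case: (fib i') af.
  have : nth x0 (fib i') a' \in fib i' by apply: mem_nth.
  rewrite mem_filter => /andP[/eqP cx xs]; exists (nth x0 (fib i') a') => //.
  by rewrite cx index_uniq ?filter_uniq.
have [x xs xe] := getx _ _ ai; have [y ys ye] := getx _ _ bj.
by exists x, y.
Qed.

Lemma gdd_fill l (h : bool) : gdd E l ->
  {in l, forall g, Kdec E (g + h)} -> Kdec E (sumn l + h).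
Proof.
move=> dl lK.
pose s := [seq (i, a) | i <- iota 0 (size l), a <- iota 0 (nth 0 l i)].
have sE p : (p \in s) = (p.2 < nth 0 l p.1).
  case: p => i a; apply/allpairsPdep/idP => [[i' [a' [_]]]|/= ai].
    by rewrite mem_iota => ai [-> ->].
  exists i, a; split; rewrite ?mem_iota //=.
  by case: ltnP => // li; rewrite nth_default in ai.
have su : uniq s.
  apply: allpairs_uniq_dep => [|i _|]; rewrite ?iota_uniq //.
  by move=> [i a] [j b] /= _ _ [-> ->].
have <- : size s = sumn l.
  rewrite size_allpairs_dep; congr sumn.
  rewrite -[RHS](mkseq_nth 0); apply: eq_map => i; exact: size_iota.
apply: (@fill _ Ewf _ _ s fst) => //.
  by apply: decomposable_ext dl => // [p|p q]; rewrite ?inE /= /multi ?sE.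
move=> [i a] ais /=.
have -> : count (fun y => y.1 == i) s = nth 0 l i.
  rewrite -size_filter; transitivity (size (map (pair i) (iota 0 (nth 0 l i)))); last first.
    by rewrite size_map size_iota.
  apply: perm_size; apply: uniq_perm; rewrite ?filter_uniq ?map_inj_uniq ?iota_uniq //.
    by move=> ? ? [].
  move=> [j b]; rewrite mem_filter sE /=; apply/andP/mapP => [[/eqP <- bj]|[c]].
    by exists b; rewrite ?mem_iota.
  by rewrite mem_iota => /andP[_ ci] [-> ->]; rewrite eqxx.
apply: lK; apply: mem_nth; move: ais; rewrite sE /=.
by case: (ltnP i (size l)) => // li; rewrite nth_default.
Qed.

(* A transversal design TD(k, m): the m^2 blocks are indexed by [(r, s)], and
   block [(r, s)] meets group [i] in the point [L i r s]. *)
Definition td k m := exists L : nat -> nat -> nat -> nat,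
  (forall i r s, i < k -> r < m -> s < m -> L i r s < m) /\
  (forall i i' r s r' s', i < i' -> i' < k -> r < m -> s < m -> r' < m -> s' < m ->
     L i r s = L i r' s' -> L i' r s = L i' r' s' -> r = r' /\ s = s').

(** Sending a block to its points in groups [i] and [i'] is injective from m^2 blocks to m^2 pairs
    of points, hence bijective: two points of different groups lie in exactly one common block. *)
Lemma td_meet k m L i i' x x' :
    (forall i r s, i < k -> r < m -> s < m -> L i r s < m) ->
    (forall i i' r s r' s', i < i' -> i' < k -> r < m -> s < m -> r' < m -> s' < m ->
     L i r s = L i r' s' -> L i' r s = L i' r' s' -> r = r' /\ s = s') ->
    i < k -> i' < k -> i != i' -> x < m -> x' < m ->
  exists r0 s0, [/\ r0 < m, s0 < m & forall r s, r < m -> s < m ->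
    (L i r s == x) && (L i' r s == x') = (r == r0) && (s == s0)].
Proof.
move=> Lm Lu ik ik' ii xm xm'.
pose F (p : 'I_m * 'I_m) := (Ordinal (Lm i _ _ ik (ltn_ord p.1) (ltn_ord p.2)),
  Ordinal (Lm i' _ _ ik' (ltn_ord p.1) (ltn_ord p.2))).
have FI : injective F.
  move=> [r s] [r' s'] /= [e e'].
  have [rr ss] : r = r' :> nat /\ s = s' :> nat.
    by case: (ltngtP i i') ii => // lt _; [apply: (Lu i i')|apply: (Lu i' i)].
  by congr pair; apply: val_inj.
have [G GF FG] := injF_bij FI.
have Ge := FG (Ordinal xm, Ordinal xm').
exists (G (Ordinal xm, Ordinal xm')).1, (G (Ordinal xm, Ordinal xm')).2.
split=> // r s rm sm; apply/andP/andP => -[/eqP e1 /eqP e2].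
  have Fe : F (Ordinal rm, Ordinal sm) = (Ordinal xm, Ordinal xm').
    by congr pair; apply: val_inj.
  by rewrite -Fe GF /= !eqxx.
have /= Ge1 := congr1 (fun p => val p.1) Ge.
have /= Ge2 := congr1 (fun p => val p.2) Ge.
by split; apply/eqP; rewrite e1 e2.
Qed.

Lemma nth_mkseq0 (f : nat -> nat) k i : nth 0 (mkseq f k) i = if i < k then f i else 0.
Proof. by case: ltnP => ik; [rewrite nth_mkseq | rewrite nth_default ?size_mkseq]. Qed.

(* Wilson's construction: each block of the transversal design is replaced by a
   group divisible design on the windows of its points. *)
Lemma wilson k m (w : nat -> nat -> nat) :
    td k m ->
    (forall f : nat -> nat, (forall i, i < k -> f i < m) -> gdd E (mkseq (fun i => w i (f i)) k)) ->
  gdd E (mkseq (fun i => \sum_(x < m) w i x) k).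
Proof.
move=> [L [Lm Lu]] wg.
pose win i x b := (i < k) && window (w i) x b.
pose W r s (p q : nat * nat) : nat :=
  [&& p.1 != q.1, win p.1 (L p.1 r s) p.2 & win q.1 (L q.1 r s) q.2].
have winD i x b : x < m -> win i x b -> b < nth 0 (mkseq (fun i => \sum_(x < m) w i x) k) i.
  by move=> xm /andP[ik]; rewrite nth_mkseq0 ik; apply: window_lt.
pose WW p q := \sum_(r <- iota 0 m) \sum_(s <- iota 0 m) W r s p q.
apply: (@decomposable_ext _ _ _ _ WW) => //; last first.
  apply: decomposable_sum => r; rewrite mem_iota => rm; apply: decomposable_sum => s; rewrite mem_iota => sm.
  have := wg (fun i => L i r s) (fun i ik => Lm i r s ik rm sm).
  (* Part [i] of the small design is shifted onto the window of the point in which block [(r, s)]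
     meets group [i]. *)
  apply: (@decomposable_map _ Ewf _ _ _ _ (fun p => (p.1, offset (w p.1) (L p.1 r s) + p.2))).
  - by move=> [i a] [j b] _ _ /= [<- /addnI ->].
  - move=> [i a] /=; rewrite nth_mkseq0; case: ifP => // ik ai.
    apply: (winD _ (L i r s)); first exact: Lm.
    by rewrite /win ik /window offsetS; lia.
  - move=> [i a] [j b] /=; rewrite !nth_mkseq0.
    case: ifP => // ik ai; case: ifP => // jk bj; rewrite /W /win /= ik jk /window !offsetS.
    by rewrite !leq_addr !ltn_add2l ai bj.
  move=> [i a] [j b]; rewrite /W /= eqb0 negbK => /and3P[_ /andP[ik]].
  rewrite /window offsetS => /andP[ia ai] /andP[jk]; rewrite /window offsetS => /andP[jb bj].
  exists (i, a - offset (w i) (L i r s)), (j, b - offset (w j) (L j r s)).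
  by rewrite /= !nth_mkseq0 ik jk !subnKC // !ltn_subLR.
move=> [i b] [j c]; rewrite /WW.
have W0 : ~~ [&& i != j, b < nth 0 (mkseq (fun i => \sum_(x < m) w i x) k) i
      & c < nth 0 (mkseq (fun i => \sum_(x < m) w i x) k) j] ->
    \sum_(r <- iota 0 m) \sum_(s <- iota 0 m) W r s (i, b) (j, c) = 0.
  move=> ijbc; rewrite big_seq big1 // => r; rewrite mem_iota => rm.
  rewrite big_seq big1 // => s; rewrite mem_iota => sm.
  apply/eqP; rewrite eqb0 /=; apply: contra ijbc => /and3P[-> wi wj].
  have /andP[ik _] := wi; have /andP[jk _] := wj.
  by rewrite (winD _ _ _ _ wi) ?(winD _ _ _ _ wj) ?Lm.
have [/and3P[ij bi cj]|/W0 ->] := boolP [&& _, _ & _]; last by [].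
move: bi cj; rewrite !nth_mkseq0; case: ifP => // ik; case: ifP => // jk.
move=> /windowP[x xm xb] /windowP[y ym yc].
(* The windows containing [b] and [c] determine two points of the transversal design; the only block
   through both is the only one whose design covers the edge. *)
have [r0 [s0 [r0m s0m rs]]] := td_meet Lm Lu ik jk ij xm ym.
have WE r s : r < m -> s < m -> W r s (i, b) (j, c) = (r == r0) && (s == s0).
  move=> rm sm; rewrite -rs // /W /win /= ij ik jk /=; congr nat_of_bool; congr andb.
    by apply/idP/eqP => [/window_eq/(_ xb)|->].
  by apply/idP/eqP => [/window_eq/(_ yc)|->].
rewrite (bigD1_seq r0) ?mem_iota ?iota_uniq //= (bigD1_seq s0) ?mem_iota ?iota_uniq //=.
rewrite WE // !eqxx big_seq_cond big1 => [|s /andP[]]; last first.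
  by rewrite mem_iota => sm /negbTE s0'; rewrite WE // s0' andbF.
rewrite big_seq_cond big1 // => r /andP[]; rewrite mem_iota => rm /negbTE r0'.
by rewrite big_seq big1 // => s; rewrite mem_iota => sm; rewrite WE // r0'.
Qed.
End Gdd.

(** * Cyclic development *)

Section Cyclic.
Variable E : seq (nat * nat).
Hypothesis Ewf : wf_edges E.

(* An orbit [(l, c, t)] is a copy of Z_l on which Z_g acts by translation, with l
   dividing g; its point [x] has colour [(c, x mod t)]. *)
Definition orbit_len (os : seq (nat * nat * nat)) j := (nth (0, 0, 0) os j).1.1.
Definition orbit_class (os : seq (nat * nat * nat)) j := (nth (0, 0, 0) os j).1.2.
Definition orbit_mod (os : seq (nat * nat * nat)) j := (nth (0, 0, 0) os j).2.

Definition orbit_pts os : seq (nat * nat) :=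
  [seq (j, x) | j <- iota 0 (size os), x <- iota 0 (orbit_len os j)].
Definition colour os (p : nat * nat) := (orbit_class os p.1, p.2 %% orbit_mod os p.1).
Definition translate os i (p : nat * nat) := (p.1, (p.2 + i) %% orbit_len os p.1).

Definition valid_pt os (p : nat * nat) := (p.1 < size os) && (p.2 < orbit_len os p.1).

(* Points in orbits shorter than g all have the same colour, so that every edge
   has an end in an orbit of length g. *)
Definition orbits_ok g (os : seq (nat * nat * nat)) :=
  all (fun o => [&& 0 < o.2, o.2 %| o.1.1 & o.1.1 %| g]) os &&
  all (fun o => all (fun o' =>
    ((o.1.2 == o'.1.2) ==> (o.2 == o'.2)) &&
    ((o.1.1 != g) && (o'.1.1 != g) ==> (o.1.2 == o'.1.2) && (o.2 == 1))) os) os.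

Definition block_fun (b : seq (nat * nat)) k := nth (0, 0) b k.-1.

Definition block_arcs (B : seq (seq (nat * nat))) :=
  flatten (map (arcs E) (map block_fun B)).

(* The neighbours of the point [(j, 0)] in the developed design: the arc
   [(j, x) -> (k, y)] is translated by [- x]. *)
Definition row g os (A : seq ((nat * nat) * (nat * nat))) j : seq (nat * nat) :=
  [seq (a.2.1, (a.2.2 + (g - a.1.2)) %% orbit_len os a.2.1) | a <- A & a.1.1 == j].

(** Each of the residues modulo [t] is taken by [l / t] points of Z_l, so all colours of class [c]
    have the same number of points. [degree_out] is the complementary number, the degree of a vertex
    of class [c] in the multipartite graph. *)
Definition class_size (os : seq (nat * nat * nat)) c :=
  sumn [seq if o.1.2 == c then o.1.1 %/ o.2 else 0 | o <- os].
Definition degree_out (os : seq (nat * nat * nat)) c :=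
  sumn [seq if o.1.2 == c then o.1.1 - o.1.1 %/ o.2 else o.1.1 | o <- os].

(** Distinctness is tested orbit by orbit, as strict increase after sorting, in order to keep the
    evaluation of the tables cheap. *)
Definition uniq_rowb (os : seq (nat * nat * nat)) (r : seq (nat * nat)) :=
  all (fun j => sorted ltn (sort leq [seq p.2 | p <- r & p.1 == j])) (iota 0 (size os)).

Definition block_ok os (b : seq (nat * nat)) :=
  uniq (map (block_fun b) labels) && all (valid_pt os) (map (block_fun b) labels).

(* By symmetry it is enough to check the neighbourhood of one point of each full
   orbit: its entries are distinct and their number is the degree of the point. *)
Definition cyclic_ok g os B :=
  let A := block_arcs B in
  [&& orbits_ok g os, all (block_ok os) B,
      all (fun a => colour os a.1 != colour os a.2) A &
      all (fun j => (orbit_len os j == g) ==>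
             let r := row g os A j in
             uniq_rowb os r && (size r == degree_out os (orbit_class os j)))
          (iota 0 (size os))].

Lemma count_mod_iota t k r : r < t -> count (fun x => x %% t == r) (iota 0 (k * t)) = k.
Proof.
move=> rt; elim: k => // k IH; rewrite mulSn addnC iotaD count_cat IH add0n -[RHS]addn1; congr addn.
rewrite -[t in iota _ t]addn0 addnC -[k * t]addn0 iotaDl count_map.
rewrite (eq_in_count (a2 := pred1 r)) => [|x].
  by rewrite count_uniq_mem ?iota_uniq // mem_iota add0n rt.
by rewrite mem_iota add0n => xt /=; rewrite modnMDl modn_small.
Qed.

Lemma mem_orbit_pts os p : (p \in orbit_pts os) = valid_pt os p.
Proof.
case: p => j x; apply/allpairsPdep/andP => [[j' [x' [jj xx [-> ->]]]]|[/= js xl]].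
  by move: jj xx; rewrite !mem_iota.
by exists j, x; rewrite !mem_iota.
Qed.

Lemma orbit_pts_uniq os : uniq (orbit_pts os).
Proof.
apply: allpairs_uniq_dep => [|j _|]; rewrite ?iota_uniq //.
by move=> [j x] [k y] /= _ _ [-> ->].
Qed.

Lemma size_orbit_pts os : size (orbit_pts os) = sumn [seq o.1.1 | o <- os].
Proof.
rewrite size_allpairs_dep; congr sumn; rewrite -[in RHS](mkseq_nth (0, 0, 0) os) -map_comp.
by apply: eq_map => j; rewrite /= size_iota.
Qed.

Section Checked.
Variables (g : nat) (os : seq (nat * nat * nat)).
Hypothesis osP : orbits_ok g os.

Lemma orbitsP j : j < size os ->
  [/\ 0 < orbit_mod os j, orbit_mod os j %| orbit_len os j & orbit_len os j %| g].
Proof. by move=> js; have /andP[/(all_nthP (0, 0, 0))/(_ j js)/and3P[]] := osP. Qed.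

Lemma orbit_mod_eq j k : j < size os -> k < size os -> orbit_class os j = orbit_class os k ->
  orbit_mod os j = orbit_mod os k.
Proof.
move=> js ks jk; have /andP[_ /(all_nthP (0, 0, 0))/(_ j js)] := osP.
move=> /(all_nthP (0, 0, 0))/(_ k ks)/andP[/implyP jk' _]; apply/eqP/jk'/eqP; exact: jk.
Qed.

Lemma short_orbits j k : j < size os -> k < size os -> orbit_len os j != g -> orbit_len os k != g ->
  orbit_class os j = orbit_class os k /\ orbit_mod os j = 1.
Proof.
move=> js ks jg kg; have /andP[_ /(all_nthP (0, 0, 0))/(_ j js)] := osP.
move=> /(all_nthP (0, 0, 0))/(_ k ks)/andP[_ /implyP].
by rewrite jg kg => /(_ isT)/andP[/eqP ? /eqP].
Qed.

Lemma count_colour p : valid_pt os p ->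
  count (fun q => colour os q == colour os p) (orbit_pts os) = class_size os (orbit_class os p.1).
Proof.
case: p => j x /andP[/= js xj].
rewrite /class_size /colour /=; set c := orbit_class os j; set r := x %% _.
rewrite /orbit_pts count_flatten -[in RHS](mkseq_nth (0, 0, 0) os) -!map_comp.
congr sumn; apply/eq_in_map => k; rewrite mem_iota add0n /= => ks.
rewrite count_map -/(orbit_class os k) -/(orbit_len os k) -/(orbit_mod os k).
case: eqVneq => [kj|kj]; last first.
  by apply/eqP; rewrite eqn0Ngt -has_count; apply/hasPn => y _ /=; rewrite xpair_eqE (negbTE kj).
have [m0 md _] := orbitsP ks.
rewrite (eq_count (a2 := fun y => y %% orbit_mod os k == r)) => [|y]; last first.
  by rewrite /= xpair_eqE kj eqxx.
by rewrite -[in iota _ _](divnK md) count_mod_iota // /r -(orbit_mod_eq ks js kj) ltn_mod.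
Qed.

Lemma count_degree_out p : valid_pt os p ->
  count (fun q => colour os q != colour os p) (orbit_pts os) = degree_out os (orbit_class os p.1).
Proof.
move=> pv; apply/(@addnI (class_size os (orbit_class os p.1))).
rewrite -[X in X + _ = _](count_colour pv) count_predC size_orbit_pts /class_size /degree_out.
move: (orbit_class os p.1) => c; elim: (os) => //= o os' ->; have := leq_div o.1.1 o.2.
by case: ifP => _; lia.
Qed.

Lemma uniq_rowP r : all (fun p => p.1 < size os) r -> uniq_rowb os r -> uniq r.
Proof.
move=> /allP rs /allP ru; apply: count_mem_uniq => -[j x].
have [jr|/negbTE jr] := boolP ((j, x) \in r); last first.
  by apply/eqP; rewrite eqn0Ngt -has_count has_pred1 jr.
have js := rs _ jr.
have {}ru : uniq [seq p.2 | p <- r & p.1 == j].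
  rewrite -(sort_uniq leq); apply: (sorted_uniq ltn_trans ltnn); apply: ru.
  by rewrite mem_iota.
have := count_uniq_mem x ru; rewrite count_map count_filter.
rewrite (eq_count (a2 := pred1 (j, x))) => [->|p].
  apply/eqP; rewrite eqb1; apply/mapP; exists (j, x) => //.
  by rewrite mem_filter eqxx.
by case: p => k y; rewrite /= xpair_eqE andbC.
Qed.

Lemma valid_shift i p : valid_pt os p -> valid_pt os (translate os i p).
Proof.
by move=> /andP[ps pl]; rewrite /valid_pt /= ps /= ltn_mod (leq_ltn_trans (leq0n _) pl).
Qed.

Lemma translate_inj i p q : valid_pt os p -> valid_pt os q ->
  translate os i p = translate os i q -> p = q.
Proof.
case: p q => [j x] [k y] /andP[/= js xj] /andP[/= ks yk] [jk].
rewrite -{k}jk in ks yk *; move=> /eqP.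
by rewrite eqn_modDr !modn_small // => /eqP ->.
Qed.

(** Translations preserve differences: if [x] takes [p] to [y], it takes [q] to [z] exactly when
    [q - p] and [z - y] agree modulo [l]. As [l] divides [g], adding [g - p] replaces subtracting
    [p]. *)
Lemma translate_eq l x p q y z : l %| g -> 0 < l -> p < g -> y < g -> q < l -> z < l ->
    x < g -> (p + x) %% g = y ->
  ((q + x) %% l == z) = ((q + (g - p)) %% l == (z + (g - y)) %% l).
Proof.
move=> /dvdnP[k gE] l0 pg yg ql zl xg pxy.
have gl c u : (c * g + u) %% l = u %% l by rewrite gE mulnA modnMDl.
have e1 : (q + (g - p) + y) %% l = (q + x) %% l.
  have := divn_eq (p + x) g; rewrite pxy => e.
  rewrite -(gl ((p + x) %/ g)) -[RHS](gl 1); congr (_ %% l); lia.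
have e2 : (z + (g - y) + y) %% l = z.
  by rewrite -addnA subnK ?(ltnW yg) // addnC -[g]mul1n gl modn_small.
by rewrite -(eqn_modDr y) e1 e2.
Qed.

Variable B : seq (seq (nat * nat)).
Hypothesis Bok : all (block_ok os) B.
Let A := block_arcs B.
Hypothesis Acol : all (fun a => colour os a.1 != colour os a.2) A.
Hypothesis rowP : all (fun j => (orbit_len os j == g) ==>
             let r := row g os A j in
             uniq_rowb os r && (size r == degree_out os (orbit_class os j)))
          (iota 0 (size os)).

Lemma arcs_valid : all (fun a => valid_pt os a.1 && valid_pt os a.2) A.
Proof. by apply: all_arcs => //; rewrite all_map. Qed.

Lemma arcs_swap (T : eqType) (f : nat -> T) :
  perm_eq (map (fun a => (a.2, a.1)) (arcs E f)) (arcs E f).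
Proof. by rewrite /arcs !map_cat -!map_comp perm_catC. Qed.

Lemma block_arcs_swap : perm_eq (map (fun a => (a.2, a.1)) A) A.
Proof.
rewrite /A /block_arcs; elim: (map _ B) => //= f F IH.
by rewrite map_cat perm_cat // arcs_swap.
Qed.

Definition dev_count u v := \sum_(i <- iota 0 g)
  count (fun a => (translate os i a.1, translate os i a.2) == (u, v)) A.

Lemma dev_countC u v : dev_count u v = dev_count v u.
Proof.
apply: eq_bigr => i _; rewrite -[in RHS](permP block_arcs_swap) count_map.
by apply: eq_count => a /=; rewrite !xpair_eqE andbC.
Qed.

(** On a full orbit the group acts regularly, so every base arc leaving the orbit of [u] has exactly
    one translate leaving [u]. Whether that translate ends in [v] is decided by a difference, and
    the row lists these differences. *)
Lemma dev_count_row u v : valid_pt os u -> valid_pt os v -> orbit_len os u.1 = g ->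
  dev_count u v = count_mem (v.1, (v.2 + (g - u.2)) %% orbit_len os v.1) (row g os A u.1).
Proof.
case: u v => [ju y] [kv z] /andP[/= jus yl] /andP[/= kvs zl] /= ug.
rewrite /row count_map count_filter /dev_count.
have := arcs_valid; elim: (A) => [|[[j p] [k q]] A' IH] /=.
  by move=> _; rewrite big1.
move=> /andP[/andP[/andP[/= js pl] /andP[/= ks ql]] /IH <-].
rewrite big_split /=; congr addn.
under eq_bigr do rewrite !xpair_eqE /=.
rewrite xpair_eqE.
have [jE|/negbTE jN] := eqVneq j ju; last by rewrite andbF big1.
have [kE|/negbTE kN] := eqVneq k kv; last by rewrite big1 // => i _; rewrite andbF.
rewrite andbT /= {}kE {j}jE in js pl ks ql *; rewrite ug in pl yl.
have [_ _ lg] := orbitsP ks; have l0 : 0 < orbit_len os kv by apply: leq_ltn_trans ql.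
have g0 : 0 < g by apply: leq_ltn_trans pl.
(* The unique translation that takes [p] to [y]. *)
pose i0 := (y + (g - p)) %% g; have i0g : i0 < g by rewrite ltn_mod.
have iE i : i < g -> ((p + i) %% g == y) = (i == i0).
  move=> ig; apply/eqP/eqP => [yE|->].
    by rewrite /i0 -yE modnDml addnAC subnKC ?(ltnW pl) // modnDl modn_small.
  by rewrite /i0 modnDmr addnCA subnKC ?(ltnW pl) // modnDr modn_small.
rewrite ug (bigD1_seq i0) ?iota_uniq ?mem_iota //= iE // eqxx /=.
rewrite (translate_eq lg l0 pl yl ql zl i0g); last by apply/eqP; rewrite iE.
rewrite big_seq_cond big1 ?addn0 // => i /andP[]; rewrite mem_iota add0n => ig /negbTE ii.
by rewrite iE // ii.
Qed.

(** The entries of the row are distinct, all differ in colour from [(j, 0)], and there are as many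
    of them as points of other colours; hence the row contains each such point exactly once. *)
Lemma row_count u v : valid_pt os u -> valid_pt os v -> orbit_len os u.1 = g ->
  count_mem (v.1, (v.2 + (g - u.2)) %% orbit_len os v.1) (row g os A u.1) =
    (colour os u != colour os v).
Proof.
case: u v => [j y] [k z] /andP[/= js yl] /andP[/= ks zl] jg.
have [k0 mk lg] := orbitsP ks; have l0 : 0 < orbit_len os k by apply: leq_ltn_trans zl.
have yg : y < g by rewrite -jg.
have j0v : valid_pt os (j, 0) by rewrite /valid_pt /= js jg (leq_ltn_trans _ yg).
(* The modulus of a colour class divides the length of its orbits and therefore [g], so translation
   respects the comparison of colours. *)
have colE x p q : p < g -> orbit_class os x = orbit_class os j -> x < size os ->
    ((q + (g - p)) %% orbit_len os x %% orbit_mod os x == 0 %% orbit_mod os j) =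
    (q %% orbit_mod os x == p %% orbit_mod os j).
  move=> pg xj xs; have [m0 mx lx] := orbitsP xs; rewrite (orbit_mod_eq js xs (esym xj)).
  rewrite modn_dvdm // mod0n -[in LHS](mod0n (orbit_mod os x)) -(eqn_modDr p).
  rewrite -addnA subnK ?(ltnW pg) //.
  by rewrite add0n -modnDmr (eqP (dvdn_trans mx lx)) addn0.
have /allP/(_ j) := rowP; rewrite mem_iota js jg eqxx => /(_ isT) /andP[].
have rs : {subset row g os A j <= [seq p <- orbit_pts os | colour os p != colour os (j, 0)]}.
  move=> p /mapP[[[j' a] [k' b]]]; rewrite mem_filter /= => /andP[/eqP -> aA] ->.
  have /allP/(_ _ aA)/andP[/andP[/= _ al] /andP[/= k's bl]] := arcs_valid.
  have /allP/(_ _ aA) /= := Acol; rewrite /colour mem_filter mem_orbit_pts /valid_pt /= k's.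
  rewrite ltn_mod (leq_ltn_trans _ bl) // andbT !xpair_eqE.
  have [kj|//] := eqVneq (orbit_class os k') (orbit_class os j).
  by rewrite andbT /= colE -?jg // (orbit_mod_eq js k's (esym kj)) eq_sym.
move=> ru /eqP rsz.
have {}ru : uniq (row g os A j).
  by apply: uniq_rowP ru; apply/allP => p /rs; rewrite mem_filter mem_orbit_pts => /andP[_ /andP[]].
rewrite count_uniq_mem //; congr nat_of_bool.
have sz : size [seq p <- orbit_pts os | colour os p != colour os (j, 0)] <= size (row g os A j).
  by rewrite size_filter (count_degree_out j0v) rsz.
(* A duplicate-free list contained in another and at least as long has the same members. *)
have [_ ->] := uniq_min_size ru rs sz.
rewrite mem_filter mem_orbit_pts /valid_pt /= ks ltn_mod l0 andbT /colour /= !xpair_eqE.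
rewrite [orbit_class os k == _]eq_sym; have [kj|//] := eqVneq (orbit_class os j) (orbit_class os k).
by rewrite andbT /= colE ?yg ?(esym kj) // eq_sym.
Qed.

(** A pair with an end in a full orbit is counted from that end, after exchanging the two points if
    necessary. Two points of short orbits have the same colour, and no translate of a base arc joins
    them because base arcs join different colours. *)
Lemma cyclic_dec : decomposable E (mem (orbit_pts os)) (multi (orbit_pts os) (colour os)).
Proof.
apply: (@decomposable_ext _ _ (mem (orbit_pts os)) _ dev_count) => //; last first.
  apply: decomposable_sum => i _; exists (map (comp (translate os i)) (map block_fun B)); split.
    rewrite !all_map; apply: sub_all Bok => b /andP[bu /allP bv]; apply/andP; split.
      by rewrite map_comp map_inj_in_uniq // => x y /bv xv /bv yv; apply: translate_inj.
    rewrite map_comp all_map; apply/allP => x /bv xv; rewrite /= mem_orbit_pts; exact: valid_shift.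
  move=> x y; rewrite /A /block_arcs.
  have -> : map (arcs E) (map (comp (translate os i)) (map block_fun B)) =
      map (map (fun a => (translate os i a.1, translate os i a.2))) (map (arcs E) (map block_fun B)).
    by rewrite -!map_comp; apply: eq_map => b /=; rewrite /arcs -map_comp.
  by rewrite -map_flatten count_map.
move=> u v; rewrite /multi !mem_orbit_pts.
have ns0 (P : bool) : (forall i a, a \in A -> (translate os i a.1, translate os i a.2) = (u, v) -> P) ->
    ~~ P -> dev_count u v = 0.
  move=> uvP /negP nP; rewrite /dev_count big1 // => i _; apply/eqP.
  rewrite eqn0Ngt -has_count; apply/hasPn => a aA; apply/negP => /eqP aE.
  by apply: nP; apply: uvP aE.
have [uv|uv] := boolP (valid_pt os u); last first.
  rewrite /= andbF; apply: (ns0 _ _ uv) => i a aA [<- _]; apply: valid_shift.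
  by have /allP/(_ _ aA)/andP[] := arcs_valid.
have [vv|vv] := boolP (valid_pt os v); last first.
  rewrite !andbF; apply: (ns0 _ _ vv) => i a aA [_ <-]; apply: valid_shift.
  by have /allP/(_ _ aA)/andP[] := arcs_valid.
rewrite !andbT; have [ug|ug] := eqVneq (orbit_len os u.1) g.
  by rewrite dev_count_row // row_count.
have [vg|vg] := eqVneq (orbit_len os v.1) g.
  by rewrite dev_countC dev_count_row // row_count // eq_sym.
have /andP[us _] := uv; have /andP[vs _] := vv.
have [uvc u1] := short_orbits us vs ug vg; have [_ v1] := short_orbits vs us vg ug.
rewrite /colour uvc u1 v1 !modn1 eqxx; apply: (ns0 false) => // i a aA [ua va].
have /allP/(_ _ aA) := Acol; rewrite /colour.
have /= -> := congr1 fst ua; have /= -> := congr1 fst va.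
by rewrite uvc u1 v1 !modn1 eqxx.
Qed.

End Checked.
End Cyclic.

(** * Encoding and evaluation of tables of base blocks *)

Fixpoint pos_bits (p : positive) : seq bool :=
  match p with
  | xH => [:: true]
  | xO p => false :: pos_bits p
  | xI p => true :: pos_bits p
  end.

(** A position beyond all orbits yields an orbit index out of range, which [block_ok] rejects. Only
    positions are unary numbers: the codes themselves stay binary, and nine bits suffice since no
    table entry has more than 420 points. Bits missing at the top of a code count as zeros. *)
Fixpoint locate j (os : seq (nat * nat * nat)) x : nat * nat :=
  if os is o :: os' then
    if x < o.1.1 then (j, x) else locate j.+1 os' (x - o.1.1)
  else (j, x).

(* A block is a number whose 9-bit digits, lowest first, are the positions of the
   labels 1..6 in the concatenation of the orbits. *)
Definition decode os (c : positive) : seq (nat * nat) :=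
  [seq locate 0 os (foldr (fun (b : bool) n => b + n.*2) 0 (take 9 (drop (9 * i) (pos_bits c))))
  | i <- iota 0 6].

(* The blocks [codes] are developed over Z_period. Each entry [h] of [fills] stands
   for one design of a complete graph, obtained by adding [h] points and filling
   the colour classes; the entries of the tables were found by computer search. *)
Record design := Design {
  fills : seq bool;
  period : nat;
  orbits : seq (nat * nat * nat);
  codes : seq positive
}.

Definition design_ok E d := cyclic_ok E (period d) (orbits d) (map (decode (orbits d)) (codes d)).

Definition design_size d := sumn [seq o.1.1 | o <- orbits d].

(** The order of the entries matters: the colour classes of a design are filled only by complete
    graphs from [known] or from earlier entries. *)
Fixpoint table_ok E (known : seq nat) (ds : seq design) : bool :=
  if ds is d :: ds' then
    [&& design_ok E d,
        all (fun h : bool => all (fun o => class_size (orbits d) o.1.2 + h \in known) (orbits d))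
          (fills d) &
        table_ok E ([seq design_size d + nat_of_bool h | h <- fills d] ++ known) ds']
  else true.

Definition orders ds := flatten [seq [seq design_size d + nat_of_bool h | h <- fills d] | d <- ds].

(** Colours are numbered by [c * s + r], which is injective because every residue [r] lies below a
    modulus that is at most [s]. The heavy parts thus get numbers below [s], a light part of class 1
    gets number [s], and a number without points is an empty part. *)
Definition design_gdd_ok E s l d :=
  let os := orbits d in
  let f (c : nat * nat) := c.1 * s + c.2 in
  [&& design_ok E d, all (fun o => o.2 <= s) os,
      all (fun p => f (colour os p) < size l) (orbit_pts os) &
      l == [seq count (fun p => f (colour os p) == i) (orbit_pts os) | i <- iota 0 (size l)]].

Section Table.
Variable E : seq (nat * nat).
Hypothesis Ewf : wf_edges E.

Lemma design_dec d : design_ok E d ->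
  orbits_ok (period d) (orbits d) /\
  decomposable E (mem (orbit_pts (orbits d))) (multi (orbit_pts (orbits d)) (colour (orbits d))).
Proof. by move=> /and4P[osP Bok Acol rowP]; split=> //; exact: (cyclic_dec Ewf osP Bok Acol rowP). Qed.

Lemma table_Kdec known ds : table_ok E known ds ->
  {in known, forall n, Kdec E n} -> {in orders ds, forall n, Kdec E n}.
Proof.
elim: ds known => // d ds IH known /and3P[/design_dec[osP dd] /allP dk dsP] kK.
have dK : {in [seq design_size d + nat_of_bool h | h <- fills d], forall n, Kdec E n}.
  move=> _ /mapP[h hd ->]; rewrite /design_size -size_orbit_pts.
  apply: (fill Ewf (orbit_pts_uniq _) dd) => p; rewrite mem_orbit_pts => pv.
  rewrite (count_colour osP pv); apply: kK.
  have /andP[ps _] := pv.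
  exact: (allP (dk h hd) _ (mem_nth (0, 0, 0) ps)).
move=> n; rewrite mem_cat => /orP[/dK //|]; apply: IH dsP _ n => n.
by rewrite mem_cat => /orP[/dK|/kK].
Qed.

Lemma design_gdd s l d : design_gdd_ok E s l d -> gdd E l.
Proof.
move=> /and4P[/design_dec[osP dd] /allP os_s /allP ls /eqP lE].
set f := fun c : nat * nat => c.1 * s + c.2 in ls lE.
apply: (gdd_points Ewf (s := orbit_pts (orbits d)) (col := fun p => f (colour (orbits d) p))).
- exact: orbit_pts_uniq.
- move=> i; have [il|li] := ltnP i (size l).
    by rewrite lE (nth_map 0) ?size_iota // nth_iota.
  rewrite nth_default //; apply/eqP; rewrite eqn0Ngt -has_count.
  apply/hasPn => p /ls /= lt_l; apply/negP => /= /eqP fi.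
  by have := eq_ind _ (fun n => n < size l) lt_l _ fi; rewrite ltnNge li.
apply: decomposable_ext dd => // p q; rewrite /multi !mem_orbit_pts.
have [pv|] := boolP (valid_pt _ p); last by rewrite !andbF.
have [qv|] := boolP (valid_pt _ q); last by rewrite !andbF.
congr (nat_of_bool (~~ _ && _)).
have lt_s x : valid_pt (orbits d) x -> (colour (orbits d) x).2 < s.
  move=> /andP[xs _]; have [m0 _ _] := orbitsP osP xs.
  by apply: leq_trans (ltn_pmod _ m0) (os_s _ (mem_nth (0, 0, 0) xs)).
move: (lt_s p pv) (lt_s q qv); case: (colour _ p) (colour _ q) => [c a] [c' a'] /= as_ a's.
rewrite /f /= xpair_eqE; apply/andP/eqP => [[/eqP -> /eqP ->]//|e].
have s0 : 0 < s by apply: leq_ltn_trans as_.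
have := congr1 (divn^~ s) e; rewrite !divnMDl // !divn_small // !addn0 => ->.
by have := congr1 (modn^~ s) e; rewrite !modnMDl !modn_small // => ->.
Qed.
End Table.

(** * Recursion *)

Definition residues := [:: 0; 1; 5; 16].

(* The lines of slope 0..4 in (Z_m)^2 together with the vertical direction; the
   slopes differ by at most 4, which is invertible modulo m. *)
Lemma td6 m : coprime m 6 -> td 6 m.
Proof.
move=> m6; case: (posnP m) m6 => [->//|m0 m6].
exists (fun i r s => if i < 5 then (s + i * r) %% m else r); split=> [i r s _ rm sm|].
  by case: ifP; rewrite ?ltn_mod.
move=> i i' r s r' s' ii ik rm sm rm' sm'.
have i5 : i < 5 by lia.
have rs : r = r' -> (s + i * r) %% m = (s' + i * r') %% m -> r = r' /\ s = s'.
  by move=> <- /eqP; rewrite eqn_modDr !modn_small // => /eqP.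
rewrite i5; case: ifP => [i'5|_] e1 e2; last exact: rs.
apply: (rs _ e1).
have [d dE d4] : exists2 d, i' = i + d & 0 < d <= 4 by exists (i' - i); lia.
have drr : d * r = d * r' %[mod m].
  (* The equations of the two lines are subtracted within the natural numbers: the values
     [s + i * r] and [s' + i * r'], congruent by [e1], are added to both sides. *)
  apply/eqP; rewrite -(eqn_modDr (s + i * r + (s' + i * r'))); apply/eqP.
  have -> : d * r + (s + i * r + (s' + i * r')) = (s + i' * r) + (s' + i * r') by lia.
  have -> : d * r' + (s + i * r + (s' + i * r')) = (s' + i' * r') + (s + i * r) by lia.
  by rewrite -modnDm e2 -[in LHS]e1 modnDm.
have md : coprime m d.
  have : d \in [:: 1; 2; 3; 4] by rewrite !inE; lia.
  rewrite -[6]/(2 * 3) coprimeMr in m6; case/andP: m6 => m2 m3.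
  rewrite !inE => /or4P[] /eqP ->; rewrite ?coprimen1 //.
  by rewrite -[4]/(2 ^ 2) coprimeXr.
wlog rr : r r' rm rm' drr {e1 e2 rs s s' sm sm'} / r <= r'.
  by move=> th; case/orP: (leq_total r r') => [|/th ->] //; apply: th.
apply/eqP; rewrite eqn_leq rr /= -subn_eq0; apply/eqP.
have : m %| d * (r' - r) by rewrite mulnBr -eqn_mod_dvd ?leq_mul2l ?rr ?orbT //; apply/eqP.
by rewrite Gauss_dvdr // => /dvdn_leq; lia.
Qed.

Definition digit_add p a b := (a %% p + b %% p) %% p + p * ((a %/ p + b %/ p) %% p).

(* [D] is a difference matrix over (Z_p)^2, whose elements are encoded as
   [a + p b]; block [(r, s)] is column [r] translated by [s], and the fifth group
   records the column. *)
Definition difference_td p (D : seq (seq nat)) i r s :=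
  if i == 4 then r else digit_add p s (nth 0 (nth [::] D i) r).

Definition td_check k m L :=
  let ms := iota 0 m in
  all (fun i => all (fun r => all (fun s => L i r s < m) ms) ms) (iota 0 k) &&
  all (fun i' => all (fun i => uniq [seq (L i r s, L i' r s) | r <- ms, s <- ms]) (iota 0 i')) (iota 0 k).

Lemma uniq_map_inj_in (T U : eqType) (f : T -> U) s :
  uniq (map f s) -> {in s &, injective f}.
Proof.
elim: s => //= a s IH /andP[fa /IH fs] x y.
have fN z : z \in s -> f z <> f a by move=> zs fz; case/negP: fa; rewrite -fz map_f.
by rewrite !inE => /predU1P[->|xs] /predU1P[->|ys] // e; [case: (fN y) | case: (fN x) | apply: fs].
Qed.

Lemma td_checkP k m L : td_check k m L -> td k m.
Proof.
move=> /andP[/allP Lm /allP Lu]; exists L; split=> [i r s ik rm sm|].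
  have := Lm i; rewrite mem_iota => /(_ ik)/allP/(_ r); rewrite mem_iota => /(_ rm).
  by move=> /allP/(_ s); rewrite mem_iota => /(_ sm).
move=> i i' r s r' s' ii ik rm sm rm' sm' e e'.
have := Lu i'; rewrite mem_iota => /(_ ik)/allP/(_ i); rewrite mem_iota => /(_ ii).
rewrite -(map_allpairs (fun p => (L i p.1 p.2, L i' p.1 p.2)) pair) => /uniq_map_inj_in inj.
have [] : (r, s) = (r', s') by apply: inj; rewrite ?allpairs_f ?mem_iota //= e e'.
by [].
Qed.

(** The rows form the multiplication table of the field with four elements, 2 standing for a
    generator: the blocks are the non-vertical lines through the affine plane, read in transposed
    form. The order 4 is not coprime to 6, so [td6] does not apply. *)
Lemma td4 : td 5 4.
Proof.
by apply: (@td_checkP _ _ (difference_td 2 [:: [:: 0; 0; 0; 0]; [:: 0; 1; 2; 3];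
  [:: 0; 2; 3; 1]; [:: 0; 3; 1; 2]])); vm_compute.
Qed.

(** The rows are the multiples by 0, 1, 2 and i in the field with nine elements, where i^2 = -1 and
    [a + 3 * b] encodes a + b i. *)
Lemma td9 : td 5 9.
Proof.
by apply: (@td_checkP _ _ (difference_td 3 [:: [:: 0; 0; 0; 0; 0; 0; 0; 0; 0];
  [:: 0; 1; 2; 3; 4; 5; 6; 7; 8]; [:: 0; 2; 1; 6; 8; 7; 3; 5; 4];
  [:: 0; 3; 6; 2; 5; 8; 1; 4; 7]])); vm_compute.
Qed.

(** * The recursion on the quotient of the order by 20 *)

Section Recursion.
Variable E : seq (nat * nat).
Hypothesis Ewf : wf_edges E.

Lemma sum_light m v y : v + (0 < y) <= m ->
  \sum_(x < m) (if x < v then 20 else if x == v :> nat then y else 0) = 20 * v + y.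
Proof.
move=> vm.
suff H n : \sum_(x < n) (if x < v then 20 else if x == v :> nat then y else 0) =
    20 * minn v n + (v < n) * y.
  by rewrite H; case: posnP vm => [->|y0] vm; [lia|rewrite (_ : v < m); lia].
elim: n => [|n IH]; first by rewrite big_ord0; lia.
by rewrite big_ord_recr /= IH; case: (ltngtP n v) => nv; lia.
Qed.

(* The parts of size 20 are blown-up points of weight 20, the last part a point of
   weight [y]. *)
Definition light (y : nat) := gdd E [:: 20; 20; 20; 20; y] /\ gdd E [:: 20; 20; 20; 20; 20; y].

(* Weight 20 everywhere, except that the fifth group keeps [v] points of weight 20
   and one of weight [y], and the sixth keeps [u] points of weight 20. *)
Lemma td_step k m u v (h : bool) y :
    td k m -> (k == 5) && (u == 0) || (k == 6) -> u <= m -> v + (0 < y) <= m ->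
    light 0 -> light 20 -> light y ->
    Kdec E (20 * m + h) -> Kdec E (20 * u + h) -> Kdec E (20 * v + y + h) ->
  Kdec E (20 * (4 * m + u + v) + y + h).
Proof.
move=> tdm ku um vm [l0 _] [l20 l2020] [ly ly20] Km Ku Kv.
(* The sixth group is written with a light point of weight 0, so that [sum_light] computes the
   totals of both truncated groups. *)
pose w i x := if i < 4 then 20 else if i == 4 then (if x < v then 20 else if x == v then y else 0)
   else if x < u then 20 else if x == u then 0 else 0.
have k56 : k = 5 \/ k = 6 by move: ku; case/orP => [/andP[/eqP ->]|/eqP ->]; [left|right].
have g0 l : gdd E l -> gdd E (rcons l 0).
  apply: (gdd_reindex Ewf (f := id)) => // i; last by exists i.
  by rewrite nth_rcons; case: ltnP => // li; rewrite nth_default //; case: ifP.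
have gr a b : gdd E [:: 20; 20; 20; 20; a; b] -> gdd E [:: 20; 20; 20; 20; b; a].
  pose f i := if i == 4 then 5 else if i == 5 then 4 else i.
  have fK : involutive f by move=> [|[|[|[|[|[|i]]]]]].
  apply: (gdd_reindex Ewf (f := f)); first exact: inv_inj.
    by move=> [|[|[|[|[|[|i]]]]]].
  by move=> i _; exists (f i); rewrite fK.
have g5 a : gdd E [:: 20; 20; 20; 20; a; 0] -> gdd E [:: 20; 20; 20; 20; a].
  apply: (gdd_reindex Ewf (f := id)) => // i; last by exists i.
  by case: i => [|[|[|[|[|[|i]]]]]] //=; rewrite !nth_nil.
have := wilson Ewf (w := w) tdm.
have sw i : i < 4 -> \sum_(x < m) w i x = 20 * m.
  by move=> i4; rewrite /w i4 sum_nat_const card_ord mulnC.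
have s4 : \sum_(x < m) w 4 x = 20 * v + y by rewrite -(sum_light vm).
have s5 : \sum_(x < m) w 5 x = 20 * u by rewrite -[RHS]addn0 -(@sum_light m) ?addn0.
have w4 x : w 4 x \in [:: 20; y; 0].
  by rewrite /w /=; case: ifP => _; [|case: ifP => _]; rewrite !inE eqxx ?orbT.
have w5 x : w 5 x \in [:: 20; 0].
  by rewrite /w /=; case: ifP => _; [|case: ifP => _]; rewrite !inE eqxx ?orbT.
(* The last two weights are 20, [y] or 0 and 20 or 0. Up to the order of the parts and to empty
   parts, all six combinations are supplied by [light 0], [light 20] and [light y]. *)
have blk f : gdd E [:: 20; 20; 20; 20; w 4 (f 4); w 5 (f 5)].
  have := w4 (f 4); have := w5 (f 5); rewrite !inE.
  move=> /orP[] /eqP -> /or3P[] /eqP -> //; try exact: (g0 [:: _; _; _; _; _]).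
  - exact: gr.
  - apply: gr; exact: (g0 [:: _; _; _; _; _]).
have nn : 20 * (4 * m + u + v) + y + h =
    sumn [:: 20 * m; 20 * m; 20 * m; 20 * m; 20 * v + y; 20 * u] + h.
  by rewrite /=; lia.
case: k56 ku => -> /= ku wg; rewrite nn.
  have -> : u = 0 by lia.
  rewrite muln0 (_ : sumn _ = sumn [:: 20 * m; 20 * m; 20 * m; 20 * m; 20 * v + y]) //.
  apply: gdd_fill => //.
    have w50 x : w 5 x = 0 by rewrite /w /= (_ : u = 0); [case: x | lia].
    rewrite -s4 -{1}(sw 0) // -{1}(sw 1) // -{1}(sw 2) // -{1}(sw 3) //; apply: wg => f _.
    by have := blk f; rewrite w50; apply: g5.
  by move=> g; rewrite !inE => /or4P[/eqP->|/eqP->|/eqP->|/orP[]/eqP->].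
apply: gdd_fill => //.
  rewrite -s4 -s5 -{1}(sw 0) // -{1}(sw 1) // -{1}(sw 2) // -{1}(sw 3) //.
  by apply: wg => f _; apply: blk.
by move=> g; rewrite !inE => /or4P[/eqP->|/eqP->|/eqP->|/or3P[]/eqP->].
Qed.

(* A residue modulo 20 is decomposed as a light weight in {0, 5, 15} plus an
   optional additional point: 0 = 0 + 0, 1 = 0 + 1, 5 = 5 + 0, 16 = 15 + 1. *)
Definition res_one r := (r == 1) || (r == 16).
Definition res_light r := if r == 5 then 5 else if r == 16 then 15 else 0.
Definition admissible (ex : seq nat) n := (n %% 20 \in residues) && (n \notin ex).

Definition admissible_at (ex : seq nat) t r := (r \in residues) && (20 * t + r \notin ex).

(* One step of [td_step] with the transversal designs TD(k, m), for the listed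
   pairs (k, m). *)
Definition splits (ex : seq nat) t r := has (fun km => has (fun u =>
    let v := t - (4 * km.2 + u) in
    [&& 4 * km.2 + u <= t, u <= km.2, v + (0 < res_light r) <= km.2, (km.1 == 5) ==> (u == 0),
        admissible_at ex km.2 (res_one r), admissible_at ex u (res_one r) & admissible_at ex v r])
  (iota 0 km.2.+1)) [:: (5, 4); (6, 5); (6, 7); (5, 9); (6, 11)].

(** From [t = 46] on, the quotient [(t - 2) %/ 4] is at least 11, and so is the number m that
    [admissible_Kdec] derives from it; the finitely many smaller t are checked one by one. *)
Definition small_ok (ex known : seq nat) := all (fun t => all (fun r =>
  admissible_at ex t r ==> (20 * t + r \in known) || splits ex t r) residues) (iota 0 46).

(** Strong induction on the quotient t by 20, over all residues together, because filling the groups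
    leads to orders of residue 0 or 1 besides that of [n]. Since m is positive and t = 4m + u + v,
    all three groups sizes m, u and v are below t. *)
Lemma admissible_Kdec ex known :
    {subset ex <= [:: 5; 16; 20]} -> light 0 -> light 20 -> light 5 -> light 15 ->
    {in known, forall n, Kdec E n} -> small_ok ex known ->
  forall n, admissible ex n -> Kdec E n.
Proof.
move=> exS l0 l20 l5 l15 kK /allP sm.
have rE r : r \in residues -> r = res_light r + res_one r.
  by rewrite !inE => /or4P[] /eqP ->.
have lr r : r \in residues -> light (res_light r) by rewrite !inE => /or4P[] /eqP ->.
have K t : forall r, admissible_at ex t r -> Kdec E (20 * t + r).
  have [n] := ubnP t; elim: n t => // n IH t tn r tr.
  have step k m u v : td k m -> (k == 5) && (u == 0) || (k == 6) -> 0 < m ->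
      t = 4 * m + u + v -> u <= m -> v + (0 < res_light r) <= m ->
      admissible_at ex m (res_one r) -> admissible_at ex u (res_one r) -> admissible_at ex v r ->
      Kdec E (20 * t + r).
    move=> tdm ku m0 tE um vm am au av; have /andP[rr _] := tr.
    rewrite {1}(rE r rr) addnA tE; apply: (td_step tdm ku um vm l0 l20 (lr r rr)).
    - by apply: IH am; lia.
    - by apply: IH au; lia.
    - by rewrite -addnA -(rE r rr); apply: IH av; lia.
  have [t46|t46] := ltnP t 46.
    have := sm t; rewrite mem_iota => /(_ t46)/allP/(_ r).
    have /andP[rr _] := tr; rewrite tr => /(_ rr) /= /orP[/kK //|].
    move=> /hasP[[k m] km /hasP[u _ /and5P[/= t4 um vm ku /and3P[am au av]]]].
    have tdm : td k m.
      move: km; rewrite !inE => /or4P[| | |/orP[]] /eqP[-> ->]; try exact: td6.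
        exact: td4.
      exact: td9.
    apply: (step k m u (t - (4 * m + u)) tdm _ _ _ um vm am au av); last by rewrite subnKC.
      by move: km ku; rewrite !inE => /or4P[| | |/orP[]] /eqP[-> _] //= ->.
    by move: km; rewrite !inE => /or4P[| | |/orP[]] /eqP[_ ->].
  (* Such orders are at least 40, whereas the exceptions are at most 20. *)
  have big q s : 1 < q -> s \in residues -> admissible_at ex q s.
    move=> q1 sr; rewrite /admissible_at sr /=; apply/negP => /exS.
    by move: sr; rewrite !inE; lia.
  have /andP[rr _] := tr; have or : (res_one r : nat) \in residues by case: res_one.
  (* m is the largest number congruent to 1 or 5 modulo 6 that does not exceed [q]; the list gives
     the distance [e] for each residue of [q] modulo 6. As [e <= 3] and t lies between [4 * q + 2]
     and [4 * q + 5], the upper bound is [4 * m + 12 + 5]. *)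
  have [m [m6 m11 mt tm]] : exists m, [/\ coprime m 6, 11 <= m, 4 * m + 2 <= t & t <= 4 * m + 17].
    pose q := (t - 2) %/ 4; pose e := nth 0 [:: 1; 0; 1; 2; 3; 0] (q %% 6).
    have e3 : e <= 3 /\ (q - e) %% 6 \in [:: 1; 5].
      have : 11 <= q by rewrite /q; lia.
      rewrite /e !inE; have := ltn_pmod q (isT : 0 < 6).
      by case: {-2}(q %% 6) (erefl (q %% 6)) => [|[|[|[|[|[|]]]]]] //=; lia.
    exists (q - e); rewrite -coprime_modl; case: e3 => e3; rewrite !inE => qe.
    by split; [case/orP: qe => /eqP -> | rewrite /q in qe *; lia ..].
  (* Beside a light point the fifth group has room for m - 1 points of weight 20, hence certainly
     for 10. A remainder t - 4m of 11 to 17 puts 7 points into the sixth group. In both cases v lies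
     between 2 and 10, which also avoids the exceptional orders. *)
  have [s17|s17] := leqP t (4 * m + 10).
    have a0 : admissible_at ex 0 (res_one r).
      by rewrite /admissible_at or; apply/negP => /exS; rewrite !inE; case: res_one.
    apply: (step 6 m 0 (t - 4 * m) (td6 m6) _ _ _ _ _ _ a0) => //; try (apply: big => //);
      by case: (0 < res_light r); lia.
  apply: (step 6 m 7 (t - 4 * m - 7) (td6 m6)) => //; try (apply: big => //);
    by case: (0 < res_light r); lia.
move=> n /andP[nr nex]; rewrite (divn_eq n 20) mulnC; apply: K.
by rewrite /admissible_at nr mulnC -divn_eq.
Qed.

(** Seven designs give eight ingredients: the one with parts 20^5 serves both for a fifth point of
    weight 20 and, with an empty part, for a sixth point of weight 0. *)
Definition lights_ok ds :=
  if ds is [:: d4; d5; d6; d45; d415; d55; d515] then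
    [&& design_gdd_ok E 4 [:: 20; 20; 20; 20; 0] d4,
        design_gdd_ok E 5 [:: 20; 20; 20; 20; 20; 0] d5,
        design_gdd_ok E 5 [:: 20; 20; 20; 20; 20] d5,
        design_gdd_ok E 6 [:: 20; 20; 20; 20; 20; 20] d6,
        design_gdd_ok E 4 [:: 20; 20; 20; 20; 5] d45,
        design_gdd_ok E 4 [:: 20; 20; 20; 20; 15] d415,
        design_gdd_ok E 5 [:: 20; 20; 20; 20; 20; 5] d55 &
        design_gdd_ok E 5 [:: 20; 20; 20; 20; 20; 15] d515]
  else false.

(** The list [lights] plays two roles: its designs replace the blocks of transversal designs, and
    those with prescribed fillings also yield complete graphs for the table. The designs in [start]
    precede it because its groups have to be filled. *)
Lemma designs_Kdec ex start lights rest : all (mem [:: 5; 16; 20]) ex ->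
    lights_ok lights -> table_ok E [:: 0; 1] (start ++ lights ++ rest) ->
    small_ok ex (0 :: 1 :: orders (start ++ lights ++ rest)) ->
  forall n, admissible ex n -> Kdec E n.
Proof.
move=> /allP exS; case: lights => // d4 [//|d5 [//|d6 [//|d45 [//|d415 [//|d55 [//|d515 [|//]]]]]]].
move=> /and5P[g40 g50 g5 g6 /and4P[g45 g415 g55 g515]] tP.
apply: admissible_Kdec => //.
1-4: by split; apply: (design_gdd Ewf); eassumption.
have K01 : {in [:: 0; 1], forall n, Kdec E n}.
  by move=> n; rewrite !inE => /orP[]/eqP ->; apply: Kdec_small.
move=> n; rewrite -[_ :: _]/([:: 0; 1] ++ _) mem_cat => /orP[/K01 //|].
exact: (table_Kdec Ewf tP K01).
Qed.

End Recursion.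

(** * Designs as lists of blocks *)

Definition simple_edges (E : seq (nat * nat)) :=
  uniq (E ++ [seq (e.2, e.1) | e <- E]).

Lemma set2_eq (T : finType) (x y a b : T) :
  [set x; y] = [set a; b] -> (x, y) = (a, b) \/ (x, y) = (b, a).
Proof.
have half (u v c d : T) : [set u; v] = [set c; d] -> u = c -> v = d.
  move=> e uc; have /set2P[vc|//] : v \in [set c; d] by rewrite -e set22.
  have : d \in [set u; v] by rewrite e set22.
  by rewrite vc uc => /set2P[].
move=> e; have /set2P[xa|xb] : x \in [set a; b] by rewrite -e set21.
  by left; rewrite (half _ _ _ _ e xa) xa.
have e' : [set x; y] = [set b; a] by rewrite e setUC.
by right; rewrite (half _ _ _ _ e' xb) xb.
Qed.

Lemma edges6E s (x y : 'I_6) :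
  ([set x; y] \in edges6 s) = ((x.+1, y.+1) \in s ++ [seq (e.2, e.1) | e <- s]).
Proof.
rewrite mem_cat; apply/imsetP/orP => [[[a b]]|[xy|/mapP[[a b] ab [xb ya]]]].
- rewrite inE /= => ab /set2_eq[[-> ->]|[-> ->]]; [by left | right].
  by apply/mapP; exists (a.+1, b.+1).
- by exists (x, y); rewrite ?inE.
- by exists (y, x); rewrite ?inE /= 1?setUC // xb ya.
Qed.

Section Interface.
Variable s : seq (nat * nat).
Hypothesis swf : wf_edges s.
Hypothesis ss : simple_edges s.

Definition copy_edges (T : finType) (f : nat -> T) : {set {set T}} :=
  [set (fun x : 'I_6 => f x.+1) @: e | e : {set 'I_6} in edges6 s].

Lemma labelsP a : reflect (exists x : 'I_6, a = x.+1) (a \in labels).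
Proof.
rewrite mem_iota; apply: (iffP andP) => [[a0 a7]|[x ->]]; last by have := ltn_ord x; lia.
have a6 : a.-1 < 6 by lia.
by exists (Ordinal a6); rewrite prednK.
Qed.

Lemma labels_inj (T : eqType) (f : nat -> T) : uniq (map f labels) ->
  injective (fun x : 'I_6 => f x.+1).
Proof.
move=> fu x y e; apply: val_inj; apply: succn_inj.
have ll (z : 'I_6) : z.+1 \in labels by apply/labelsP; exists z.
have := ll x; have := ll y; move: x.+1 y.+1 e => a b e bl al.
have := fu; rewrite -[labels]/(map id labels) => fu'.
have := index_uniq (f a) (s := map f labels).
have na c : c \in labels -> c = nth 0 labels (index c labels) by move=> cl; rewrite nth_index.
have ic c : c \in labels -> index c labels < size (map f labels) by rewrite size_map index_mem.
move/(_ (index a labels) (ic a al) fu); rewrite (nth_map 0) -?na -?(size_map f) ?ic // e.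
have := index_uniq (f a) (ic b bl) fu; rewrite (nth_map 0) -?na -?(size_map f) ?ic // => -> i.
by rewrite (na a al) (na b bl) i.
Qed.

(** The doubled edge list has no repetition and [f] is injective on labels, so a multiplicity is 0
    or 1 and merely records membership. This links the counting form of a decomposition to edge
    sets. *)
Lemma count_arcs_copy (T : finType) (f : nat -> T) (u v : T) : uniq (map f labels) ->
  count_mem (u, v) (arcs s f) = ([set u; v] \in copy_edges f).
Proof.
move=> fu; have fI := labels_inj fu.
have sl e : e \in s ++ [seq (e.2, e.1) | e <- s] -> exists x y : 'I_6, e = (x.+1, y.+1).
  rewrite mem_cat => /orP[/(allP swf)/andP[/labelsP[x x1] /labelsP[y y1]]|].
    by exists x, y; rewrite -x1 -y1; case: e x1 y1.
  by move=> /mapP[[a b] /(allP swf)/andP[/labelsP[x /= ->] /labelsP[y /= ->]] ->]; exists y, x.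
rewrite count_uniq_mem.
  congr nat_of_bool; apply/mapP/imsetP => [[e eE [-> ->]]|[e]].
    have [x [y exy]] := sl e eE.
    by exists [set x; y]; rewrite ?edges6E ?imsetU1 ?imset_set1 -?exy // exy.
  move=> /imsetP[[x y]]; rewrite inE /= => xy -> ; rewrite imsetU1 imset_set1.
  move=> /set2_eq[[-> ->]|[-> ->]]; [exists (x.+1, y.+1) | exists (y.+1, x.+1)] => //.
    by rewrite mem_cat xy.
  by rewrite mem_cat; apply/orP; right; apply/mapP; exists (x.+1, y.+1).
rewrite map_inj_in_uniq // => e1 e2 /sl[x1 [y1 ->]] /sl[x2 [y2 ->]] /= [].
by move=> /(fI x1 x2) -> /(fI y1 y2) ->.
Qed.

Lemma Kdec_ord n : Kdec s n <-> decomposable s (@predT 'I_n) (fun x y => x != y).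
Proof.
split.
  case: n => [_|n]; first by apply: decomposable_ext (decomposable0 s _) => // -[].
  apply: (@decomposable_map _ swf _ _ _ _ inord).
  - by move=> x y xn yn e; rewrite -(inordK xn) -(inordK yn) e.
  - by [].
  - by move=> x y xn yn; rewrite xn yn -val_eqE /= !inordK // andbT.
  by move=> x y _; exists (val x), (val y); rewrite !inord_val /= !ltn_ord.
apply: (@decomposable_map _ swf _ _ _ _ val).
- by move=> x y _ _; apply: val_inj.
- by move=> x _; apply: ltn_ord.
- by move=> x y _ _; rewrite !ltn_ord -val_eqE /= !andbT.
move=> x y; rewrite eqb0 negbK => /and3P[_ xn yn].
by exists (Ordinal xn), (Ordinal yn).
Qed.

Hypothesis sP : all (fun p => p.1 != p.2) s.
Hypothesis s0 : s != [::].

(** Every pair of distinct points lies in exactly one copy, which gives covering and disjointness of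
    the edge sets at once; the sets are nonempty because [s] is. *)
Lemma Kdec_design n : Kdec s n -> has_design (graph6 sP) n.
Proof.
move/Kdec_ord => [B [/all_nthP BP Bw]].
(* Indexing the blocks uses a default placement, taken from the list itself. An empty list means
   that there are no edges, and then the empty partition is a design. *)
have [b0|f0] := altP (@nilP _ B).
  exists set0; split; last by move=> F; rewrite inE.
  suff -> : eset (complete n) = set0.
    by rewrite /partition /cover big_set0 eqxx inE andbT; apply/trivIsetP => A; rewrite inE.
  apply/setP => e; rewrite !inE; apply/negbTE/negP => /cards2P[x [y [xy _]]].
  by have := Bw x y; rewrite b0 /= xy.
case: B BP Bw f0 => // fd B; move: (fd :: B) => {B} B BP Bw _.
pose F i := copy_edges (nth fd B i).
have Bu i : i < size B -> uniq (map (nth fd B i) labels) by move=> /(BP fd)/andP[].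
(* The multiplicity condition in terms of edge sets: one copy for each pair of distinct points. *)
have wE x y : \sum_(i < size B) ([set x; y] \in F i) = (x != y).
  rewrite -Bw count_flatten -map_comp sumnE big_map (big_nth fd) big_mkord.
  by apply: eq_bigr => i _; rewrite /= count_arcs_copy // Bu.
have F2 i e : i < size B -> e \in F i -> exists x y, x != y /\ e = [set x; y].
  move=> iB /imsetP[e' /imsetP[[a b]]]; rewrite inE /= => ab -> ->; rewrite imsetU1 imset_set1.
  exists (nth fd B i a.+1), (nth fd B i b.+1); split=> //.
  rewrite (inj_eq (labels_inj (Bu i iB))).
  by have := allP sP _ ab; rewrite /= eqSS.
exists [set F i | i : 'I_(size B)]; split.
  apply/and3P; split.
  - apply/eqP/setP => e; rewrite inE; apply/bigcupP/idP.
      move=> [_ /imsetP[i _ ->] /F2[//|x [y [xy ->]]]]; by rewrite cards2 xy.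
    move=> /cards2P[x [y [xy ->]]]; have := wE x y; rewrite xy => w.
    have [i xyi|no] := pickP (fun i : 'I_(size B) => [set x; y] \in F i).
      by exists (F i); rewrite ?imset_f.
    by move: w; rewrite big1 // => i _; rewrite no.
  - apply/trivIsetP => _ _ /imsetP[i _ ->] /imsetP[j _ ->] ij.
    apply/pred0P => e /=; apply/negP => /andP[/[dup] /F2[//|x [y [xy ->]]] ei ej].
    have := wE x y; rewrite (bigD1 i) //= (bigD1 j) /=; last first.
      by apply: contraNneq ij => ->.
    by rewrite ei ej; case: (x != y).
  apply/negP => /imsetP[i _ /esym]; apply/eqP/set0Pn.
  have [x [y xy]] : exists x y : 'I_6, (x.+1, y.+1) \in s.
    case: s s0 swf => // -[a b] s' _ /= /andP[/andP[/labelsP[x /= ->] /labelsP[y /= ->]] _].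
    by exists x, y; rewrite mem_head.
  by eexists; apply: imset_f; apply: (imset_f _ (x := (x, y))); rewrite inE.
move=> _ /imsetP[i _ ->].
have fI := labels_inj (Bu i (ltn_ord i)).
pose phi (x : 'I_6) := nth fd B i x.+1.
have wf e : e \in F i -> #|e| = 2 /\ e \subset phi @: [set: 'I_6].
  move=> ei; split; first by have [//|x [y [xy ->]]] := F2 i e _ ei; rewrite cards2 xy.
  by case/imsetP: ei => e' _ ->; apply: imsetS; apply: subsetT.
exists (SGraph wf); split=> //.
  split; rewrite ?subsetT //; apply/subsetP => e /F2[//|x [y [xy ->]]].
  by rewrite inE cards2 xy.
exists (fun x => phi (val x)); split.
- by move=> x y /fI /val_inj.
- apply/setP => u; apply/imsetP/imsetP => [[x _ ->]|[x _ ->]]; first by exists (val x).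
  by exists (exist _ x (in_setT x)).
move=> x y /=; have -> : [set phi (val x); phi (val y)] = phi @: [set val x; val y].
  by rewrite imsetU1 imset_set1.
exact: mem_imset (imset_inj fI).
Qed.

(** The isomorphism onto the subgraph carried by a part, precomposed with the shift from labels to
    ordinals, is a placement of the labels. Summing over the parts gives multiplicity 1 because
    exactly one part contains a given edge. *)
Lemma design_Kdec n : has_design (graph6 sP) n -> Kdec s n.
Proof.
move=> [P [/and3P[/eqP cP /trivIsetP tP _] PH]]; apply/Kdec_ord.
have [B [BP Bw]] : decomposable s (@predT 'I_n) (fun x y => \sum_(F <- enum P) ([set x; y] \in F)).
  apply: decomposable_sum => F; rewrite mem_enum => /PH[[V Ed Ewf] [HK [g [/= gI gV gE]] /= EF]].
  pose f k := g (exist _ (inord k.-1 : 'I_6) (in_setT _)).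
  have fE (x : 'I_6) : f x.+1 = g (exist _ x (in_setT x)).
    by congr g; apply: val_inj; rewrite /= inord_val.
  have fu : uniq (map f labels).
    rewrite map_inj_in_uniq ?iota_uniq // => a b /labelsP[x ->] /labelsP[y ->].
    by rewrite !fE => /gI [->].
  have gX z : z \in V -> exists x : 'I_6, z = f x.+1.
    rewrite -gV => /imsetP[x _ ->]; exists (val x); rewrite fE; congr g; exact: val_inj.
  exists [:: f]; split=> [|x y]; first by rewrite /= andbT /placed fu all_predT.
  rewrite /= cats0 count_arcs_copy // -EF; congr nat_of_bool.
  apply/imsetP/idP => [[e /imsetP[[a b]]]|xyE].
    rewrite inE /= => ab -> ; rewrite imsetU1 imset_set1 !fE => ->.
    by rewrite gE /= edges6E mem_cat ab.
  have [_ /subsetP xyV] := Ewf _ xyE.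
  have [a xa] := gX x (xyV x (set21 _ _)); have [b yb] := gX y (xyV y (set22 _ _)).
  exists [set a; b]; last by rewrite imsetU1 imset_set1 xa yb.
  by move: xyE; rewrite xa yb !fE gE.
exists B; split=> // x y; rewrite Bw.
have [->|xy] := eqVneq x y.
  rewrite big1_seq // => F /andP[_]; rewrite mem_enum => FP; apply/eqP; rewrite eqb0.
  apply/negP => yyF; have : [set y; y] \in cover P by apply/bigcupP; exists F.
  by rewrite cP inE cards2 eqxx.
have : [set x; y] \in cover P by rewrite cP inE cards2 xy.
case/bigcupP => F FP xyF; rewrite (bigD1_seq F) ?enum_uniq ?mem_enum //= xyF big1_seq //.
move=> F' /andP[F'F]; rewrite mem_enum => F'P; apply/eqP; rewrite eqb0; apply/negP => xyF'.
have := tP _ _ F'P FP F'F; move/pred0P/(_ [set x; y]).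
by rewrite /= xyF xyF'.
Qed.

End Interface.

(** * Nonexistence *)

Section Counting.
Variables (E : seq (nat * nat)) (n : nat) (B : seq (nat -> nat)).
Hypothesis Ewf : wf_edges E.
Hypothesis BP : all (placed (fun x => x < n)) B.
Hypothesis Bw : forall x y, count_mem (x, y) (flatten (map (arcs E) B)) = [&& x != y, x < n & y < n].

Definition occ (L : seq nat) x := \sum_(f <- B) count (fun a => f a == x) L.

(** Over all blocks, every ordered pair of distinct points occurs exactly once as an arc. The counts
    of blocks, of degrees and of pairs inside a set are the choices of [Q] that follow. *)
Lemma count_arcs (Q : nat -> nat -> bool) :
  \sum_(f <- B) count (fun p => Q p.1 p.2) (arcs E f) = \sum_(x < n) \sum_(y < n) (Q x y && (x != y)).
Proof.
have -> : \sum_(f <- B) count (fun p => Q p.1 p.2) (arcs E f) =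
    count (fun p => Q p.1 p.2) (flatten (map (arcs E) B)).
  by rewrite count_flatten -map_comp sumnE big_map.
have An := all_arcs Ewf BP.
transitivity (\sum_(x < n) \sum_(y < n) Q x y * count_mem (val x, val y) (flatten (map (arcs E) B))).
  2: apply: eq_bigr => x _; apply: eq_bigr => y _.
  2: by rewrite Bw !ltn_ord !andbT -val_eqE /=; case: (Q x y); case: eqP.
elim: (flatten _) An => [_|[a b] A IH /= /andP[/andP[an bn] /IH ->]].
  by rewrite big1 // => i _; rewrite big1 // => j _; rewrite muln0.
transitivity (\sum_(x < n) (\sum_(y < n) Q x y * ((a, b) == (val x, val y)) +
    \sum_(y < n) Q x y * count_mem (val x, val y) A)).
  2: by apply: eq_bigr => x _; rewrite -big_split; apply: eq_bigr => y _; rewrite mulnDr.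
rewrite big_split /=; congr (_ + _).
rewrite (bigD1 (Ordinal an)) //= (bigD1 (Ordinal bn)) //= eqxx muln1.
rewrite !big1 ?addn0 // => [i ia|i ib].
  rewrite big1 // => j _.
  by rewrite xpair_eqE [a == _]eq_sym -[_ == a]/(i == Ordinal an) (negbTE ia) muln0.
by rewrite xpair_eqE [b == _]eq_sym -[_ == b]/(i == Ordinal bn) (negbTE ib) andbF muln0.
Qed.

Lemma count_blocks : size B * (size E).*2 = n * n.-1.
Proof.
have := count_arcs (fun _ _ => true).
under eq_bigr => f _ do rewrite count_predT size_map size_cat size_map addnn.
rewrite big_const_seq count_predT iter_addn_0 mulnC => ->.
rewrite -[in RHS](card_ord n) -sum_nat_const; apply: eq_bigr => x _.
have := sum1_card (predC1 x); rewrite cardC1 card_ord => <-.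
by rewrite [RHS]big_mkcond; apply: eq_bigr => y _ /=; rewrite inE /= eq_sym; case: eqP.
Qed.

Lemma degree x : x < n -> \sum_(f <- B) count (fun p => p.1 == x) (arcs E f) = n.-1.
Proof.
move=> xn; rewrite (count_arcs (fun a _ => a == x)) (bigD1 (Ordinal xn)) //=.
rewrite [X in _ + X]big1 => [|i ix]; last first.
  by rewrite big1 // => j _; rewrite -val_eqE /= in ix; rewrite (negbTE ix).
have := sum1_card (predC1 (Ordinal xn)); rewrite cardC1 card_ord => <-.
rewrite addn0 [RHS]big_mkcond; apply: eq_bigr => y _ /=.
by rewrite eqxx inE /= eq_sym; case: eqP.
Qed.

(** Double counting of the incidences between points satisfying [Q] and places with a label in
    [L]. *)
Lemma sum_occ (Q : pred nat) L : {subset L <= labels} ->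
  \sum_(x < n) Q x * occ L x = \sum_(f <- B) count (fun a => Q (f a)) L.
Proof.
move=> LL; transitivity (\sum_(x < n) \sum_(f <- B) Q x * count (fun a => f a == x) L).
  by apply: eq_bigr => x _; rewrite big_distrr.
rewrite exchange_big /=; elim: B BP => [|f B' IH] /=; first by rewrite !big_nil.
move=> /andP[/andP[_ /allP fn] /IH e]; rewrite !big_cons {}e {IH}; congr (_ + _).
elim: L LL => [_|a L IHL LL] /=; first by rewrite big1 // => i _; rewrite muln0.
transitivity (\sum_(x < n) (Q x * (f a == x) + Q x * count (fun a => f a == x) L)).
  by apply: eq_bigr => x _; rewrite mulnDr.
rewrite big_split /= IHL => [|b bL]; last by apply: LL; rewrite inE bL orbT.
congr (_ + _); have an : f a < n by apply: fn; rewrite map_f // LL ?mem_head.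
rewrite (bigD1 (Ordinal an)) //= eqxx muln1 big1 ?addn0 // => i ia.
by rewrite -val_eqE /= eq_sym in ia; rewrite (negbTE ia) muln0.
Qed.

(** All edges inside [A] have to be covered, and a block covers few of them unless it places many
    points of [A] on labels in [L]. Pairs are ordered, so [c] is twice the number of edges allowed
    for each such place. *)
Lemma inner_pairs (A : pred nat) L c : {subset L <= labels} ->
    (forall f : nat -> nat, count (fun p => A p.1 && A p.2) (arcs E f) <=
       c * count (fun a => A (f a)) L) ->
  (\sum_(x < n) A x) * (\sum_(x < n) A x).-1 <= c * \sum_(x < n) A x * occ L x.
Proof.
move=> LL fc; rewrite sum_occ // big_distrr /=.
apply: leq_trans (leq_sum _ (fun f _ => fc f)).
rewrite (count_arcs (fun x y => A x && A y)).
set k := \sum_(x < n) A x.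
suff -> : \sum_(x < n) \sum_(y < n) ((A x && A y) && (x != y)) = \sum_(x < n) A x * k.-1.
  by rewrite -big_distrl.
apply: eq_bigr => x _; case Ax: (A x); last by rewrite big1.
have -> : k = (\sum_(y < n | y != x) A y).+1 by rewrite /k (bigD1 x) //= Ax.
rewrite mul1n /= [RHS]big_mkcond; apply: eq_bigr => y _.
by rewrite eq_sym; case: (y == x); rewrite ?andbF ?andbT.
Qed.

End Counting.

Lemma residue20 n : 20 %| n * n.-1 -> n %% 20 \in residues.
Proof.
case: n => // n /=; have nS : n.+1 = (n %% 20).+1 %[mod 20] by rewrite -[n.+1]addn1 -modnDml addn1.
have nn : n.+1 * n = (n %% 20).+1 * (n %% 20) %[mod 20] by rewrite -modnMm nS modnMm -modnMmr modnMmr.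
rewrite /dvdn nn nS.
have /allP H : all (fun r => (r.+1 * r %% 20 == 0) ==> (r.+1 %% 20 \in [:: 0; 1; 5; 16])) (iota 0 20).
  by [].
by apply/implyP; apply: H; rewrite mem_iota ltn_mod.
Qed.

Section Obstructions.
Variables (E : seq (nat * nat)) (n : nat).
Hypothesis Ewf : wf_edges E.

Lemma Kdec_residue : size E = 10 -> Kdec E n -> n %% 20 \in residues.
Proof.
move=> E10 [B [BP Bw]]; apply: residue20.
by rewrite -(count_blocks Ewf BP Bw) E10 dvdn_mull.
Qed.

Lemma Kdec_not5 : ~ Kdec E 5.
Proof.
move=> [[|f B] [/= BP Bw]]; first by have := Bw 0 1.
have /andP[/andP[fu /allP f5] _] := BP.
have /uniq_leq_size : {subset map f labels <= iota 0 5} by move=> x /f5; rewrite mem_iota.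
by rewrite size_map => /(_ fu).
Qed.

End Obstructions.

(** * The edge lists of the five graphs and the exceptional orders 16 and 20 *)

Definition n3_edges := [:: (5, 3); (5, 2); (5, 1); (4, 3); (4, 2); (4, 1);
  (6, 1); (3, 2); (3, 1); (2, 1)].
Definition n6_edges := [:: (6, 2); (6, 3); (6, 1); (5, 2); (5, 3); (5, 1);
  (4, 2); (4, 3); (4, 1); (2, 1)].
Definition n8_edges := [:: (6, 4); (6, 2); (6, 1); (5, 3); (5, 2); (5, 1);
  (4, 2); (4, 1); (3, 2); (3, 1)].
Definition n10_edges := [:: (4, 3); (4, 2); (4, 5); (4, 1); (6, 1); (3, 2);
  (3, 5); (3, 1); (2, 5); (2, 1)].
Definition n13_edges := [:: (6, 4); (6, 3); (6, 1); (5, 3); (5, 2); (5, 1);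
  (4, 2); (4, 1); (3, 1); (2, 1)].

(** For a graph with only two vertex degrees, the degree n - 1 of a point in the complete graph
    becomes a linear equation for the numbers of times it plays the two kinds of roles, which has
    few solutions when n is small. *)
Lemma occ_degree E n B d L d' L' : wf_edges E -> all (placed (fun x => x < n)) B ->
    (forall x y, count_mem (x, y) (flatten (map (arcs E) B)) = [&& x != y, x < n & y < n]) ->
    (forall (f : nat -> nat) x, count (fun p => p.1 == x) (arcs E f) =
       d * count (fun a => f a == x) L + d' * count (fun a => f a == x) L') ->
  forall x, x < n -> n.-1 = d * occ B L x + d' * occ B L' x.
Proof.
move=> Ewf BP Bw dE x xn; rewrite -(degree Ewf BP Bw xn) /occ !big_distrr -big_split /=.
by apply: eq_bigr => f _; apply: dE.
Qed.

Lemma sum_occ1 n B L : all (placed (fun x => x < n)) B -> {subset L <= labels} ->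
  \sum_(x < n) occ B L x = size B * size L.
Proof.
move=> BP LL; under eq_bigr do rewrite -[occ _ _ _]mul1n.
rewrite (sum_occ BP xpredT LL) (eq_bigr (fun=> size L)) => [|f _]; last exact: count_predT.
by rewrite big_const_seq count_predT iter_addn_0 mulnC.
Qed.

(* The eight vertices placed three times on a vertex of degree 4 are placed once
   on a vertex of degree 3. A block covers at most 5/2 edges between them for each
   such place, which makes at most 20 of their 28 edges. *)
Lemma n8_not16 : ~ Kdec n8_edges 16.
Proof.
move=> [B [BP Bw]].
(* The solutions are (0, 5) and (3, 1). *)
have deg x : x < 16 -> 15 = 4 * occ B [:: 1; 2] x + 3 * occ B [:: 3; 4; 5; 6] x.
  by apply: (occ_degree _ BP Bw) => // f y /=; lia.
have sB : size B = 12 by have := count_blocks (isT : wf_edges n8_edges) BP Bw; rewrite /=; lia.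
have hub : {subset [:: 1; 2] <= labels} by apply/allP.
have low : {subset [:: 3; 4; 5; 6] <= labels} by apply/allP.
have s1 := sum_occ1 BP hub.
pose A x := occ B [:: 1; 2] x == 3.
(* The 12 blocks offer 24 places on labels of degree 4, and each point of [A] occupies three of
   them. *)
have sA : \sum_(x < 16) A x = 8.
  apply/eqP; rewrite -(eqn_pmul2l (isT : 0 < 3)) big_distrr /=; apply/eqP.
  rewrite (eq_bigr (fun x : 'I_16 => occ B [:: 1; 2] x)) ?s1 ?sB // => x _.
  by have := deg x (ltn_ord x); rewrite /A; case: eqP => [->|]; lia.
have := inner_pairs (isT : wf_edges n8_edges) BP Bw (A := A) (c := 5) low.
rewrite sA (eq_bigr (fun x : 'I_16 => A x : nat)) ?sA => [H|x _]; last first.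
  by have := deg x (ltn_ord x); rewrite /A; case: eqP => [->|]; lia.
suff : 56 <= 40 by [].
apply: H => f /=.
(* The bound for one block depends only on which of its six vertices lie in [A]. *)
by case: (A (f 1)) (A (f 2)) (A (f 3)) (A (f 4)) (A (f 5)) (A (f 6)) => [] [] [] [] [] [].
Qed.

(** [n13] is a wheel with hub 1, of degree 5, and rim cycle 6, 4, 2, 5, 3. Each block has one hub,
    so the hub places number n (n - 1) / 20 in all. *)
Lemma n13_occ B n : all (placed (fun x => x < n)) B ->
    (forall x y, count_mem (x, y) (flatten (map (arcs n13_edges) B)) = [&& x != y, x < n & y < n]) ->
  (forall x, x < n -> n.-1 = 5 * occ B [:: 1] x + 3 * occ B [:: 2; 3; 4; 5; 6] x) /\
  \sum_(x < n) occ B [:: 1] x * 20 = n * n.-1.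
Proof.
move=> BP Bw; split=> [x|].
  by apply: (occ_degree _ BP Bw) => // f y /=; lia.
have hub : {subset [:: 1] <= labels} by apply/allP.
by rewrite -big_distrl /= (sum_occ1 BP hub) muln1 -(count_blocks (isT : wf_edges n13_edges) BP Bw).
Qed.

(* Four vertices are always hubs of the wheel, but every edge of the wheel has an
   end on the rim, so no block covers an edge between two of them. *)
Lemma n13_not16 : ~ Kdec n13_edges 16.
Proof.
move=> [B [BP Bw]]; have [deg s1] := n13_occ BP Bw.
pose A x := occ B [:: 1] x == 3.
have sA : \sum_(x < 16) A x = 4.
  (* The equation 15 = 5 a + 3 b has the solutions (0, 5) and (3, 0). A point of [A] contributes 3 *
     20 = 60 to the total 16 * 15 = 240. *)
  apply/eqP; rewrite -(eqn_pmul2r (isT : 0 < 60)) big_distrl /=; apply/eqP.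
  rewrite -[RHS]s1; apply: eq_bigr => x _.
  by have := deg x (ltn_ord x); rewrite /A; case: eqP => [->|]; lia.
have rim : {subset [:: 2; 3; 4; 5; 6] <= labels} by apply/allP.
(* A block has 20 arcs and each has an end on the rim, so 20 for every rim place of [A] is a valid
   bound; points of [A] have no rim places, and the right side is 0. *)
have := inner_pairs (isT : wf_edges n13_edges) BP Bw (A := A) (c := 20) rim.
rewrite sA [X in 20 * X]big1 => [H|x _]; last first.
  by have := deg x (ltn_ord x); rewrite /A; case: eqP => [->|]; lia.
suff : 12 <= 0 by [].
apply: H => f /=.
by case: (A (f 1)) (A (f 2)) (A (f 3)) (A (f 4)) (A (f 5)) (A (f 6)) => [] [] [] [] [] [].
Qed.

(* Every vertex would be the hub of two of the 19 blocks. *)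
Lemma n13_not20 : ~ Kdec n13_edges 20.
Proof.
move=> [B [BP Bw]]; have [deg] := n13_occ BP Bw.
(* The equation 19 = 5 a + 3 b forces a = 2, and 40 is 20 times this value; the sum is 800 instead
   of 380. *)
rewrite (eq_bigr (fun=> 40)) => [|x _]; first by rewrite sum_nat_const card_ord.
by have := deg x (ltn_ord x); lia.
Qed.

(** * Base blocks *)

(** Order 20 is developed over Z_19 with one fixed point. A single base block gives this point
    degree 19 only if it is placed on a vertex of degree 1, here the label 6; the same holds for
    [n10]. *)
Definition n3_small : seq design := [::
  Design [:: false] 19 [:: (19, 0, 19); (1, 1, 1)] [::
    668641452105728]%positive;
  Design [:: false] 21 [:: (21, 0, 21)] [::
    388334302527491]%positive].

(** With a light part of 5 or 15 points there are 280, 360, 450 or 550 blocks, an odd multiple of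
    half the number of heavy points. Hence a group of order 40 or 50 with two full orbits. As 15
    divides neither order, a part of 15 points consists of orbits of lengths 10 and 5. The tables of
    the other graphs follow the same pattern. *)
Definition n3_gdds : seq design := [::
  Design [:: false; true] 80 [:: (80, 0, 4)] [::
    494097603495424; 75041669925911; 247051763061760]%positive;
  Design [:: false; true] 100 [:: (100, 0, 5)] [::
    1901330488673287; 1621988628777472; 1377207036434433; 884076079256070]%positive;
  Design [:: false; true] 120 [:: (120, 0, 6)] [::
    2079110744303104; 2041736615970304; 1548663894068736; 1307732852092416; 387237083875328]%positive;
  Design [::] 40 [:: (40, 0, 4); (40, 0, 4); (5, 1, 1)] [::
    1516226554403897; 1585369605493288; 1517051171849786; 2820530133035520; 2572249755812352;
    2500909128764416; 497672626391552]%positive;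
  Design [::] 40 [:: (40, 0, 4); (40, 0, 4); (10, 1, 1); (5, 1, 1)] [::
    1483871741280299; 3276140542189096; 3101803381561856; 2959483473270272; 2502353052016640;
    2076778436496384; 1905397552667136; 458358927961091; 36769634720768]%positive;
  Design [::] 50 [:: (50, 0, 5); (50, 0, 5); (5, 1, 1)] [::
    2076434423661117; 2609635299736576; 3525446619662891; 3204265329848832; 2853713725130756;
    640396812387901; 2045652009795584; 774674812019712; 459394268268032]%positive;
  Design [::] 50 [:: (50, 0, 5); (50, 0, 5); (10, 1, 1); (5, 1, 1)] [::
    3659458731573345; 3945605140890674; 1938796708888665; 3906916625163776; 3765223897694306;
    2467372823748686; 3875510858586624; 3379211572140553; 3314683975338507; 499049302906880;
    422284695708672]%positive].

(** Together with the preceding entries and the transversal steps, these designs reach all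
    admissible orders below 920, the range examined by [small_ok]. *)
Definition n3_large : seq design := [::
  Design [:: false] 5 [:: (5, 0, 5); (5, 1, 5); (5, 2, 5); (5, 3, 5); (5, 4, 5)] [::
    528523243028496; 529003337221637; 317830668488714; 106037110384650; 845733557447168;
    36561850997760]%positive;
  Design [:: false] 9 [:: (9, 0, 9); (9, 1, 9); (9, 2, 9); (9, 3, 9)] [::
    388749980073993; 741144121850898; 669535073482778; 599922240665122; 492651138262546;
    493477791006739; 1196476286116352]%positive;
  Design [:: false] 39 [:: (39, 0, 39); (1, 1, 1)] [::
    1372397749665801; 457745134002688]%positive;
  Design [:: false] 41 [:: (41, 0, 41)] [::
    1409780206534667; 422350446657545]%positive;
  Design [:: false] 9 [:: (9, 0, 9); (9, 1, 9); (9, 2, 9); (9, 3, 9); (9, 4, 9)] [::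
    775294354739236; 528731414484507; 458226574833682; 1722152662050; 563774594236460;
    706436224531992; 1478501289438208; 740938907924480; 950459091388454; 424892664138240;
    688671688722]%positive;
  Design [:: false] 11 [:: (11, 0, 11); (11, 1, 11); (11, 2, 11); (11, 3, 11); (11, 4, 11);
    (1, 5, 1)] [::
    1408680562552373; 1691670452389398; 810481945429551; 776736257369142; 1551756521653771;
    1936448961143318; 1302649630097441; 1197442390032426; 1584812209995820; 459804039446579;
    37320852773888; 634696443625508; 1691535301411840; 387234253515290]%positive;
  Design [:: false] 59 [:: (59, 0, 59); (1, 1, 1)] [::
    1585220898265623; 2078145696518665; 36150341550592]%positive;
  Design [:: false] 61 [:: (61, 0, 61)] [::
    74354478034468; 633938262097975; 275961110533]%positive;
  Design [:: false] 13 [:: (13, 0, 13); (13, 1, 13); (13, 2, 13); (13, 3, 13); (13, 4, 13)] [::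
    1308771252795; 844838597820441; 1971221952475136; 915139017583668; 1196276720612357;
    563577023114778; 1372948715306047; 1655803181025818; 70921990732329; 459600960974375;
    1092782354879001; 1902299550338604; 635591277959719; 739360102437927; 106862014385707;
    2044954468417580]%positive;
  Design [:: false] 19 [:: (19, 0, 19); (19, 1, 19); (19, 2, 19); (19, 3, 19)] [::
    1761633866360381; 2076500206321721; 671189185331258; 1444835601182246; 1412322691664459;
    989977625786368; 1690302638194719; 1692294568775168; 812271469101056; 1726102805965312;
    917270940902419; 1903873103761415; 1091127856611903; 915207344375296; 142936516097577]%positive;
  Design [:: false] 30 [:: (30, 0, 3); (30, 0, 3); (10, 1, 1); (10, 1, 1); (5, 1, 1)] [::
    2925259689063454; 1236136284936222; 2925327866670592; 1166453000896565; 1162939713220178;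
    2644061469017088; 2077600909133312; 1443459599732736; 355005366045184]%positive;
  Design [:: false] 19 [:: (19, 0, 19); (19, 1, 19); (19, 2, 19); (19, 3, 19); (19, 4, 19);
    (1, 5, 1)] [::
    2750299226524217; 2851311092537436; 2573821847819341; 2009915585734218; 2044891525332006;
    2080563372228682; 1341408895565903; 2713665977478695; 2680540647411800; 2291526130204762;
    2291938840039936; 3345687056496147; 1341274001244209; 2292830858389049; 2187340966018652;
    1339823658895445; 3342653876907008; 2926284710123008; 2076567575480832; 2570533370871808;
    1765334656005654; 73461131942407; 1762795778767360; 427228991072289]%positive;
  Design [:: false] 40 [:: (40, 0, 4); (40, 0, 4); (10, 1, 1); (10, 1, 1); (5, 1, 1)] [::
    3314420367518760; 2890629901483520; 1798663599602729; 3240343184901120; 3099941771460096;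
    3131548993084968; 3595001712627749; 1695653099507273; 2289534996350464; 531201838066688;
    493889992270848]%positive;
  Design [:: true] 40 [:: (40, 0, 4); (40, 0, 4); (10, 1, 1); (10, 1, 1); (10, 1, 1); (5, 1, 1)] [::
    3770856067341312; 1590043077807656; 3700969710048296; 3912282503915008; 3978926439845387;
    1765005815223336; 3875998210474496; 3838264929179136; 1020896565570107; 3452403296287232;
    2185629001114112; 352189084357632; 111884305179648]%positive;
  Design [:: false] 125 [:: (125, 0, 5)] [::
    2083650235829760; 2043390312073216; 1724174631715328; 1692087334996992; 1549912657104896]%positive;
  Design [:: true] 50 [:: (50, 0, 5); (50, 0, 5); (10, 1, 1); (10, 1, 1); (10, 1, 1); (5, 1, 1)] [::
    4512550767081984; 4579884970074698; 4473717280006656; 4476057352709682; 4438808729012736;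
    4228584300663362; 3947109320028227; 4366522125920768; 4406446818113536; 2041518215190537;
    3698825852144642; 2500714940598272; 2148103879712256; 2010872296551936; 849390065951744]%positive;
  Design [:: false; true] 140 [:: (140, 0, 7)] [::
    2185015515941888; 2152103038944256; 1801073598679552; 1767467503617536; 2435418259739167;
    817969006649856]%positive;
  Design [:: true] 144 [:: (144, 0, 6)] [::
    5033295155036252; 2568529661919236; 148734008878; 2780947310968974; 1902430013928989;
    3871036855843446]%positive;
  Design [:: false] 111 [:: (111, 0, 111); (3, 1, 1); (3, 1, 1); (3, 1, 1); (3, 1, 1); (3, 1, 1);
    (3, 1, 1); (3, 1, 1); (3, 1, 1); (3, 1, 1); (3, 1, 1); (3, 1, 1); (3, 1, 1); (3, 1, 1);
    (3, 1, 1); (3, 1, 1)] [::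
    5040933202599424; 5004101176813568; 4971526789812736; 3984443323211264; 3949465765953024;
    607566611634176; 3908976715803136; 672832414061057; 1798938464369688; 428142496583680]%positive;
  Design [:: false; true] 160 [:: (160, 0, 4)] [::
    3379623888737297; 2676486211695623; 2044131992726016; 1938790272220672; 1804719222955520;
    1488395551652864]%positive;
  Design [:: false] 129 [:: (129, 0, 129); (3, 1, 1); (3, 1, 1); (3, 1, 1); (3, 1, 1); (3, 1, 1);
    (3, 1, 1); (3, 1, 1); (3, 1, 1); (3, 1, 1); (3, 1, 1); (3, 1, 1); (3, 1, 1)] [::
    4830793338515968; 4794644342030848; 4758776123252224; 2261989366471168; 1065586086665216;
    2119454578240000; 1840651203029008; 2963939770295329; 1443590052531214; 213045168047104]%positive;
  Design [:: true] 175 [:: (175, 0, 5)] [::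
    2783767510658048; 1803206188628992; 1516996444831232; 1696891657307136; 2747473423286818;
    846228579165184; 151184999717888]%positive;
  Design [:: false; true] 180 [:: (180, 0, 9)] [::
    2572456440428544; 4125436360848930; 3694908836460567; 2646387062505476; 1871918550785027;
    1173321722121728; 784365050198528; 284793946251264]%positive;
  Design [:: false] 80 [:: (80, 0, 4); (80, 0, 4); (10, 1, 1); (10, 1, 1); (5, 1, 1)] [::
    3178437158371479; 5706476090046034; 3137387731686563; 3249628384067725; 3316540198617225;
    6340491395524096; 3071714734375009; 4550328879214210; 2932397517320850; 6203328786334208;
    5811554746147840; 4656294309721093; 1342940333799936; 1314340401912832; 1483241211649031;
    637313731831296; 107356751667712]%positive;
  Design [:: false] 171 [:: (171, 0, 171); (19, 1, 1); (3, 1, 1); (3, 1, 1)] [::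
    6029679262472704; 2862246224268288; 2791937604110336; 3179306601726991; 6098441251650617;
    2083031252295680; 1660958093666816; 951303758420480; 814894122803200; 749936602572288;
    140962715927040]%positive;
  Design [:: false; true] 200 [:: (200, 0, 5)] [::
    3062353558543360; 1695250572439040; 2081581691905552; 1482301838750208; 1020558197173248;
    814189315145728; 749801860299776; 641634831194112]%positive;
  Design [:: false] 80 [:: (80, 0, 4); (80, 0, 4); (20, 1, 1); (20, 1, 1); (5, 1, 1)] [::
    3424441608762960; 6626644941395536; 5983965369177169; 3139105724384406; 5884861137654311;
    5947470374308864; 6510758117329489; 7154204747018752; 5778431727467008; 4826924788311142;
    5842338970878976; 6377532159469056; 7081610834436629; 2825882330255879; 1236057250688621;
    468941721091666; 5981686876172831; 5396471788928015; 4022713749113856; 1241279946387458;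
    634084716454400]%positive;
  Design [:: false] 216 [:: (216, 0, 6)] [::
    3029024092775936; 3067843612817418; 2151834622362112; 2082422181085696; 1553205403376128;
    1407527387673088; 1029968598215168; 915770519066112; 326073925590532]%positive;
  Design [:: false; true] 220 [:: (220, 0, 11)] [::
    3351723761514005; 6523952247118933; 5007313414445627; 2568600929255424; 2435571553153024;
    2581103552794629; 2223560139753472; 1938370307915777; 1935965111478276; 357412157102592]%positive;
  Design [:: false] 225 [:: (225, 0, 5)] [::
    3424387382406144; 2961197182582784; 2891237109855744; 4510196717688879; 2680274223683072;
    2537547081718784; 2817154959042571; 2357491209081344; 781707411460096]%positive;
  Design [:: false] 171 [:: (171, 0, 171); (19, 1, 1); (19, 1, 1); (3, 1, 1); (3, 1, 1);
    (3, 1, 1); (3, 1, 1); (3, 1, 1); (3, 1, 1); (3, 1, 1); (3, 1, 1); (3, 1, 1)] [::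
    7685136277115392; 7193311507930624; 6417465379665920; 7499435596077056; 7474304100944896;
    7677958447001662; 7533587692354560; 6051918196604456; 6835114440155648; 2746583703967744;
    6545066984498176; 7670399301150826; 1526124578919936; 848368534034432; 817486895524871]%positive;
  Design [:: false; true] 240 [:: (240, 0, 4)] [::
    3637142492548096; 5559680576858675; 2189355197400064; 3418264920916480; 4024487471857173;
    1165989541856256; 926569316489728; 634917420012032; 150633121647631]%positive;
  Design [:: false] 100 [:: (100, 0, 5); (100, 0, 5); (20, 1, 1); (25, 1, 1)] [::
    7643255131987635; 7369643797250162; 7820289884395115; 8134621678335588; 7329413244502124;
    5884380082423477; 3670605136134261; 7787634740781677; 3984655964700773; 3702558709514462;
    8313576043078144; 7256529263454208; 8284825114477056; 7861801571945984; 7681064645011456;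
    8101682722221060; 7085944985414656; 5074951762932224; 7050211237880320; 6478807327377408;
    3746310998209555; 4896540053064704; 1695653931101696; 1343701342228480; 816252932447232]%positive;
  Design [:: false] 231 [:: (231, 0, 231); (11, 1, 1); (11, 1, 1); (3, 1, 1)] [::
    8622645111543341; 4765627019508757; 3957381543248896; 3499681100405248; 954051071353344;
    3344451066674688; 2438100117484032; 2188524129623552; 1526362539300352; 1416310308067328;
    1378930685726720; 5503880332316736; 603563165508097; 251534008668672]%positive;
  Design [:: false; true] 260 [:: (260, 0, 13)] [::
    4156162277432832; 3488212450829312; 7745097350361693; 1309264736688128; 6522715346953275;
    2725139594412545; 2361211203623936; 1448137003371520; 3906152534742056; 1239427591525888;
    879884185160201; 117238250469888]%positive;
  Design [:: true] 264 [:: (264, 0, 11)] [::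
    4610262229671424; 4507664576952832; 4476333296505856; 3840335005886464; 3249360735102976;
    2889044684466688; 2827948631108096; 1838046019617280; 2439138911995904; 3321624649384488;
    1388064726881804; 1093120716718087]%positive;
  Design [:: true] 275 [:: (275, 0, 5)] [::
    5818821709210656; 4619555071859200; 4446090442366464; 4330221894974976; 4372414152067075;
    4188941080904704; 3800535249574400; 6803022091519065; 4168798356153360; 3487677207809536;
    1690506389094912]%positive;
  Design [:: false; true] 280 [:: (280, 0, 7)] [::
    4821297427692544; 4627309864208384; 3006692006605312; 4514113715211779; 5813049290225197;
    3388213832556562; 3532455990843431; 2047705680285184; 1867729635976192; 1759494867261440;
    1938507729824267; 2405868901553184]%positive;
  Design [:: false] 249 [:: (249, 0, 249); (3, 1, 1); (3, 1, 1); (3, 1, 1); (3, 1, 1); (3, 1, 1);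
    (3, 1, 1); (3, 1, 1); (3, 1, 1); (3, 1, 1); (3, 1, 1); (3, 1, 1); (3, 1, 1)] [::
    9657733150960128; 3959241696365056; 9624475597809152; 4334982617919488; 4099907351304704;
    9623612972692547; 3663189858894848; 3282420086361088; 3915635831989272; 2641304653208064;
    3324717021054486; 2576499349734916; 2122402119378432; 2005581824267776; 1738085219447808;
    712621007169583]%positive;
  Design [:: false] 231 [:: (231, 0, 231); (11, 1, 1); (11, 1, 1); (11, 1, 1); (11, 1, 1);
    (21, 1, 1)] [::
    10248759829995008; 9903678932431360; 9863057453630976; 8419393318994944; 9465796953936384;
    8736650706174482; 8353922541183488; 8309502797956096; 8147384271214080; 3870775723166208;
    3696150937338368; 3310154700039680; 3100364090902016; 3219988541443597; 2514275066712064;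
    2326581040390144; 1163089927213568; 1097107001948160]%positive;
  Design [:: false; true] 300 [:: (300, 0, 5)] [::
    5178153247294464; 5147845265550336; 5035223061378560; 4785841801050624; 4716638509842432;
    4083945536083968; 3734840109258240; 3874885135107592; 3238297356993536; 4760954081967664;
    2692704005059090; 1266854076096512]%positive;
  Design [:: false] 209 [:: (209, 0, 209); (19, 1, 1); (11, 1, 1); (11, 1, 1); (11, 1, 1);
    (11, 1, 1); (11, 1, 1); (11, 1, 1); (11, 1, 1)] [::
    10712578313467392; 10466357624490496; 10380145712284237; 10347168421783552; 9678802533092864;
    9398840859186688; 9369733293438464; 9329096380398080; 9015191722791424; 8977110266284032;
    8903250578109952; 8692286796087808; 8289150930866176; 8128416667148800; 8023149023603712;
    7711508884127232; 7682974941736961; 7505885808413184; 7462396163147264; 3529294899166247]%positive;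
  Design [:: true] 315 [:: (315, 0, 9)] [::
    6581951527506472; 8811623666258014; 4927423128284160; 4901033024189440; 4626167065744896;
    4473471288514560; 5005045693772828; 3772699956271616; 3067917324394496; 3357152608549386;
    2478025413535232; 2864227817456669; 2047428098310156; 1774130755152399]%positive;
  Design [:: false] 325 [:: (325, 0, 5)] [::
    5319939556770304; 5216978016517632; 4893663095295488; 4699386683401728; 4117808948573696;
    3424774482404864; 3207014532276224; 2749409391019008; 1724314666436096; 10802151996909714;
    1477816656098816; 600290749590528; 721554543613959]%positive;
  Design [:: false] 336 [:: (336, 0, 6)] [::
    5774243445986816; 4935232191597056; 4402121281377280; 4192045548973056; 4544556507223057;
    3769749038337536; 3663392626444288; 3460172260677120; 3279928165528064; 3027299542364160;
    1800117108775936; 1420054845206016; 1170292841503232; 493492191629312]%positive;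
  Design [:: false] 405 [:: (405, 0, 9)] [::
    6808696255169024; 6774480423664128; 7300619799725587; 6414018128156160; 7376348667554847;
    7953867145835569; 6210522737082888; 5882262796110848; 7510076740990008; 5245914289538560;
    4867886829869568; 4295318085323264; 4189346147180544; 4026031028853760; 3259571243402752;
    3132449463759360; 2788177498341888; 54975587435533]%positive;
  Design [:: false] 351 [:: (351, 0, 351); (13, 1, 1); (13, 1, 1); (13, 1, 1); (13, 1, 1);
    (13, 1, 1)] [::
    14322513393690762; 13836620952182784; 12688020623256626; 13452542905627648; 14194008005997174;
    13198620451684352; 13340512099437660; 12708997712850944; 12690748487010816; 12636347198268416;
    12608792033387520; 12570748014315008; 12509497886835712; 7725993346922543; 5918674100004864;
    5876755712477184; 5656162978550784; 5542363251115532; 5039269227976704; 4275940591143424;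
    4132278684355584; 3133884105857536; 2512026542553088; 1657994899268615]%positive].

Lemma n3_Kdec n : admissible [:: 5; 16] n -> Kdec n3_edges n.
Proof.
by refine (@designs_Kdec n3_edges isT [:: 5; 16] n3_small n3_gdds n3_large isT _ _ _ n); vm_compute. Qed.

(** All 19 blocks of order 20 are listed, under the trivial group: [n6] has no vertex of degree 1,
    which excludes a single base block over Z_19 with a fixed point. The same applies to [n8]. *)
Definition n6_small : seq design := [::
  Design [:: false] 1 [:: (1, 0, 1); (1, 1, 1); (1, 2, 1); (1, 3, 1); (1, 4, 1); (1, 5, 1);
    (1, 6, 1); (1, 7, 1); (1, 8, 1); (1, 9, 1); (1, 10, 1); (1, 11, 1); (1, 12, 1); (1, 13, 1);
    (1, 14, 1); (1, 15, 1); (1, 16, 1); (1, 17, 1); (1, 18, 1); (1, 19, 1)] [::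
    633731284733953; 176197009942022; 599235719341065; 422418894300175; 176196877030400;
    281887566470147; 599097608772103; 669465545286160; 493200092170756; 599097609035264;
    281681272248327; 669259792393216; 281887430156303; 422762626161152; 457740971679746;
    669534669773323; 387715288276999; 668847206047239; 352187858035725]%positive;
  Design [:: false] 21 [:: (21, 0, 21)] [::
    106377751041039]%positive].

Definition n6_gdds : seq design := [::
  Design [:: false; true] 80 [:: (80, 0, 4)] [::
    458569497469002; 1516501414976537; 35323168951808]%positive;
  Design [:: false; true] 100 [:: (100, 0, 5)] [::
    1587076317059588; 2503662889098752; 388131106609152; 1305740388090931]%positive;
  Design [:: false; true] 120 [:: (120, 0, 6)] [::
    389028353468416; 2435074663926372; 2962496652063819; 38141592111104; 636548520363047]%positive;
  Design [::] 40 [:: (40, 0, 4); (40, 0, 4); (5, 1, 1)] [::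
    1905253014087720; 1657453249319936; 2468267507600941; 530727240471040; 460765991568896;
    2081378061779968; 1304511625853952]%positive;
  Design [::] 40 [:: (40, 0, 4); (40, 0, 4); (10, 1, 1); (5, 1, 1)] [::
    423655587225181; 1728707170958395; 1623578037213696; 2152717340399104; 1868697473949696;
    1657040148669952; 600132703493632; 2503863271199232; 744989055258638]%positive;
  Design [::] 50 [:: (50, 0, 5); (50, 0, 5); (5, 1, 1)] [::
    1976578331161145; 1129335894875739; 2328009718125656; 1833995752964608; 2151815927828529;
    459670775399424; 1481674348068402; 247395241218048; 3349181163911683]%positive;
  Design [::] 50 [:: (50, 0, 5); (50, 0, 5); (10, 1, 1); (5, 1, 1)] [::
    2010113427947574; 882701692340823; 423107697361007; 2257171768943104; 2715999903442540;
    3877922481924160; 2399616884558395; 1833641825325079; 2292619184443920; 919329161905753;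
    147612388819459]%positive].

Definition n6_large : seq design := [::
  Design [:: false] 5 [:: (5, 0, 5); (5, 1, 5); (5, 2, 5); (5, 3, 5); (5, 4, 5)] [::
    529072597772824; 36492727555072; 458361597330437; 106998776729622; 528934485362700;
    317830532696586]%positive;
  Design [:: false] 9 [:: (9, 0, 9); (9, 1, 9); (9, 2, 9); (9, 3, 9)] [::
    352740164254226; 670293408093197; 1057802264788992; 670087113881088; 459389704357377;
    71055940004895; 599784935130630]%positive;
  Design [:: false] 13 [:: (13, 0, 13); (13, 1, 13); (13, 2, 13); (1, 3, 1)] [::
    599787760527895; 1234068123436032; 635866561654272; 529280237319168; 565286416157220;
    564118318745610]%positive;
  Design [:: false] 41 [:: (41, 0, 41)] [::
    142869939624478; 71814407002624]%positive;
  Design [:: false] 9 [:: (9, 0, 9); (9, 1, 9); (9, 2, 9); (9, 3, 9); (9, 4, 9)] [::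
    141293020251175; 1269319880423969; 988188498461702; 882429624330249; 142594128491560;
    741003334518276; 247460049472032; 775706668977706; 2200242502669; 35323430573577;
    741483157132829]%positive;
  Design [:: false] 9 [:: (9, 0, 9); (9, 1, 9); (9, 2, 9); (9, 3, 9); (9, 4, 1); (9, 4, 1);
    (1, 4, 1); (1, 4, 1)] [::
    176747847902217; 600128411944983; 494785877771264; 35596702593580; 354665111757344;
    105828002327051; 212278088068114; 246981563018770; 318927494197789; 635867765670400;
    1128238127011849; 1446133883742738; 917062634986006; 1375492672597016; 1586601054976035]%positive;
  Design [:: false; true] 60 [:: (60, 0, 3)] [::
    1692354561707522; 813296080929335]%positive;
  Design [:: false] 13 [:: (13, 0, 13); (13, 1, 13); (13, 2, 13); (13, 3, 13); (13, 4, 13)] [::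
    1163972251497503; 953004265591309; 566118709998644; 1094502230274612; 1410680934636583;
    1657934551462951; 1833714010584064; 1516300086027832; 212343193082382; 1270348250896899;
    1200460807552558; 1235508277560383; 670633373740085; 811377587914752; 105829742957626;
    740383643683369]%positive;
  Design [:: false] 19 [:: (19, 0, 19); (19, 1, 19); (19, 2, 19); (19, 3, 19)] [::
    705820312242747; 1658750745741896; 1657657268666406; 320438920563763; 216194980011008;
    1553266351302689; 531003196846592; 106034171775010; 282507936032787; 1269732863662138;
    106311581193243; 1516779250419219; 883045277378085; 212283190173203; 988124613476352]%positive;
  Design [:: false] 30 [:: (30, 0, 3); (30, 0, 3); (10, 1, 1); (10, 1, 1); (5, 1, 1)] [::
    73740311894016; 212141061711389; 2684091932204; 1164936598799426; 2362516030379520;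
    388750797997056; 1376180268192340; 1411508789581345; 2256758756082178]%positive;
  Design [:: true] 30 [:: (30, 0, 3); (30, 0, 3); (10, 1, 1); (10, 1, 1); (10, 1, 1); (5, 1, 1)] [::
    2326841497485829; 423449437962293; 813302410684416; 847727501540905; 1163974542384212;
    353983830978560; 282443639459840; 2891176160003124; 71124677040733; 2362107063969333;
    1128516640348160]%positive;
  Design [:: false] 40 [:: (40, 0, 4); (40, 0, 4); (10, 1, 1); (10, 1, 1); (5, 1, 1)] [::
    2221916117585408; 1659031381895680; 1447380247430656; 497254160185353; 3243902899596337;
    1023176116825128; 494855134161920; 107416875475456; 670094768216610; 3208111061732904;
    1234350795678248]%positive;
  Design [:: true] 40 [:: (40, 0, 4); (40, 0, 4); (10, 1, 1); (10, 1, 1); (10, 1, 1); (5, 1, 1)] [::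
    916793947904000; 529627047014434; 356590760813103; 849652996124210; 218808998440525;
    1588038414390361; 1129404622988370; 882701706223199; 216890896850432; 177369562004008;
    2926362421632529; 1621779675384427; 71412162517544]%positive;
  Design [:: false] 125 [:: (125, 0, 5)] [::
    3068054724441174; 2152365012582008; 4019203563116032; 1377413222393899; 2152843776119811]%positive;
  Design [:: true] 50 [:: (50, 0, 5); (50, 0, 5); (10, 1, 1); (10, 1, 1); (10, 1, 1); (5, 1, 1)] [::
    3420940671155762; 637510618242135; 2573751667682304; 2221840556154368; 250554198327808;
    2541108825986054; 74026320930304; 1445521990878237; 461595464178705; 900091655801;
    429304274502228; 635043424798309; 636074222451279; 2257447979912192; 459057010362880]%positive;
  Design [:: false; true] 140 [:: (140, 0, 7)] [::
    991278458245720; 1661917194137698; 3068603674922028; 952529949298688; 176543846630912;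
    1378376759931392]%positive;
  Design [:: true] 144 [:: (144, 0, 6)] [::
    1306638308659200; 3737727367406659; 1199154891374143; 248087130674688; 500965019544087;
    2260802199365761]%positive;
  Design [:: true] 60 [:: (60, 0, 3); (60, 0, 3); (20, 1, 1); (15, 1, 1)] [::
    4442243499355136; 3736912397339778; 2961328435147403; 4477575078365804; 2930423721395712;
    2470004569180160; 3913505488284308; 3456661486345325; 3385602496342548; 1059654338108554;
    426954144409607; 4900935648467987; 2292502430758912; 357274841261195; 1658683486376595]%positive;
  Design [:: false; true] 160 [:: (160, 0, 4)] [::
    112906112355477; 1134833467435583; 255567740613641; 3562557411440128; 1555327952143363;
    814267712445440]%positive;
  Design [:: false] 60 [:: (60, 0, 3); (60, 0, 3); (30, 1, 1); (15, 1, 1)] [::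
    36421325635598; 1552029425152606; 2822524603284480; 1488059624098887; 3631420123419780;
    3631213928546956; 2186526669215744; 1835027772545536; 743819617534097; 2579677502564352;
    745743795678858; 72996603333632; 1273852974915706; 1240268311143424; 599929772114432;
    322844131867270; 5218437231038976]%positive;
  Design [:: true] 175 [:: (175, 0, 5)] [::
    497535185640606; 1659323856197120; 671883480009728; 1974520483234985; 1066045256772659;
    4689692238848096; 1270829284329112]%positive;
  Design [:: false; true] 180 [:: (180, 0, 9)] [::
    1944703478088361; 1593604697287715; 5641181857596006; 36834079941120; 1552310447156224;
    1692217793103872; 2435143424288287; 288965408637052]%positive;
  Design [:: false] 80 [:: (80, 0, 4); (80, 0, 4); (10, 1, 1); (10, 1, 1); (5, 1, 1)] [::
    6064288066224253; 2965520302002868; 5147503003445291; 6169703346632202; 496429524918799;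
    641362931291648; 1199992690970112; 78499519982215; 177249715276800; 993889821678242;
    1344312952537197; 317574212561920; 429084457594529; 5182778127199232; 4654438905373278;
    3350486845054062; 3950545301460594]%positive;
  Design [:: false] 171 [:: (171, 0, 171); (19, 1, 1); (3, 1, 1); (3, 1, 1)] [::
    3316333238823573; 1451022622933070; 6733546657701491; 705475649541120; 4019883238006409;
    2115599824065052; 423178440367104; 530995400942256; 2609018045029888; 850900272109056;
    3525952998998533]%positive;
  Design [:: false; true] 200 [:: (200, 0, 5)] [::
    3459478716465848; 3208589678216826; 540203834749537; 1341344618126336; 1939813396127766;
    4517216552764503; 5112729110392843; 2576914208261126]%positive;
  Design [:: false] 90 [:: (90, 0, 3); (90, 0, 3); (10, 1, 1); (10, 1, 1); (5, 1, 1)] [::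
    6170827280109169; 3667093459924480; 3774991714015744; 5008002734132835; 4371801086960640;
    3812900171971200; 2679445318107136; 4655263563740165; 672916160916992; 3494809841245850;
    1622494100615168; 3243902924853782; 1587007597603476; 4727777727128206; 4691010021590016;
    1592367759558244; 1489494698179675]%positive;
  Design [:: false] 216 [:: (216, 0, 6)] [::
    4482720323376640; 2508331096760526; 2680766520373760; 1551355622457856; 3737327150567936;
    3778412384636460; 7121742978621005; 2259034430776832; 1236400834096166]%positive;
  Design [:: false; true] 220 [:: (220, 0, 11)] [::
    1057950037786112; 1665237772695552; 189734499425840; 39036957805227; 529784536315392;
    637648039901906; 1703006086731336; 4199449823321088; 1519662540853794; 2225343765948928]%positive;
  Design [:: false] 225 [:: (225, 0, 5)] [::
    891566533718062; 2265023927031296; 1348563500107776; 40133113993886; 4267489708504576;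
    2152848599046808; 4759923276701839; 258110361515186; 1381336644324955]%positive;
  Design [:: false] 171 [:: (171, 0, 171); (19, 1, 1); (19, 1, 1); (3, 1, 1); (3, 1, 1);
    (3, 1, 1); (3, 1, 1); (3, 1, 1); (3, 1, 1); (3, 1, 1); (3, 1, 1); (3, 1, 1)] [::
    5290849960769027; 2159583510407772; 7720770661268035; 1658133610314752; 7016052425028684;
    3005517216920064; 2542345779693233; 3772218244931251; 990316424341012; 1305120309062830;
    35390558911147; 963791360665600; 1449365894953984; 6876170033325056; 1845424103099904]%positive;
  Design [:: false; true] 240 [:: (240, 0, 4)] [::
    144104767700642; 2786643551036429; 3639798390938112; 531553369750528; 2506572857093120;
    4554520763389642; 3422642583412224; 1445654450673811; 1702593758599734]%positive;
  Design [:: false] 100 [:: (100, 0, 5); (100, 0, 5); (20, 1, 1); (25, 1, 1)] [::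
    8108705546562159; 2052375921656973; 4446791974051047; 5046168350418608; 541234655726262;
    3739467408549376; 3772511560765440; 3562627369116160; 3354403848429592; 3808158577962033;
    2681640188971051; 6557445656157184; 3526477418890253; 1129201423415296; 2085666317983420;
    4759304833946355; 109982613551104; 1059448233429700; 4020534455049744; 2719388798409728;
    215366860891870; 211589872859648; 2295230581515422; 144754356519956; 4233944458334783]%positive;
  Design [:: false] 231 [:: (231, 0, 231); (11, 1, 1); (11, 1, 1); (3, 1, 1)] [::
    3278701575297024; 6172039823611920; 6667374904479744; 117304713403392; 673345528155648;
    1909258191119360; 783820123052770; 1874745094573056; 1981046954430082; 3420374517426820;
    459115092536445; 2468815977366773; 1414332248094208; 2752215106982410]%positive;
  Design [:: false; true] 260 [:: (260, 0, 13)] [::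
    4442256785027584; 4270228294354602; 3922645183734316; 3711813832219359; 424274072213661;
    394246456663294; 715163624331384; 566389014305885; 366274812591272; 317349518118912;
    1130795675682304; 1414453025667079]%positive;
  Design [:: true] 264 [:: (264, 0, 11)] [::
    611259803825225; 1071272789888512; 1389508924130816; 533343972899328; 4586966033409024;
    3920446190857821; 2261695980984320; 2680884247186445; 4867334560932352; 2616289126254084;
    282368371403296; 2612439632066160]%positive;
  Design [:: true] 275 [:: (275, 0, 5)] [::
    1846015603327488; 4268458489454851; 6029182882549503; 222238850271301; 1979558375743488;
    1377642035815424; 152842464936448; 2618693141221377; 6453036025160362; 5113416270763066;
    178258325538316]%positive;
  Design [:: false; true] 280 [:: (280, 0, 7)] [::
    4869393423854839; 1305468194602716; 3703292648509971; 959392662982713; 5642899853489687;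
    2400441518281912; 1236125974345753; 5149356818696733; 5114617027101184; 4195736376409294;
    2261008238798852; 1306425986436616]%positive;
  Design [:: false] 249 [:: (249, 0, 249); (3, 1, 1); (3, 1, 1); (3, 1, 1); (3, 1, 1); (3, 1, 1);
    (3, 1, 1); (3, 1, 1); (3, 1, 1); (3, 1, 1); (3, 1, 1); (3, 1, 1); (3, 1, 1)] [::
    2469093617697960; 3003078641732608; 255705244246631; 2089140884629569; 2577049166823985;
    284223827884069; 4444260140581888; 1516468533498880; 1587248303762432; 1631366689080938;
    7654421081699328; 917508651558912; 176960577470976; 3075268296642048; 1978230983200256;
    3879715505199104]%positive;
  Design [:: false] 231 [:: (231, 0, 231); (11, 1, 1); (3, 1, 1); (3, 1, 1); (3, 1, 1); (3, 1, 1);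
    (3, 1, 1); (3, 1, 1); (3, 1, 1); (3, 1, 1); (3, 1, 1); (3, 1, 1); (3, 1, 1); (3, 1, 1);
    (3, 1, 1); (3, 1, 1); (3, 1, 1); (3, 1, 1); (3, 1, 1); (3, 1, 1)] [::
    9378592593079466; 2820968342911628; 2611104563877543; 5220206402606618; 2371715376119874;
    652529281010264; 1974722950645877; 822607467529728; 330367542263879; 181694335122152;
    1071437986714624; 2366323371812414; 499144202161664; 952319744791552; 709264777676800;
    1596560971735040; 6526979284729344; 9484525552855040]%positive;
  Design [:: false; true] 300 [:: (300, 0, 5)] [::
    2679930646253056; 105868155986944; 2754620250262043; 4514119881355039; 1729806687062731;
    248638379144192; 2857149696855109; 1206920175946949; 1136350233366659; 3738568927500288;
    5009375257436160; 1976377653945081]%positive;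
  Design [:: false] 140 [:: (140, 0, 7); (140, 0, 7); (20, 1, 1); (5, 1, 1)] [::
    2574184927492729; 145497991005844; 319764238258828; 2822880467897996; 3810859825532551;
    956804933624345; 147769862983343; 1023115067960534; 194361802384646; 542577735048332;
    146047756406835; 353987913728140; 107915681086604; 2437842305333432; 3394162232734913;
    3989478772620428; 1939278601016972; 1764336941021324; 2540667419339916; 2764399231194892;
    7156515049144622; 6315223141161739; 1850309645216768; 4760151765549568; 7019370999304332;
    3842657176602377; 3148588989302954; 996157538737155; 4513151639113494]%positive;
  Design [:: true] 315 [:: (315, 0, 9)] [::
    2787557129939968; 5894212920841216; 6348786353329704; 2187067050014720; 3596227667433264;
    6628405853081732; 5361974618903644; 7969810043122726; 2681708861721109; 1354873213600441;
    529349103219200; 707192741757440; 3810357548796205; 4023320278279939]%positive;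
  Design [:: false] 325 [:: (325, 0, 5)] [::
    4726461736769536; 147074210081280; 1907446918491898; 6175819402356887; 2257847180592139;
    2938032515261986; 7861715907651863; 7093500071917603; 2937014332720766; 674275514403609;
    5044586060463616; 3384993305720832; 2609793034631168]%positive;
  Design [:: false] 336 [:: (336, 0, 6)] [::
    5471653983174795; 7650828940235264; 3812281752618558; 4129559594007583; 2506900139031040;
    745005342786048; 2334881687372298; 5999698737401956; 719492942673677; 708429087024752;
    4761664524163072; 777642968622592; 2801143311874839; 1410762049324032]%positive;
  Design [:: false] 405 [:: (405, 0, 9)] [::
    4198011045274112; 761353149146859; 8681813874619161; 5046970167152408; 918851478894805;
    536770837922304; 288421897382400; 11211720105675340; 608887818690560; 5962309839164246;
    470799685297816; 141082102380032; 2331103700506472; 1553147453511168; 4035670406362112;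
    3402167646535680; 3282531432692113; 2895226985396078]%positive;
  Design [:: false] 351 [:: (351, 0, 351); (39, 1, 1); (13, 1, 1); (13, 1, 1)] [::
    6206797660104192; 4201733756673853; 1411429436603547; 2057117578671412; 4415651823164928;
    4129227460840508; 4742064533146719; 5224535687901728; 2259152857501716; 7722488688177711;
    5006215830884864; 6777733285062658; 1800218940802560; 4735321808074080; 8428564099912704;
    162436200129788; 2926742996815360; 564193052255744; 856382138659177; 817650114674176;
    4831048025902951; 388677461609030; 424411536413540; 2125335575422564]%positive].

Lemma n6_Kdec n : admissible [:: 5; 16] n -> Kdec n6_edges n.
Proof.
by refine (@designs_Kdec n6_edges isT [:: 5; 16] n6_small n6_gdds n6_large isT _ _ _ n); vm_compute. Qed.

Definition n8_small : seq design := [::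
  Design [:: false] 1 [:: (1, 0, 1); (1, 1, 1); (1, 2, 1); (1, 3, 1); (1, 4, 1); (1, 5, 1);
    (1, 6, 1); (1, 7, 1); (1, 8, 1); (1, 9, 1); (1, 10, 1); (1, 11, 1); (1, 12, 1); (1, 13, 1);
    (1, 14, 1); (1, 15, 1); (1, 16, 1); (1, 17, 1); (1, 18, 1); (1, 19, 1)] [::
    316729142025742; 599167268821516; 457879485682184; 387235594118674; 668849084045836;
    211862549698573; 246978067831308; 634008174858249; 669261131944456; 176196872573448;
    669742306165248; 141081219958274; 352599769353734; 669672241634319; 634419015589390;
    387715690929678; 246703324668432; 634625308756484; 564118856668682]%positive;
  Design [:: false] 21 [:: (21, 0, 21)] [::
    457536960464392]%positive].

Definition n8_gdds : seq design := [::
  Design [:: false; true] 80 [:: (80, 0, 4)] [::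
    390746061670400; 110853105949714; 1233726268798022]%positive;
  Design [:: false; true] 100 [:: (100, 0, 5)] [::
    2185014419390976; 1024408890388992; 1233591111523350; 3135132988651008]%positive;
  Design [:: false; true] 120 [:: (120, 0, 6)] [::
    463106459318317; 285327702139904; 387237472643094; 1448134663779840; 528112131538011]%positive;
  Design [::] 40 [:: (40, 0, 4); (40, 0, 4); (5, 1, 1)] [::
    1939614884195328; 1798054374555648; 1656768335226368; 1830900937544750; 1729747347593216;
    2779713705609745; 286493780243463]%positive;
  Design [::] 40 [:: (40, 0, 4); (40, 0, 4); (10, 1, 1); (5, 1, 1)] [::
    2185151048103467; 2398868889147913; 1445246164031488; 2568815376352330; 352883650347606;
    250896711950888; 1197169675607592; 2008885321829968; 1870555988106752]%positive;
  Design [::] 50 [:: (50, 0, 5); (50, 0, 5); (5, 1, 1)] [::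
    2117192317443154; 1903954979491328; 780458240540672; 1834683058881030; 2393097258434627;
    529214864391252; 323604847789089; 1936385065913956; 1060759614279247]%positive;
  Design [::] 50 [:: (50, 0, 5); (50, 0, 5); (10, 1, 1); (5, 1, 1)] [::
    1444148144000512; 110848421414968; 142951839446066; 985924654123574; 39239371250286;
    2962511689437234; 288765164654130; 497669819096136; 1731400252003890; 428124505151026;
    111125433715282]%positive].

Definition n8_large : seq design := [::
  Design [:: false] 5 [:: (5, 0, 5); (5, 1, 5); (5, 2, 5); (5, 3, 5); (5, 4, 5)] [::
    142320318031384; 247392937455621; 212483173522958; 35391201610764; 35940557399063;
    669399107245063]%positive;
  Design [:: false] 9 [:: (9, 0, 9); (9, 1, 9); (9, 2, 9); (9, 3, 9)] [::
    846353108841984; 810756144638476; 635521884237312; 705546357309969; 107618998958089;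
    72087673244169; 318930181955072]%positive;
  Design [:: false] 13 [:: (13, 0, 13); (13, 1, 13); (13, 2, 13); (1, 3, 1)] [::
    1021450736123904; 495264497412096; 740388742641183; 706164966830593; 493134588943878;
    1056223463738368]%positive;
  Design [:: false] 41 [:: (41, 0, 41)] [::
    106447274788366; 669195633171985]%positive;
  Design [:: false] 9 [:: (9, 0, 9); (9, 1, 9); (9, 2, 9); (9, 3, 9); (9, 4, 9)] [::
    493751590201375; 600200617932306; 985786675121682; 600888751430656; 354800537457187;
    423521624801316; 1056978566663724; 1022206785627136; 916448046231040; 105622775274015;
    810205986949632]%positive;
  Design [:: false] 9 [:: (9, 0, 9); (9, 1, 9); (9, 2, 9); (9, 3, 9); (9, 4, 1); (9, 4, 1);
    (1, 4, 1); (1, 4, 1)] [::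
    71128016228405; 141634199373362; 105554460817444; 565221188185127; 107621691169801;
    36012497840168; 704653138336310; 493064802798647; 563090747838511; 1023445614999049;
    953281413136900; 810481132525100; 1234893969307136; 952527248441363; 636898418636308]%positive;
  Design [:: false; true] 60 [:: (60, 0, 3)] [::
    1619794033916442; 1798464539216388]%positive;
  Design [:: false] 13 [:: (13, 0, 13); (13, 1, 13); (13, 2, 13); (13, 3, 13); (13, 4, 13)] [::
    73327852668454; 74290596427809; 1270010837231159; 952869378878976; 38277290678272;
    317489768333325; 214818564081703; 1622818096944168; 39247280367654; 390127854837793;
    1235100799340045; 424758041932348; 1056913742917648; 810208808141832; 634353922360366;
    635385113745959]%positive;
  Design [:: false] 19 [:: (19, 0, 19); (19, 1, 19); (19, 2, 19); (19, 3, 19)] [::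
    2503185739551744; 141363759837734; 2185495053102636; 2325544944037951; 424144936920645;
    1517472484966931; 2184670286983680; 250627045215257; 1585228002908193; 1447237956434944;
    844841407755842; 1129274008689664; 1057942385228800; 809312632964616; 987163873275397]%positive;
  Design [:: false] 30 [:: (30, 0, 3); (30, 0, 3); (10, 1, 1); (10, 1, 1); (5, 1, 1)] [::
    563854333191168; 176069642295326; 532999409528869; 284294093770827; 3237339504700;
    1130372309984808; 215444283738668; 107890115372093; 1232013264179200]%positive;
  Design [:: true] 30 [:: (30, 0, 3); (30, 0, 3); (10, 1, 1); (10, 1, 1); (10, 1, 1); (5, 1, 1)] [::
    176405454818897; 811649103078483; 743144643124794; 1586532733461057; 1376598892753951;
    635660931212860; 2010053821336083; 251653005789184; 1413703788414976; 1553276944281088;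
    600956253277277]%positive;
  Design [:: false] 40 [:: (40, 0, 4); (40, 0, 4); (10, 1, 1); (10, 1, 1); (5, 1, 1)] [::
    1093537328309336; 1269808423244389; 1800120398793728; 39104346066472; 1343064474421800;
    2467249223655936; 287871535684121; 2115606266548827; 2680482781211693; 147198069187621;
    1445176769797725]%positive;
  Design [:: true] 40 [:: (40, 0, 4); (40, 0, 4); (10, 1, 1); (10, 1, 1); (10, 1, 1); (5, 1, 1)] [::
    1938518213953576; 41720238603791; 2040908195328606; 2642895645983232; 1693669082053228;
    1235657287277568; 77392626346509; 1694151192136305; 37801916108288; 2644477141320710;
    2428355203040296; 1056573789344296; 1443806675249745]%positive;
  Design [:: false] 125 [:: (125, 0, 5)] [::
    289105663545856; 604742803805745; 1798402535631360; 1026811790115345; 41232091090944]%positive;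
  Design [:: true] 50 [:: (50, 0, 5); (50, 0, 5); (10, 1, 1); (10, 1, 1); (10, 1, 1); (5, 1, 1)] [::
    604599459307654; 37661239155812; 571142351618098; 2782534038721586; 2540507796887621;
    1697936149858866; 36980890068018; 497121002792043; 992666947424819; 1450813390607454;
    1803077199896157; 1340037748002304; 956311109939320; 3027449298320511; 43569490429537]%positive;
  Design [:: false; true] 140 [:: (140, 0, 7)] [::
    2082011032364578; 2294832046576640; 956512436508182; 1795175668026990; 1655940076012141;
    705550383845393]%positive;
  Design [:: true] 144 [:: (144, 0, 6)] [::
    990259070162944; 318864283448320; 776063814754885; 1625297900305416; 1763694903319552;
    501448306335744]%positive;
  Design [:: false] 111 [:: (111, 0, 111); (3, 1, 1); (3, 1, 1); (3, 1, 1); (3, 1, 1); (3, 1, 1);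
    (3, 1, 1); (3, 1, 1); (3, 1, 1); (3, 1, 1); (3, 1, 1); (3, 1, 1); (3, 1, 1); (3, 1, 1);
    (3, 1, 1); (3, 1, 1)] [::
    182263812466176; 2647367778056813; 2858268523233809; 1274353035532373; 3386791495223864;
    79030753725541; 3596866398717963; 1759854394618368; 1870218680611328; 744035039626752]%positive;
  Design [:: false; true] 160 [:: (160, 0, 4)] [::
    2471026095882752; 3069780630200862; 1232902190569472; 291170462782982; 140817616348187;
    107560612707328]%positive;
  Design [:: false] 129 [:: (129, 0, 129); (3, 1, 1); (3, 1, 1); (3, 1, 1); (3, 1, 1); (3, 1, 1);
    (3, 1, 1); (3, 1, 1); (3, 1, 1); (3, 1, 1); (3, 1, 1); (3, 1, 1); (3, 1, 1)] [::
    1559396324764215; 3212101216642610; 607483395592248; 326163708781078; 4336564188498503;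
    429708565552128; 147472702782976; 214346920421888; 748570121129984; 2402452640388608]%positive;
  Design [:: true] 175 [:: (175, 0, 5)] [::
    4724415188520448; 1270151086873088; 2257588355923474; 746646247877120; 1372476261054561;
    1477966294979663; 634214735220748]%positive;
  Design [:: false; true] 180 [:: (180, 0, 9)] [::
    108934329305768; 1095546168412672; 916111960860284; 281888904252046; 1092384800647843;
    3729696046992969; 70439208534120; 1759576697354332]%positive;
  Design [:: false] 80 [:: (80, 0, 4); (80, 0, 4); (10, 1, 1); (10, 1, 1); (5, 1, 1)] [::
    461057002384976; 4891884849787392; 469845263003182; 3421075534867629; 888900164786256;
    1138217738871925; 923941975658155; 4794301670277801; 844575656708768; 1102682119000717;
    151809242985625; 111533632786944; 1064281487473161; 2087374507024977; 3739387111469056;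
    1311247479662592; 3914345306964992]%positive;
  Design [:: false] 171 [:: (171, 0, 171); (19, 1, 1); (3, 1, 1); (3, 1, 1)] [::
    2958468097045147; 1269261217603668; 681635877749248; 2254907893687814; 176405044307030;
    3659330659564544; 3487664752614912; 3812642066043531; 883808035411120; 3143322818328113;
    44945405417984]%positive;
  Design [:: false; true] 200 [:: (200, 0, 5)] [::
    463875820812800; 2963610649252368; 2507456282187776; 4399035293116960; 2748593043670028;
    5525136526563374; 5289083513341960; 4024026941411840]%positive;
  Design [:: false] 90 [:: (90, 0, 3); (90, 0, 3); (10, 1, 1); (10, 1, 1); (5, 1, 1)] [::
    3318765301812224; 3097751873202869; 3492476010720266; 5920551080112136; 5219544286915072;
    4794856979122176; 189328600905319; 3174310739016715; 4235758219041808; 2294764929911808;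
    2856613350220320; 1374120428178009; 388411340888706; 2112380209248393; 3353598511636172;
    3494063269562475; 3665516642753148]%positive;
  Design [:: false] 216 [:: (216, 0, 6)] [::
    705628379863552; 6095235330641920; 3776367322483712; 604193719154256; 1979488686610961;
    3132188652483154; 366555326089217; 635607915186870; 2712997160083471]%positive;
  Design [:: false; true] 220 [:: (220, 0, 11)] [::
    3417516751734478; 1421820494641152; 3484574613031970; 1838460221043712; 850907512212999;
    2161109568403968; 1100358542227456; 1030392195666944; 2441137280286720; 961189521975808]%positive;
  Design [:: false] 225 [:: (225, 0, 5)] [::
    5072000162728993; 318185560620032; 2040988457570490; 5490988583792744; 1161928374259294;
    430602012611108; 955212940511772; 819007723207168; 2147013349088283]%positive;
  Design [:: false] 171 [:: (171, 0, 171); (19, 1, 1); (19, 1, 1); (3, 1, 1); (3, 1, 1);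
    (3, 1, 1); (3, 1, 1); (3, 1, 1); (3, 1, 1); (3, 1, 1); (3, 1, 1); (3, 1, 1)] [::
    5820364793849905; 2337729090178091; 82463908980813; 5321795058103491; 3035626436615168;
    1197238239911624; 255995485930169; 706182012535488; 292127703604908; 2609770976518862;
    363408725698219; 2322606644541054; 2927615200470528; 2090462188441088; 1211898844189696]%positive;
  Design [:: false; true] 240 [:: (240, 0, 4)] [::
    293999235606063; 2258769606104115; 2850991103857878; 217793630916139; 3913055046031889;
    598763940912282; 3801991083996703; 648237940246016; 4225233401679371]%positive;
  Design [:: false] 100 [:: (100, 0, 5); (100, 0, 5); (20, 1, 1); (25, 1, 1)] [::
    6486117347310592; 434461980354586; 5771496521802987; 4619561462734890; 3448219325549095;
    2792084151804928; 5785592744905216; 5077016173933266; 2265711507472055; 1913091847715034;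
    330618260999802; 2717660555106516; 399813592529920; 5003487436114944; 1206812985084416;
    2756972446001664; 1376463332906200; 506332889273982; 996307914523136; 2651708110989318;
    4472836256548352; 4049455959568897; 4053645700167837; 5961990843979776; 4941923346352230]%positive;
  Design [:: false] 231 [:: (231, 0, 231); (11, 1, 1); (11, 1, 1); (3, 1, 1)] [::
    3238574723976854; 3173830668681728; 1238827224128000; 3078510039598080; 1668380595708416;
    1064132508728832; 108447387423414; 3836977216502350; 1000700278781440; 458434206032608;
    426476443622400; 1164189201348096; 2186594425615096; 4694803249890039]%positive;
  Design [:: false; true] 260 [:: (260, 0, 13)] [::
    678622012638265; 572392307163648; 7502482301044224; 2935445730221066; 2500648071454213;
    4405765775320639; 5363581600266764; 1442660321674458; 316946977405108; 2861357142498304;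
    422643706668140; 1699099400857600]%positive;
  Design [:: true] 264 [:: (264, 0, 11)] [::
    3948160632324196; 7959537013316608; 6940217942295040; 1373933060237545; 1767340790371855;
    149488618528329; 5137493984831183; 4056192481496606; 142199924752044; 6932593014550529;
    3113495210091032; 3173277530971139]%positive;
  Design [:: true] 275 [:: (275, 0, 5)] [::
    2618034090946130; 2370007259812352; 4272311881456128; 1418813052685827; 530037619032635;
    6348815556684344; 8269667873328270; 141842368722007; 2263975511583232; 528552097284757;
    2540710050502656]%positive;
  Design [:: false; true] 280 [:: (280, 0, 7)] [::
    5775972280324216; 3211686215436305; 176685156736031; 1343471021805056; 1208592925574156;
    4651516287888409; 540631964673536; 755298990169619; 2689692669192192; 1624693388418560;
    2365756576477696; 2017142405442560]%positive;
  Design [:: false] 249 [:: (249, 0, 249); (3, 1, 1); (3, 1, 1); (3, 1, 1); (3, 1, 1); (3, 1, 1);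
    (3, 1, 1); (3, 1, 1); (3, 1, 1); (3, 1, 1); (3, 1, 1); (3, 1, 1); (3, 1, 1)] [::
    4231222599401001; 370706143629548; 1375865061578240; 88522631450245; 220663009772544;
    7090513593312467; 440221262955588; 317631689700864; 580346450048585; 3149082369489593;
    48951821121024; 89550605077695; 1410962391121408; 951653889015943; 1162538528072347;
    1134505954415616]%positive;
  Design [:: false] 231 [:: (231, 0, 231); (11, 1, 1); (11, 1, 1); (11, 1, 1); (11, 1, 1);
    (21, 1, 1)] [::
    647273314908758; 3959792745936990; 3960682743667230; 4517362330370560; 286837109285431;
    4445140565900800; 1841090613339694; 5610224392127550; 1462498243201536; 359751159255552;
    538902834292747; 501590440107594; 539348036847104; 1216083080086529; 4628212734815234;
    1126895265564285; 5074064567817728; 143634846578441]%positive;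
  Design [:: false; true] 300 [:: (300, 0, 5)] [::
    251061105478187; 5983916611631709; 4906945917370368; 1164250206801625; 5675506150278690;
    1765364702770720; 2891741619294281; 3636859800143360; 2618017582284816; 3924585024346624;
    4301656715255296; 1097208720128012]%positive;
  Design [:: false] 209 [:: (209, 0, 209); (19, 1, 1); (11, 1, 1); (11, 1, 1); (11, 1, 1);
    (11, 1, 1); (11, 1, 1); (11, 1, 1); (11, 1, 1)] [::
    7159505129366678; 635522552730870; 1027033786348284; 4298574399293952; 1865072636984099;
    704522947272491; 3847829122539799; 159845529434714; 1132845137536219; 1421011462443520;
    1140693519058469; 674293279362048; 4469811313419264; 1247753900413483; 1062548199801580;
    214824197912294; 4619624947781134; 2061055622439424; 5148639293357568; 282650992591657]%positive;
  Design [:: true] 315 [:: (315, 0, 9)] [::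
    3065956795818496; 10033498064798751; 1883631190658050; 745963343929344; 604746025100509;
    853499927686193; 2618666256471559; 8067497454578723; 712077928961553; 4298298311717434;
    5702644437882896; 3777194094035456; 1988088691021312; 3883017658200576]%positive;
  Design [:: false] 325 [:: (325, 0, 5)] [::
    9185017745975360; 1198269878380032; 3064370599347712; 4398296156114653; 330886029654528;
    3238500904305476; 7214967115809544; 8092579526617688; 5324067502929920; 3704483380998155;
    4398487819023499; 1281354511810048; 2583330891585536]%positive;
  Design [:: false] 336 [:: (336, 0, 6)] [::
    6592222767391744; 6627130680960000; 5496072348652251; 159049215745607; 2816638346763776;
    5455189226103962; 4013303743383571; 3205242309699072; 460434868333056; 1549922432285477;
    8674842203133442; 3521960294352384; 2643109726541824; 4728479283968000]%positive;
  Design [:: false] 405 [:: (405, 0, 9)] [::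
    4167388535873536; 10423079381532874; 6175515639709765; 7973482902114866; 9816958430102065;
    1522008634441237; 3311349723639691; 38350299899731; 2088490393317391; 179501721080320;
    8420926690093568; 3635353332292113; 1513703509867559; 1179183808125448; 950952467196627;
    2653279819314688; 2199198289550848; 141879010190467]%positive;
  Design [:: false] 351 [:: (351, 0, 351); (13, 1, 1); (13, 1, 1); (13, 1, 1); (13, 1, 1);
    (13, 1, 1)] [::
    10205640756587087; 5570386154490394; 297698952844288; 10099892219325537; 4339319168512000;
    4367278841899028; 4460541509133312; 11039277936880411; 1814206768596480; 3469829050922041;
    2090320280838656; 1819563700258870; 4472727634492416; 1443005663928694; 332272092108288;
    6462132455343104; 6241199245520736; 1760973326958080; 616788938258944; 3767430959097344;
    7170777539467848; 10030074304708804; 3642299387679744; 12280636630943397]%positive].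

Lemma n8_Kdec n : admissible [:: 5; 16] n -> Kdec n8_edges n.
Proof.
by refine (@designs_Kdec n8_edges isT [:: 5; 16] n8_small n8_gdds n8_large isT _ _ _ n); vm_compute. Qed.

Definition n10_small : seq design := [::
  Design [:: false] 19 [:: (19, 0, 19); (1, 1, 1)] [::
    669396827374592]%positive;
  Design [:: false] 21 [:: (21, 0, 21)] [::
    317965557563412]%positive].

Definition n10_gdds : seq design := [::
  Design [:: false; true] 80 [:: (80, 0, 4)] [::
    40619804721163; 109132856703488; 1161231526002742]%positive;
  Design [:: false; true] 100 [:: (100, 0, 5)] [::
    2570050606202904; 1619864113132544; 1622674756075529; 352328522924044]%positive;
  Design [:: false; true] 120 [:: (120, 0, 6)] [::
    1478371117105155; 178265058443265; 917199802597381; 355556473454080; 213382719340563]%positive;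
  Design [::] 40 [:: (40, 0, 4); (40, 0, 4); (5, 1, 1)] [::
    568653959155717; 1444147072335935; 1689885095776299; 214482896551993; 2044273050002944;
    1483523984195597; 249109992439817]%positive;
  Design [::] 40 [:: (40, 0, 4); (40, 0, 4); (10, 1, 1); (5, 1, 1)] [::
    3204598330052665; 180048542072320; 145007109996565; 3030883149283346; 3313176307564550;
    2571563888803894; 213999578513494; 2150720197099563; 423107297280041]%positive;
  Design [::] 50 [:: (50, 0, 5); (50, 0, 5); (5, 1, 1)] [::
    458917272911360; 1801488355819613; 1903608443175010; 2504275455644160; 1764660333772884;
    1765338825097284; 464556954746966; 1799356689940557; 352601247842330]%positive;
  Design [::] 50 [:: (50, 0, 5); (50, 0, 5); (10, 1, 1); (5, 1, 1)] [::
    3945813993351730; 3698346423799296; 2748784600416335; 3942657323958334; 605635780327936;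
    3100761190825985; 3630731165958163; 41309552246884; 2504001396408344; 1309249662353422;
    215092240842815]%positive].

Definition n10_large : seq design := [::
  Design [:: false] 5 [:: (5, 0, 5); (5, 1, 5); (5, 2, 5); (5, 3, 5); (5, 4, 5)] [::
    634899385289227; 774606753103883; 176680062691343; 176196875985920; 1306077432344;
    352463945206284]%positive;
  Design [:: false] 9 [:: (9, 0, 9); (9, 1, 9); (9, 2, 9); (9, 3, 9)] [::
    1020349345961499; 738872893386769; 880644794880533; 1232691592184320; 986607951544347;
    1198124615606784; 248079331622926]%positive;
  Design [:: false] 39 [:: (39, 0, 39); (1, 1, 1)] [::
    1373772805570585; 1126381481623567]%positive;
  Design [:: false] 41 [:: (41, 0, 41)] [::
    703827700613129; 317210983923736]%positive;
  Design [:: false] 9 [:: (9, 0, 9); (9, 1, 9); (9, 2, 9); (9, 3, 9); (9, 4, 9)] [::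
    564669427491876; 494921305834002; 914798919560221; 1302926924976676; 1198194549857280;
    248285086351363; 635382977789975; 529964743786523; 213581077676072; 494301350461451;
    422422794736148]%positive;
  Design [:: false] 11 [:: (11, 0, 11); (11, 1, 11); (11, 2, 11); (11, 3, 11); (11, 4, 11);
    (1, 5, 1)] [::
    882773361426447; 355283599371307; 882703303454219; 635936359597056; 1021109553594409;
    1936244277783593; 883114944241664; 759144668726; 38827584913440; 1443182304826922;
    812815720388135; 1725897043345458; 671460833624066; 212691893616641]%positive;
  Design [:: false] 59 [:: (59, 0, 59); (1, 1, 1)] [::
    2076020507672589; 1023303082581504; 1302924501975058]%positive;
  Design [:: false] 61 [:: (61, 0, 61)] [::
    1059383892252160; 1340031142461453; 950461901570057]%positive;
  Design [:: false] 13 [:: (13, 0, 13); (13, 1, 13); (13, 2, 13); (13, 3, 13); (13, 4, 13)] [::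
    496434611781645; 1867661573102112; 637240152955455; 1759219417117214; 2079869199459341;
    179502130397238; 179225640828958; 918854850052123; 564259666270746; 1548323774011932;
    1865122715271208; 1936172745244173; 914796364978732; 1901193584443405; 950666728308755;
    1020695235802112]%positive;
  Design [:: false] 19 [:: (19, 0, 19); (19, 1, 19); (19, 2, 19); (19, 3, 19)] [::
    1620139657668123; 2463737005221398; 1900926775066687; 1375358602999808; 2078702847131692;
    2392543762874925; 1548116953934922; 703695244249152; 2396594984452097; 1374257201545272;
    318381236158513; 812205432635445; 1372403395723301; 1197093555273763; 424145479794720]%positive;
  Design [:: false] 30 [:: (30, 0, 3); (30, 0, 3); (10, 1, 1); (10, 1, 1); (5, 1, 1)] [::
    1795369628351514; 355556336888320; 1165554548211779; 145004015926345; 2920446920228896;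
    145411088056392; 2924293328994347; 1231453179088941; 74499839754315]%positive;
  Design [:: false] 19 [:: (19, 0, 19); (19, 1, 19); (19, 2, 19); (19, 3, 19); (19, 4, 19);
    (1, 5, 1)] [::
    778389824763449; 1518638984603192; 1235652298679889; 3347470151601246; 1061858875277393;
    2821149829141523; 2257646087070227; 1694695725737495; 2854960884351053; 2116012284051542;
    1794684587081795; 2429035146117198; 2115121490165808; 1340518091980857; 949989478796325;
    1587699891306580; 2005856575553631; 1692979622051866; 774061578304063; 1337013134692920;
    1901611421007897; 2644876973309953; 2293171898565120; 1868002615110144]%positive;
  Design [:: false] 40 [:: (40, 0, 4); (40, 0, 4); (10, 1, 1); (10, 1, 1); (5, 1, 1)] [::
    1548327815479350; 3588813896585792; 1554513897193559; 2427728269454408; 3661862432407622;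
    3347466513325056; 1448607513837666; 2885953099427328; 2292279773502464; 849584550051845;
    355701030915072]%positive;
  Design [:: true] 40 [:: (40, 0, 4); (40, 0, 4); (10, 1, 1); (10, 1, 1); (10, 1, 1); (5, 1, 1)] [::
    7222673035359; 182937300238440; 1731669893861465; 112154099056732; 113258693918834;
    1975135362351146; 1549358067875914; 1658618278864424; 218051338829904; 3205570062975039;
    3313588629667846; 2575817128023040; 2324650131727872]%positive;
  Design [:: false] 125 [:: (125, 0, 5)] [::
    4048893078667321; 1661576568128000; 3766316954550320; 1093466741822464; 113251582220800]%positive;
  Design [:: true] 50 [:: (50, 0, 5); (50, 0, 5); (10, 1, 1); (10, 1, 1); (10, 1, 1); (5, 1, 1)] [::
    3870289817791071; 1873784463949953; 4649157038488064; 2603928102633548; 3701170517835778;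
    2998581906899036; 2855569571735040; 1802655101354105; 4336897205764096; 42607828009070;
    1836743994114154; 2964629503344641; 3557208417632310; 2714283383726592; 247945002745930]%positive;
  Design [:: false; true] 140 [:: (140, 0, 7)] [::
    709189974884444; 2785614739275815; 1659715786643456; 2885260266962982; 954178276691968;
    466537743124480]%positive;
  Design [:: true] 144 [:: (144, 0, 6)] [::
    529762075803739; 493689043157089; 74974985453593; 535398412189812; 424980439367737;
    670157451823104]%positive;
  Design [:: true] 60 [:: (60, 0, 3); (60, 0, 3); (20, 1, 1); (15, 1, 1)] [::
    2258613802442812; 4475023096579584; 5387405549926503; 5210949339840631; 2469931034088448;
    2886361399461436; 219574180249752; 881202505711621; 390208006651956; 466066525126801;
    4436613339283481; 2533425685987405; 148169163545088; 1020433768120399; 424150199959655]%positive;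
  Design [:: false; true] 160 [:: (160, 0, 4)] [::
    2782873896887808; 2363965734129152; 3378941386817566; 3591090207195177; 3208515746005030;
    493131250537984]%positive;
  Design [:: false] 60 [:: (60, 0, 3); (60, 0, 3); (20, 1, 1); (15, 1, 1); (10, 1, 1)] [::
    644395715264646; 2960587970607166; 4508350708461056; 2578771808616585; 151400983560331;
    5736568002969685; 4719942533644379; 2187422447963648; 5669083065090076; 4580569373219328;
    2392543508606063; 4333107309707379; 502215507968143; 3946643473875456; 3694429302423634;
    4228454668042257; 290555765719202]%positive;
  Design [:: true] 175 [:: (175, 0, 5)] [::
    745609301852168; 1806231887690240; 996845556893184; 461122891415601; 4724464191012917;
    638339392473088; 387168352862346]%positive;
  Design [:: false; true] 180 [:: (180, 0, 9)] [::
    110380564086864; 392752752492659; 292955053362688; 2889382901842944; 1658826437427341;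
    3910212865753137; 1980358284288000; 563645370073119]%positive;
  Design [:: false] 80 [:: (80, 0, 4); (80, 0, 4); (10, 1, 1); (10, 1, 1); (5, 1, 1)] [::
    3061054232124548; 5423359670955520; 118066670731448; 6125328050958848; 2885819024277669;
    2821764434624657; 5677072377527296; 2920321045768798; 3490216322793594; 2990681729065576;
    2856192719454327; 3105113070108803; 3389534375510137; 3166595387235924; 2920307892986964;
    3037413923109888; 426413354647621]%positive;
  Design [:: false] 171 [:: (171, 0, 171); (19, 1, 1); (3, 1, 1); (3, 1, 1)] [::
    2782455675486215; 505792935493814; 3215052700909597; 1550403204022406; 6443566325838848;
    1372750739669003; 1202339990995064; 1349939259011584; 3595275535646759; 609886579211776;
    111741108491264]%positive;
  Design [:: false; true] 200 [:: (200, 0, 5)] [::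
    532507533770786; 2894402114820096; 1731396351295645; 739495406731308; 71144524480618;
    317844894253083; 953695075565717; 177571553083539]%positive;
  Design [:: false] 80 [:: (80, 0, 4); (80, 0, 4); (20, 1, 1); (20, 1, 1); (5, 1, 1)] [::
    118140215795880; 3140769108768256; 4124496852680831; 5710332611003392; 3180211391168673;
    1238618289528320; 3202688846397565; 2898456960303270; 3350901964931262; 6198649455392256;
    3072521494069422; 3073827701260378; 3001473743716515; 3840612011910144; 1096230592582144;
    7109538313142306; 3417985085079582; 1346028434144256; 7189226976706705; 2856477257891959;
    70589136240647]%positive;
  Design [:: false] 216 [:: (216, 0, 6)] [::
    782444161699328; 530733030440998; 428535887167553; 183697785487423; 1905940870463609;
    2363007567659036; 748652715056128; 459960843501573; 70451048744960]%positive;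
  Design [:: false; true] 220 [:: (220, 0, 11)] [::
    1168855256531004; 1233669951324254; 216543713820753; 915764086311424; 2220206308982970;
    1346358846423193; 954799427420234; 182250652303396; 4714856055570462; 215300830134288]%positive;
  Design [:: false] 225 [:: (225, 0, 5)] [::
    2054441153089024; 5352567733747755; 35942081495114; 2083303182827523; 4117059845488676;
    4119408096837680; 5809084603301966; 5386123065950284; 1416527894806536]%positive;
  Design [:: true] 90 [:: (90, 0, 3); (90, 0, 3); (45, 1, 1); (10, 1, 1)] [::
    4122916066210941; 400237294564537; 7046720015302808; 7117015340548211; 4093429898543147;
    6340148774043758; 6340489687597081; 4653295235235991; 191195616116930; 6659818223042576;
    6763935071993860; 3461680427434217; 3211420926476296; 1696365927989375; 5109733066801307;
    4230945874116757; 1344028596588032; 1548742303202816; 504958902862037; 423818554769440;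
    465603446177953; 639573705359397; 1162278282461330]%positive;
  Design [:: false; true] 240 [:: (240, 0, 4)] [::
    2646952823226390; 3627093205975045; 2758074777731079; 1242181616834048; 573194935730333;
    1346082098925056; 326220774637583; 1766985270296597; 109405617265664]%positive;
  Design [:: false] 100 [:: (100, 0, 5); (100, 0, 5); (20, 1, 1); (25, 1, 1)] [::
    7854789644374628; 7153719992647789; 3710790827507944; 4340073632106496; 7468238555956736;
    5599564470943770; 3532407569383643; 3738964649574538; 7188758345810074; 4046218527514767;
    7222923060644864; 4405764346347667; 6370869330837691; 7502200092773376; 8249715095054336;
    8069815589142536; 1736286356111363; 7468779314348160; 8071124824621224; 3667283872841963;
    4257450906885120; 3805226993451009; 1690647600828928; 3631853079363720; 1309402846202880]%positive;
  Design [:: false] 231 [:: (231, 0, 231); (11, 1, 1); (11, 1, 1); (3, 1, 1)] [::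
    1584344871993551; 8904545529757775; 2163299112452103; 3569923171287042; 6864490807165022;
    8917608788394071; 8382357355364478; 3766323978436618; 3166664137129984; 8135865841746087;
    8906948426858618; 2514309075435547; 1422155675603456; 1070245611569153]%positive;
  Design [:: false; true] 260 [:: (260, 0, 13)] [::
    3388833371020288; 3428437843290624; 5102919503052843; 672728519278724; 2017688013504721;
    1882112028586496; 1656102621020356; 253662246469869; 152839652644352; 3392268434145321;
    188642918669824; 634170175651916]%positive;
  Design [:: true] 264 [:: (264, 0, 11)] [::
    4095206805773824; 1736491932582074; 3527103675891731; 7675019196104797; 2652790070985728;
    6794713210814533; 2578012258454016; 2534374478188032; 2358395310184448; 2441607044136964;
    1869106744131594; 1442719259164688]%positive;
  Design [:: true] 275 [:: (275, 0, 5)] [::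
    1340046848819419; 7781795890462809; 2794567626684928; 2582221081299968; 1275580087029248;
    5668005143904313; 1242325330690256; 3170997084094491; 1481748050875904; 5348442651492426;
    252136126943232]%positive;
  Design [:: false; true] 280 [:: (280, 0, 7)] [::
    749347507798201; 3006900345016832; 534597325029513; 5316980050493498; 2540289971995136;
    328352674087083; 285772772016285; 1811861375310336; 1548470472671238; 1460222470127620;
    352909561430127; 646857919037442]%positive;
  Design [:: false] 120 [:: (120, 0, 6); (120, 0, 6); (40, 1, 1); (5, 1, 1)] [::
    5775757730997880; 6024849568950904; 2939561576034437; 5712405216624668; 7929632829734971;
    4345835960664337; 5191564579832057; 4412015264137459; 4483553281442053; 4379110171738377;
    8840033361461408; 1882596963516437; 4398066145755793; 333926061048079; 8603565805607424;
    4265724744564989; 8708840405598241; 4758502051152098; 5916578516041856; 6274717739384965;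
    6867071553241129; 2437159400505373; 5805857254157824; 4294931462225975; 4627370042539008;
    1804856175886848; 677457151656151; 4267969948680464; 544327247069189]%positive;
  Design [:: false] 231 [:: (231, 0, 231); (11, 1, 1); (11, 1, 1); (11, 1, 1); (11, 1, 1);
    (21, 1, 1)] [::
    3522583941897216; 51682854043921; 368902845497630; 9222637967418368; 9869361633296455;
    9516215032873169; 9729111350050832; 8773239440947200; 9114563706364416; 4942720445972510;
    8982079604785326; 8165054761149440; 8976290693513327; 3252432208945664; 2975285495736320;
    3102831907700743; 1601860430203904; 1166868424968704]%positive;
  Design [:: false; true] 300 [:: (300, 0, 5)] [::
    8660606967349361; 3953722814126080; 3316002823632384; 2017153827733738; 5966300298084389;
    4206183507303424; 1307267655794896; 685483695800377; 4136037168709675; 1059934869389373;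
    1141524941766665; 218428354068623]%positive;
  Design [:: false] 209 [:: (209, 0, 209); (19, 1, 1); (11, 1, 1); (11, 1, 1); (11, 1, 1);
    (11, 1, 1); (11, 1, 1); (11, 1, 1); (11, 1, 1)] [::
    90787454386471; 84877962117382; 157719698604305; 8499991038132245; 227819736006941;
    299776253100286; 121031528808688; 9575115587603968; 10640807270031360; 9750090632396978;
    9621555965329448; 8103202624110603; 87894631645445; 7683607701749785; 8217686028320780;
    8138872330387491; 8094005128855582; 7776264983937114; 7579216763163648; 3068052045824009]%positive;
  Design [:: true] 315 [:: (315, 0, 9)] [::
    2123026512779776; 354483410567338; 10278397236740239; 3358888359144448; 107485485596707;
    4871115296735274; 2326807262003433; 2550466103738370; 2021060896096497; 2259433463238656;
    7881795148447838; 3152718647263266; 1315227330952704; 78037276950657]%positive;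
  Design [:: false] 325 [:: (325, 0, 5)] [::
    371369239904380; 5596817791909950; 3259108205556736; 2822552532025541; 3391446102869504;
    1482849407205555; 7286153391112293; 1914325654831120; 2966827856823296; 547770622803974;
    2268861616106496; 508201744466172; 289034523652096]%positive;
  Design [:: false] 336 [:: (336, 0, 6)] [::
    1950077864378612; 3979349412303360; 5071575694442533; 1735002655555846; 5145508399284264;
    3497691113064448; 10810366929666189; 4720289783218221; 10035530928226426; 3593551147696143;
    4046846817468448; 1939888034619904; 1633669888357888; 1099106997766656]%positive;
  Design [:: false] 405 [:: (405, 0, 9)] [::
    4592264299938157; 3122708794858496; 4840273828905346; 9875005095280738; 465185372635360;
    5370718685007360; 11683320785535118; 157762608955664; 2373447032264192; 3401208121812992;
    2505451206345094; 7426526336778322; 3429181801627654; 9190247942848639; 1630832100639033;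
    3211481982697476; 612753323589877; 746019586310152]%positive;
  Design [:: false] 351 [:: (351, 0, 351); (13, 1, 1); (13, 1, 1); (13, 1, 1); (13, 1, 1);
    (13, 1, 1)] [::
    415504858874259; 13144749792034877; 13765342192916992; 5854713220984832; 12355998009524364;
    6144033084986368; 98168621236622; 12443475046039555; 7685821397991467; 13451229455974578;
    12355183196504163; 45321716236690; 12899762977374315; 6041283478232576; 8486175371165768;
    6903725408124959; 6322818943549463; 4575285802699264; 3843893874138624; 236754919751696;
    4278968182898705; 2221110266429752; 3018851187426304; 1077667693592905]%positive].

Lemma n10_Kdec n : admissible [:: 5; 16] n -> Kdec n10_edges n.
Proof.
by refine (@designs_Kdec n10_edges isT [:: 5; 16] n10_small n10_gdds n10_large isT _ _ _ n); vm_compute. Qed.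

(** Order 20 does not exist for [n13], so groups of size 20 are filled only together with an
    additional point. Orders such as 80, 100, 120 and 140 therefore have entries of their own below,
    with groups of other sizes. *)
Definition n13_small : seq design := [::
  Design [:: false] 21 [:: (21, 0, 21)] [::
    282300285190145]%positive].

Definition n13_gdds : seq design := [::
  Design [:: true] 80 [:: (80, 0, 4)] [::
    1200532084752411; 885047010267648; 1729327650321408]%positive;
  Design [:: true] 100 [:: (100, 0, 5)] [::
    322370733342731; 743135399903261; 668924534863360; 425443510983168]%positive;
  Design [:: true] 120 [:: (120, 0, 6)] [::
    3841769328373760; 3525587672766976; 3030048583712819; 1129349172694528; 2218132251869246]%positive;
  Design [::] 40 [:: (40, 0, 4); (40, 0, 4); (5, 1, 1)] [::
    1903057207852544; 1411911319814228; 2005854159634483; 461589006254163; 2605782849036800;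
    2781904823920128; 457473896764928]%positive;
  Design [::] 40 [:: (40, 0, 4); (40, 0, 4); (10, 1, 1); (5, 1, 1)] [::
    639029261127741; 2569627802554410; 1201361292382293; 321407709872179; 2607291990802522;
    2781077364015197; 2889654410674185; 3064202822680603; 3066813491970067]%positive;
  Design [::] 50 [:: (50, 0, 5); (50, 0, 5); (5, 1, 1)] [::
    2606123627578880; 2783554895872016; 919061413495296; 568870976094235; 1093052271977573;
    1871241570418791; 2117043488030793; 1835644205138019; 920919385833480]%positive;
  Design [::] 50 [:: (50, 0, 5); (50, 0, 5); (10, 1, 1); (5, 1, 1)] [::
    2959070487380080; 358317470278667; 1235452453741570; 182321364100203; 1340239860465777;
    494920649461248; 2996046001078348; 673940768556032; 2853442056355908; 3062279085752419;
    2326363557331036]%positive].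

Definition n13_large : seq design := [::
  Design [:: false] 5 [:: (5, 0, 5); (5, 1, 5); (5, 2, 5); (5, 3, 5); (5, 4, 5)] [::
    740452502339601; 668711514544138; 845937835507723; 844563176751114; 739696449423890;
    246912302448659]%positive;
  Design [:: false] 9 [:: (9, 0, 9); (9, 1, 9); (9, 2, 9); (9, 3, 9)] [::
    951149103944220; 422833901020174; 530106346121216; 353357299721728; 353768007270424;
    915623012730880; 1232554951966722]%positive;
  Design [:: false] 13 [:: (13, 0, 13); (13, 1, 13); (13, 2, 13); (1, 3, 1)] [::
    704651665344512; 388474961664516; 1056083336247322; 36696744017434; 177366720331802;
    1233726009776647]%positive;
  Design [:: false] 41 [:: (41, 0, 41)] [::
    846487329439782; 1373911727213056]%positive;
  Design [:: false] 9 [:: (9, 0, 9); (9, 1, 9); (9, 2, 9); (9, 3, 9); (9, 4, 9)] [::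
    741897892812315; 1022890896527903; 812063028936720; 1093671823867918; 811922371641363;
    423384063148043; 1550109675880960; 740452901847071; 845662158848042; 635380692156431;
    282096147890210]%positive;
  Design [:: false] 11 [:: (11, 0, 11); (11, 1, 11); (11, 2, 11); (11, 3, 11); (11, 4, 11);
    (1, 5, 1)] [::
    142938665129473; 634007107163158; 810891035022884; 810410673979942; 1269523622401587;
    1478987159961616; 422356617282052; 351915805256750; 176684091583543; 1443664010437654;
    953488787920916; 422695659658284; 1021863462199852; 636892252995628]%positive;
  Design [:: false] 39 [:: (39, 0, 39); (3, 1, 1); (3, 1, 1); (3, 1, 1); (3, 1, 1); (3, 1, 1);
    (3, 1, 1); (3, 1, 1)] [::
    2079041069776919; 1339549578952713; 141569649016858; 1761830486692864]%positive;
  Design [:: false] 61 [:: (61, 0, 61)] [::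
    1656965911805954; 144655439364121; 986814653923333]%positive;
  Design [:: false] 13 [:: (13, 0, 13); (13, 1, 13); (13, 2, 13); (13, 3, 13); (13, 4, 13)] [::
    2044892599571981; 707334949326350; 2114434959160363; 671597870986269; 883393173926966;
    2184873635226624; 2077464820973600; 495747948628480; 1901264055846912; 1164597431909376;
    1550044582917120; 564809278947380; 634418888704045; 1972664664588291; 1338456915575296;
    2149065017786370]%positive;
  Design [:: false] 19 [:: (19, 0, 19); (19, 1, 19); (19, 2, 19); (19, 3, 19)] [::
    1480704483684929; 2396322792220223; 1833238484493848; 1904019148912659; 1868281664251419;
    2432610570355712; 953764200852480; 2606058394103296; 1130572972294211; 813369906429955;
    1657173684261376; 2324238606794754; 847176542981632; 1973356819385344; 462212441047045]%positive;
  Design [:: false] 11 [:: (11, 0, 11); (11, 1, 11); (11, 2, 11); (11, 3, 11); (11, 4, 11);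
    (11, 5, 1); (11, 5, 1); (1, 5, 1); (1, 5, 1); (1, 5, 1)] [::
    1688852686459981; 1620543380397134; 1725615192155727; 1761143565328957; 1585015010107453;
    1795023470876232; 388402894097987; 1797980821659203; 105971883193929; 846419284224583;
    1163630525813835; 108439616114250; 1162395191615045; 1690779922216516; 390535336716870;
    950256821605448; 1271042825539112; 391365752528404; 918993360926239; 1552380633049645;
    179983699416072; 1129479237565479; 72090629210127; 741281837121563; 1513203146190901;
    1619650827812362]%positive;
  Design [:: false] 17 [:: (17, 0, 17); (17, 1, 17); (17, 2, 17); (17, 3, 17); (17, 4, 17)] [::
    1056909317391399; 740521495756820; 1303819201019963; 739704098538506; 318931925502498;
    1055884301338624; 671119259768388; 1762522105681459; 565702088746564; 497806444891187;
    563849627739699; 598343458252357; 1654082912413265; 1760251026630223; 1092508156193331;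
    107965565396557; 1619175838869031; 2815309192652851; 216473733719585; 2359284878829073;
    2221642313121280]%positive;
  Design [:: false] 19 [:: (19, 0, 19); (19, 1, 19); (19, 2, 19); (19, 3, 19); (19, 4, 19);
    (1, 5, 1)] [::
    1972738615430222; 2679446231347775; 1094369366017081; 2923403191808548; 1940783118417967;
    2782736849305670; 1619930135920704; 1941473140963840; 2921818090667520; 2467863118217236;
    2395843906764832; 2147836112666676; 1482908475592192; 2639034351353869; 3063731173460480;
    1588180279623684; 2535064070520908; 2079592049279060; 2010941816832095; 1519186193431552;
    2679653188511324; 1061377297088546; 1023717671960626; 1691946408214579]%positive;
  Design [:: false] 75 [:: (75, 0, 3); (25, 1, 1)] [::
    2221426355732573; 352335096709152; 1940167614005277; 1338586822344788; 3204597912213504]%positive;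
  Design [:: false] 69 [:: (69, 0, 69); (3, 1, 1); (3, 1, 1); (3, 1, 1); (3, 1, 1); (3, 1, 1);
    (3, 1, 1); (3, 1, 1); (3, 1, 1); (3, 1, 1); (3, 1, 1); (3, 1, 1); (3, 1, 1)] [::
    1446072824118272; 2187902785159187; 40214585933835; 3453430602924040; 2710580041387520;
    182736500817972; 674629991530531]%positive;
  Design [:: false] 29 [:: (29, 0, 29); (29, 1, 29); (29, 2, 29); (29, 3, 29)] [::
    2854753652489786; 3805972674919011; 3033629240605291; 1518362489797181; 2042695186408960;
    1129271744790604; 2466491554594860; 2641041703305314; 1128520936587378; 3030534972556800;
    2890414076461167; 2431516702408816; 3274838622076982; 1589151733383269; 2254287815573571;
    2610805551926784; 3770435581253632; 285331745931278; 2010668540889600; 1586252241436767;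
    2005726128766987; 3696915120652301; 392663226646589]%positive;
  Design [:: false] 99 [:: (99, 0, 99); (3, 1, 1); (3, 1, 1); (3, 1, 1); (3, 1, 1); (3, 1, 1);
    (3, 1, 1); (3, 1, 1)] [::
    2925333393984000; 529624228954142; 3561664449872896; 1517606859197952; 1341410898346001;
    3100705740029960; 144806580846606]%positive;
  Design [:: false] 125 [:: (125, 0, 5)] [::
    2538853556316160; 4152313315590153; 2428619197251591; 1344775094796362; 4333388759826449]%positive;
  Design [:: false] 27 [:: (27, 0, 27); (27, 1, 27); (27, 2, 27); (27, 3, 27); (27, 4, 27);
    (1, 5, 1)] [::
    1128038954986535; 2291674320221752; 2783635160750115; 2049711031771163; 2119112471126658;
    2084824936363581; 1309454758101019; 3878812759402065; 2640905072845404; 2255590546473021;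
    3559681945239641; 2255791193111552; 2363200275742822; 2962227547340893; 2044614371180593;
    2606334072116224; 1867256506351730; 1412406865821831; 3030198628965888; 1164743071236203;
    2957354917953646; 3697804732792944; 4402723354113024; 3626815888294019; 2962015906168964;
    2788293871665184; 3949872593764358; 3169696479974400; 4614659312713733; 2857980229844996;
    4083671170549248; 3065861080875019; 1865807645638657; 324850545355776]%positive;
  Design [:: true] 140 [:: (140, 0, 7)] [::
    145623043014715; 4047719461036544; 2956871857864750; 1909371225773056; 1167620969595904;
    3417429379936768]%positive;
  Design [:: false] 99 [:: (99, 0, 99); (11, 1, 1); (3, 1, 1); (3, 1, 1); (3, 1, 1); (3, 1, 1);
    (3, 1, 1); (3, 1, 1); (3, 1, 1); (3, 1, 1); (3, 1, 1); (3, 1, 1)] [::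
    4125104180561920; 458089007939693; 1627706323894307; 3808915113115716; 3801910299328519;
    2393363962658885; 2824319108644883; 1764662624911412; 2292214413712896]%positive;
  Design [:: true] 144 [:: (144, 0, 6)] [::
    2296749743694848; 3841768545321040; 533818292830285; 2226316441550883; 4723651632693307;
    2392617194361344]%positive;
  Design [:: true] 60 [:: (60, 0, 3); (60, 0, 3); (20, 1, 1); (15, 1, 1)] [::
    2572662615079048; 3562848537280582; 2398673773789266; 4648957187266560; 2994882591850510;
    2187358151114774; 5285981492610048; 3458325118463488; 2152928617168901; 4686615046793216;
    4967944671461401; 5357042790039580; 4013973520253053; 4513771604148243; 5386246573003776]%positive;
  Design [:: false; true] 160 [:: (160, 0, 4)] [::
    427508870152303; 145274888781871; 2991569164566558; 1764582642423296; 422561182122103;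
    2219522880966144]%positive;
  Design [:: false] 60 [:: (60, 0, 3); (60, 0, 3); (20, 1, 1); (15, 1, 1); (10, 1, 1)] [::
    5428910340702240; 352951556929697; 5217057195718741; 1453231859333193; 1059732484290610;
    960990216484866; 5491927442850876; 2892615280034364; 5208804024454204; 852338014713989;
    3739456792721413; 887592725774467; 3598582805430348; 3315516958111232; 2923138371027050;
    5208392373963264; 4081540858118157]%positive;
  Design [:: true] 175 [:: (175, 0, 5)] [::
    819342866947072; 500224818454016; 2756213395685402; 5742218145704448; 2683929107387392;
    5919634003066919; 3211004811149319]%positive;
  Design [:: true] 180 [:: (180, 0, 9)] [::
    1589434164445222; 504063024693322; 5108834654513664; 4088754284789797; 4891315600359481;
    919061665426432; 5771968474784256; 3169961323266067]%positive;
  Design [:: false] 159 [:: (159, 0, 159); (3, 1, 1); (3, 1, 1); (3, 1, 1); (3, 1, 1); (3, 1, 1);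
    (3, 1, 1); (3, 1, 1)] [::
    4901491206030336; 2929789416243322; 2325880894390406; 4158716038348815; 5458478799005184;
    1129272675749888; 356325135564288; 3913310483516416; 3354288531708416; 6239607042885120]%positive;
  Design [:: false] 80 [:: (80, 0, 4); (80, 0, 4); (20, 1, 1); (5, 1, 1)] [::
    4443825398612132; 3316070596486144; 5179885881925120; 2650448250283520; 6227841263861898;
    44758276262400; 2502076438413433; 6238643750716928; 359690500579840; 925125528794624;
    3280541933371575; 4787689869803700; 248650453221397; 2684060259057765; 5640439247929481;
    2860192446021763; 5568145819476128]%positive;
  Design [:: false] 171 [:: (171, 0, 171); (19, 1, 1); (3, 1, 1); (3, 1, 1)] [::
    396112503767052; 5038101096038462; 3488479683295232; 3003799768399997; 1979674311547392;
    5777870706442259; 3000180306346058; 1659440918692016; 1549717631664290; 5289293451624461;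
    4646399407816886]%positive;
  Design [:: false; true] 200 [:: (200, 0, 5)] [::
    5043872736215046; 5321848104681600; 2579614807097380; 4053361474928652; 6132541816046080;
    5951801400492155; 2754422421857792; 294607402834432]%positive;
  Design [:: false] 80 [:: (80, 0, 4); (80, 0, 4); (20, 1, 1); (20, 1, 1); (5, 1, 1)] [::
    1308905693568080; 1800681682935889; 6475162775234128; 150509899784393; 5180855843856486;
    2288992381608129; 5320766329192557; 3490617922945190; 3422580950696111; 924837602394282;
    1347875247053312; 3350160170639872; 950465149093376; 5249688359927970; 4855521354797056;
    5594458796327083; 4305231095529475; 4928497149804747; 6340474211139727; 3589837964968132;
    7006229033650688]%positive;
  Design [:: false] 216 [:: (216, 0, 6)] [::
    2227139338829996; 7178509439467621; 964624472080517; 2852296506998810; 389049302122500;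
    1069214712463437; 5004783841202176; 2254206901158023; 4620153108824066]%positive;
  Design [:: true] 220 [:: (220, 0, 11)] [::
    3562899929038910; 7533511153025207; 6093436941500491; 2442164331610117; 2372212226280448;
    6900333160745472; 6797947269808314; 4022225889678848; 5845493340969472; 256324455890979]%positive;
  Design [:: false] 160 [:: (160, 0, 4); (40, 1, 1); (20, 1, 1)] [::
    3770645370634444; 5319579715601920; 4160698220111360; 3810516502839387; 7570280505230848;
    1840241705484466; 776693846114353; 362638472999424; 4154117923536915; 7108968403520000;
    4719322050068653; 3597141559562240]%positive;
  Design [:: false] 225 [:: (225, 0, 5)] [::
    3385195298291799; 4792162394086912; 3977975225384979; 2639796153614403; 3599262605916160;
    3105791696734208; 1314071185981441; 1380253920663040; 1407787656544313]%positive;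
  Design [:: false] 171 [:: (171, 0, 171); (19, 1, 1); (19, 1, 1); (3, 1, 1); (3, 1, 1);
    (3, 1, 1); (3, 1, 1); (3, 1, 1); (3, 1, 1); (3, 1, 1); (3, 1, 1); (3, 1, 1)] [::
    5955261453828134; 3885977312200192; 3427455212978184; 7860892905242680; 1844652780326400;
    4577479127466083; 5531721134073856; 3809968509681755; 2543261961945259; 5246958510538934;
    4340348088221712; 4126881497481416; 987242265411072; 1799836268495056; 3389258429205504]%positive;
  Design [:: false; true] 240 [:: (240, 0, 4)] [::
    4333943748821086; 2087920129277986; 3350146036531338; 2648268435136000; 4295656557248565;
    5105170243387451; 3604338866126883; 3390690812493878; 1455292682865664]%positive;
  Design [:: false] 100 [:: (100, 0, 5); (100, 0, 5); (20, 1, 1); (25, 1, 1)] [::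
    4688538018056292; 6766208710396148; 5743185604238848; 8102865334437376; 4624893828661441;
    8342768512144896; 3600296357406208; 6026232274641408; 5328196875583501; 6904468650609664;
    3102479888416822; 5957323120445440; 3918823379981824; 6735434463842304; 6385075451342336;
    1556801674295296; 2322249769287892; 7741327064282724; 850481776216275; 4905911114057874;
    6370186130409496; 5360144578562261; 3562376392343661; 1029162491445450; 432338948063441]%positive;
  Design [:: false] 231 [:: (231, 0, 231); (11, 1, 1); (11, 1, 1); (3, 1, 1)] [::
    8908597323628771; 2076506276791808; 5959847904280703; 6161006343749668; 7108137647603800;
    3918322577965057; 6102634094395508; 1307047863255133; 670666287218771; 3811549676830964;
    6699809474871315; 4446769082007789; 6030646816538774; 6617852072547840]%positive;
  Design [:: true] 260 [:: (260, 0, 13)] [::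
    9125820638429204; 5922387851477104; 6384740812998144; 6867506602967082; 215244889131520;
    1867315288473696; 5003949261193458; 434271147524157; 7355551390650368; 4754152726986767;
    1874273407074307; 1237033852076077]%positive;
  Design [:: false] 195 [:: (195, 0, 3); (65, 1, 1)] [::
    3393256939585585; 1977914203570198; 1618995483246636; 8622805349935104; 5631440895456768;
    3885223957758016; 3880061826236612; 3425747799113948; 636925329801329; 6557376820019211;
    7405281830502533; 3876741146214615; 1489840035332332]%positive;
  Design [:: true] 264 [:: (264, 0, 11)] [::
    9009747308838987; 3312210498814202; 9117990496764038; 8842273208926452; 2296684565521920;
    6021570591195149; 3946289249927168; 1522897623973937; 3283639163944981; 7890669103742977;
    5819304362115222; 8347716835356672]%positive;
  Design [:: true] 275 [:: (275, 0, 5)] [::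
    9192148113817688; 9082324696170557; 3976063892091392; 565637040056832; 9546603812624384;
    474655000388096; 2750085036769511; 5082591872942086; 4626896932044917; 5362333136719360;
    8390453667051520]%positive;
  Design [:: false; true] 280 [:: (280, 0, 7)] [::
    6138588783181834; 5118852234215511; 5988861464805402; 2368691845464202; 7724085974441984;
    4300276854967296; 179181394591766; 1807481035302912; 6308385754712576; 7405761171554337;
    2111691452842008; 5211972917794304]%positive;
  Design [:: false] 249 [:: (249, 0, 249); (3, 1, 1); (3, 1, 1); (3, 1, 1); (3, 1, 1); (3, 1, 1);
    (3, 1, 1); (3, 1, 1); (3, 1, 1); (3, 1, 1); (3, 1, 1); (3, 1, 1); (3, 1, 1)] [::
    1352545667907659; 4650548875249664; 119503756460178; 1662568424017408; 8488255286950400;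
    3239725705736192; 9511614356914201; 1844050145315328; 7535091434914009; 1555020320080032;
    1213963530404019; 355248594485421; 8773769133298688; 3917920044586496; 9306419707264512;
    9729672789640704]%positive;
  Design [:: false] 231 [:: (231, 0, 231); (11, 1, 1); (11, 1, 1); (11, 1, 1); (11, 1, 1);
    (21, 1, 1)] [::
    7681130941645045; 2089773407431168; 39594696376345; 4727626382966835; 2359244900794449;
    1274891587556352; 2969106496880831; 7824895839568139; 580164192567396; 5959495218364670;
    9057436686879744; 1412888033231140; 2789567301681223; 4610056189640983; 5777246691262750;
    6384001554579689; 5108911855108111; 6192682137671168]%positive;
  Design [:: false; true] 300 [:: (300, 0, 5)] [::
    2834134583214251; 4407609578225787; 4659943556513866; 8280577784676549; 7472576855022080;
    3000915335053349; 9617854945037312; 8489128373005312; 4931131420704782; 89419617402883;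
    3535840440221703; 574429328310510]%positive;
  Design [:: false] 209 [:: (209, 0, 209); (19, 1, 1); (11, 1, 1); (11, 1, 1); (11, 1, 1);
    (11, 1, 1); (11, 1, 1); (11, 1, 1); (11, 1, 1)] [::
    10151815439191552; 2964215995564278; 4133302324166727; 5573234461886464; 926620045803750;
    1238153762177071; 4934200033280252; 8624996726716416; 3696103669104865; 9014348385991680;
    5031793784520922; 6695552854786311; 2539220670087302; 6377186415345968; 6375797014814208;
    2260693695332396; 6697333640135680; 6371946816864540; 5461490956765696; 1803064854184211]%positive;
  Design [:: true] 315 [:: (315, 0, 9)] [::
    8456490265084134; 4718903569713152; 4942620327936053; 2829686372565016; 1619875272355328;
    6336427148181573; 6171246723072006; 602080671957008; 9517038448672913; 2694906525515886;
    8698721860321578; 5672058292535325; 6093427810238483; 1668097008730145]%positive;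
  Design [:: false] 325 [:: (325, 0, 5)] [::
    7020562427471872; 9398585419416064; 2835783566229578; 6792509892591748; 6937392036459520;
    5790098617008316; 5175093656339968; 5361219800924399; 7709106898731010; 4861078946185227;
    10045304150425601; 565111680934912; 6831499225615872]%positive;
  Design [:: false] 336 [:: (336, 0, 6)] [::
    6341504893190257; 6035456387450368; 2621610910620672; 7441299300679743; 10008383176048758;
    8288497231462524; 8810070140788736; 9903254558765568; 2641171354747179; 7321514193715459;
    6593783055515683; 9230882163654682; 1356111504741888; 9368770090384896]%positive;
  Design [:: false] 255 [:: (255, 0, 3); (85, 1, 1)] [::
    9997180230760960; 11735446801881600; 3319806246518798; 4060294587351308; 8816684328296960;
    894633979474432; 7507745719189572; 8554099743391763; 10846819924049930; 8277764914031616;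
    7793448887517188; 1496887113023495; 9519118336917556; 3628875777573174; 10824079700132037;
    9346693511811584; 8113335941988368]%positive;
  Design [:: false] 405 [:: (405, 0, 9)] [::
    12049566451368022; 13390693361540608; 2642341594399004; 10684177449001984; 6318008106483734;
    4551567574303040; 6277938623545490; 8800512052122624; 11766839272800336; 5667580655443968;
    9535178862755893; 7873125825910272; 5841065134260226; 4973026279162221; 7020634360784896;
    10853665627972096; 1323449648677376; 10742848020808046]%positive;
  Design [:: false] 351 [:: (351, 0, 351); (13, 1, 1); (13, 1, 1); (3, 1, 1); (3, 1, 1);
    (3, 1, 1); (3, 1, 1); (3, 1, 1); (3, 1, 1); (3, 1, 1); (3, 1, 1); (3, 1, 1); (3, 1, 1);
    (3, 1, 1); (3, 1, 1); (3, 1, 1)] [::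
    8148853703847936; 513563363842048; 677560290640120; 10491928055327232; 5424150632464728;
    12210610043093248; 6000365264437258; 160582795526302; 5177348681303040; 5052891641344512;
    5020215519215924; 8709836476776492; 10426307614867469; 10315461876252974; 3098573589124096;
    7509163317657805; 5793277568614753; 5469201583309167; 3466223466316130; 4050838948938103;
    8839122702568448; 11376308193329268; 8023482250559527; 9803003983049216]%positive;
  Design [:: false] 420 [:: (420, 0, 7)] [::
    7002148631051776; 8459750541623299; 13182303859638333; 8009129118400868; 5707302510002280;
    11835967948456031; 2309561023987759; 7089762574282240; 9977297651367975; 7162242605514785;
    4420111308966912; 13525127792427044; 6549393726242846; 14731402310864896; 1389646671773786;
    12324976711434305; 3647460224300544; 13278597035065515]%positive].

Lemma n13_Kdec n : admissible [:: 5; 16; 20] n -> Kdec n13_edges n.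
Proof.
by refine (@designs_Kdec n13_edges isT [:: 5; 16; 20] n13_small n13_gdds n13_large isT _ _ _ n); vm_compute. Qed.

(** * The spectra *)

Lemma design_spectrum s (sP : all (fun p => p.1 != p.2) s) ex n :
    wf_edges s -> simple_edges s -> size s = 10 ->
    (forall m, admissible ex m -> Kdec s m) -> (n \in ex -> ~ Kdec s n) ->
  has_design (graph6 sP) n <-> n %% 20 \in residues /\ n \notin ex.
Proof.
move=> swf ss s10 exK nex; split=> [/(design_Kdec swf ss) Kn|[nr nx]].
  by split; [apply: Kdec_residue Kn | apply/negP => /nex].
by apply: Kdec_design => //; [case: (s) s10 | apply: exK; rewrite /admissible nr].
Qed.

Theorem theorem1p1 (n : nat) :
  [/\ forall G : sgraph 'I_6, [\/ G = n3, G = n6 | G = n10] -> n <> 16 ->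
        (has_design G n <-> n %% 20 \in [:: 0; 1; 5; 16] /\ n <> 5),
      has_design n8 n <->
        n %% 20 \in [:: 0; 1; 5; 16] /\ n \notin [:: 5; 16]
    & has_design n13 n <->
        n %% 20 \in [:: 0; 1; 5; 16] /\ n \notin [:: 5; 16; 20]].
Proof.
split.
- move=> G GE n16.
  (* The order 16 is put among the exceptions of the recursion because it is left undecided here;
     away from 16 the two conditions agree. *)
  have n5 : n <> 5 <-> n \notin [:: 5; 16].
    by rewrite !inE negb_or (introN eqP n16) andbT; split=> /eqP.
  have no5 E : n \in [:: 5; 16] -> ~ Kdec E n.
    by rewrite !inE => /orP[]/eqP // ->; apply: Kdec_not5.
  suff [GK KG] : has_design G n <-> n %% 20 \in residues /\ n \notin [:: 5; 16].
    by split=> [/GK[? /n5]|[? /n5 ?]] //; apply: KG.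
  case: GE => ->.
  + by apply: (@design_spectrum n3_edges) => //; [apply: n3_Kdec | apply: no5].
  + by apply: (@design_spectrum n6_edges) => //; [apply: n6_Kdec | apply: no5].
  by apply: (@design_spectrum n10_edges) => //; [apply: n10_Kdec | apply: no5].
- apply: (@design_spectrum n8_edges) => //; first exact: n8_Kdec.
  by rewrite !inE => /orP[]/eqP ->; [apply: Kdec_not5 | apply: n8_not16].
apply: (@design_spectrum n13_edges) => //; first exact: n13_Kdec.
by rewrite !inE => /or3P[]/eqP ->; [apply: Kdec_not5 | apply: n13_not16 | apply: n13_not20].
Qed.
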